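(* There exist absolute constants $c, C>0$ such that the following holds. Consider a multi-objective LQR instance $(A,B,(Q_i,R_i)_{i\in[m]},\sigma)$ satisfying the standing assumption in the context, with the quantities $\Gamma,\overline\gamma,\overline\tau$ defined in the context. Let $\epsilon>0$ satisfy $$\epsilon \le c\,\frac{(1-\overline\gamma^2)^4}{\overline\tau^4}\,\Gamma^{-17},$$ and let $\widehat A\in\mathbb R^{n\times n}$, $\widehat B\in\mathbb R^{n\times d}$ satisfy $\|\widehat A-A\|\le\epsilon$, $\|\widehat B-B\|\le\epsilon$, with $(\widehat A,\widehat B)$ stabilizable. Let $N_\epsilon\subseteq\Delta([m])$ be an $\epsilon$-net of $\Delta([m])$ in $\ell_1$ (for every $w\in\Delta([m])$ there is $w_\epsilon\in N_\epsilon$ with $\|w-w_\epsilon\|_1\le\epsilon$), and let $\widehat{\mathsf{PF}}_\epsilon(\mathcal S)=\{\widehat K_{w_\epsilon}:w_\epsilon\in N_\epsilon\}$, where $\widehat K_{w}$ minimizes $\widehat{\mathcal L}_{w}$. Then for every Pareto optimal $K\in\mathsf{PF}(\mathcal S)$ there exists $\widehat K_\epsilon\in\widehat{\mathsf{PF}}_\epsilon(\mathcal S)$ such that $\widehat K_\epsilon$ stabilizes the true dynamics, i.e. $\rho(A+B\widehat K_\epsilon)<1$, and $$\|\vec{\mathcal L}(K)-\vec{\mathcal L}(\widehat K_\epsilon)\|_\infty\le C\,\sigma^2 n\,\Gamma^{29}\,\frac{\overline\tau^8}{(1-\overline\gamma^2)^4}\,\epsilon .$$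
   Context: Matrix norms are spectral operator norms; $\rho(\cdot)$ is spectral radius, $\sigma_{\min}(\cdot)$ the smallest singular value; $\|M\|_+=1+\|M\|$; $[m]=\{1,\dots,m\}$; $\Delta([m])=\{w\in\mathbb R^m_{\ge0}:\|w\|_1=1\}$. Setting. $A\in\mathbb R^{n\times n}$, $B\in\mathbb R^{n\times d}$ with $n\ge d$; symmetric cost matrices $Q_i\in\mathbb R^{n\times n}$, $R_i\in\mathbb R^{d\times d}$, $i\in[m]$; $\sigma>0$. Standing assumption: $(A,B)$ is stabilizable, each $Q_i$ and $R_i$ is positive definite, and $\sigma_{\min}(Q_i),\sigma_{\min}(R_i)\ge1$ for all $i$. The set of stabilizing controls is $\mathcal S=\{K\in\mathbb R^{d\times n}:\rho(A+BK)<1\}$. For $K\in\mathcal S$ define $$\mathcal L(K,Q,R)=\lim_{T\to\infty}\mathbb E\Big[\frac1T\sum_{t=0}^T (x_t^\top Qx_t+u_t^\top Ru_t)\Big],\quad x_{t+1}=Ax_t+Bu_t+\xi_t,\ u_t=Kx_t,$$ where $x_0\sim N(0,I_n)$ and the $\xi_t\sim N(0,\sigma^2I_n)$ are independent of each other and of $x_0$. Write $\mathcal L_i(K)=\mathcal L(K,Q_i,R_i)$ and $\vec{\mathcal L}(K)=(\mathcal L_1(K),\dots,\mathcal L_m(K))$. The loss $\widehat{\mathcal L}(K,Q,R)$ is defined in the same way with $(A,B)$ replaced by $(\widehat A,\widehat B)$ (for $K$ with $\rho(\widehat A+\widehat BK)<1$). Pareto optimality. $K\in\mathcal S$ is Pareto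 optimal if there is no $K'\in\mathcal S$ with $\mathcal L_i(K')\le\mathcal L_i(K)$ for all $i$ and $\mathcal L_j(K')<\mathcal L_j(K)$ for some $j$; $\mathsf{PF}(\mathcal S)$ is the set of Pareto optimal controls. Scalarization. $\mathsf{dare}(A,B,Q,R)$ denotes the unique positive semidefinite solution $P$ of $P=A^\top PA-A^\top PB(R+B^\top PB)^{-1}B^\top PA+Q$. For $w\in\Delta([m])$: $Q_w=\sum_iw_iQ_i$, $R_w=\sum_iw_iR_i$, $P_w=\mathsf{dare}(A,B,Q_w,R_w)$, $K_w=-(R_w+B^\top P_wB)^{-1}B^\top P_wA$, and $\widehat{\mathcal L}_w(K)=\widehat{\mathcal L}(K,Q_w,R_w)$. The minimizer $\widehat K_w$ of $\widehat{\mathcal L}_w$ (over controls stabilizing $(\widehat A,\widehat B)$) is $-(R_w+\widehat B^\top \widehat P\widehat B)^{-1}\widehat B^\top \widehat P\widehat A$ with $\widehat P=\mathsf{dare}(\widehat A,\widehat B,Q_w,R_w)$. Constants. $P_{\max}=\sup_{w\in\Delta([m])}\|P_w\|$, $K_{\max}=\sup_{w\in\Delta([m])}\|K_w\|$, $$\Gamma=\max\{1+P_{\max},\,1+K_{\max},\,\|A\|_+,\,\|B\|_+,\,\max_i\|Q_i\|,\,\max_i\|R_i\|,\,1+m\max_i\|R_i^{-1}\|\}.$$ For a square matrix $L$ and $\rho>0$, $\tau(L,\rho)=\sup_{k\ge0}\|L^k\|\rho^{-k}$. The numbers $\overline\gamma\in(0,1)$ and $\overline\tau<\infty$ are fixed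 constants such that $\rho(A+BK_w)\le\overline\gamma$ and $\tau(A+BK_w,\overline\gamma)\le\overline\tau$ for all $w\in\Delta([m])$ (such constants exist). *)

(* Defs.v *)
From mathcomp Require Import all_boot all_order all_algebra finmap.
From mathcomp Require Import all_classical all_reals all_analysis.
From mathcomp Require Import complex.

Set Implicit Arguments.
Unset Strict Implicit.
Unset Printing Implicit Defensive.

Import Order.TTheory GRing.Theory Num.Theory.
Import numFieldNormedType.Exports.

Local Open Scope classical_set_scope.
Local Open Scope ring_scope.

Section MatrixNotions.
Variable R : realType.

Definition l1norm m (w : 'rV[R]_m) : R := \sum_i `|w 0 i|.

Definition l2norm n (x : 'cV[R]_n) : R := Num.sqrt (\sum_i x i 0 ^+ 2).

Definition opnorm p q (M : 'M[R]_(p, q)) : R :=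
  sup [set l2norm (M *m x) | x in [set x : 'cV[R]_q | l2norm x <= 1]].

(* The singular values are the square roots of the eigenvalues of M^T M. *)
Definition sigma_min p q (M : 'M[R]_(p, q)) : R :=
  inf [set s : R | 0 <= s /\ eigenvalue (M^T *m M) (s ^+ 2)].

(* The eigenvalues are the complex ones, hence the embedding into R[i], whose
   norm is itself R[i]-valued. *)
Definition spectral_radius n (M : 'M[R]_n) : R :=
  sup [set r : R | exists2 z : R[i],
         eigenvalue (map_mx (real_complex R) M) z & `|z| = real_complex R r].

(* Extended-real valued: the supremum may be infinite, and the real-valued
   [sup] of an unbounded set is 0. *)
Definition tau n (L : 'M[R]_n) (rho : R) : \bar R :=
  ereal_sup [set (opnorm (L ^+ k) * rho ^- k)%:E | k in [set: nat]].

Definition quad n (M : 'M[R]_n) (x : 'cV[R]_n) : R := (x^T *m M *m x) 0 0.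

Definition posdefmx n (M : 'M[R]_n) : Prop :=
  M^T = M /\ forall x : 'cV[R]_n, x != 0 -> 0 < quad M x.

Definition possemidefmx n (M : 'M[R]_n) : Prop :=
  M^T = M /\ forall x : 'cV[R]_n, 0 <= quad M x.

Definition simplex m : set 'rV[R]_m :=
  [set w : 'rV[R]_m | (forall i, 0 <= w 0 i) /\ l1norm w = 1].

Definition l1_net m (eps : R) (N : set 'rV[R]_m) : Prop :=
  N `<=` @simplex m /\
  forall w : 'rV[R]_m, simplex w -> exists2 v : 'rV[R]_m, N v & l1norm (w - v) <= eps.

End MatrixNotions.

Section Noise.
Context d (T : measurableType d) (R : realType) (P : probability T R).

Definition mutually_independent (I : choiceType) (F : I -> set (set T)) : Prop :=
  forall (J : {fset I}) (E : I -> set T),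
    (forall i, i \in J -> F i (E i)) ->
    P (\bigcap_(i in [set` J]) E i) = (\prod_(i <- J) P (E i))%E.

Definition sigma_of_rv (X : {RV P >-> R}) : set (set T) :=
  preimage_set_system setT X measurable.

Definition random_vector n := 'I_n -> {RV P >-> R}.

Definition sigma_of_rvec n (X : random_vector n) : set (set T) :=
  <<s \bigcup_i sigma_of_rv (X i) >>.

(* X ~ N(0, s^2 I_n); [normal_prob] takes the standard deviation. *)
Definition isotropic_gaussian n (s : R) (X : random_vector n) : Prop :=
  mutually_independent (fun i => sigma_of_rv (X i)) /\
  forall i (V : set R), measurable V -> distribution P (X i) V = normal_prob 0 s V.

Definition lqr_noise n (sigma : R) (x0 : random_vector n)
    (xi : nat -> random_vector n) : Prop :=
  [/\ isotropic_gaussian 1 x0,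
      forall t, isotropic_gaussian sigma (xi t) &
      mutually_independent
        (fun t : nat => sigma_of_rvec (if t is t'.+1 then xi t' else x0))].

(* [R] is the field of reals, so control cost matrices are named [S]. *)
Section Cost.
Variables (n p : nat) (x0 : random_vector n) (xi : nat -> random_vector n).
Variables (A : 'M[R]_n) (B : 'M[R]_(n, p)).

Fixpoint state (K : 'M[R]_(p, n)) (t : nat) (omega : T) : 'cV[R]_n :=
  if t is t'.+1 then
    A *m state K t' omega + B *m (K *m state K t' omega)
    + \col_i xi t' i omega
  else \col_i x0 i omega.

Definition average_cost (K : 'M[R]_(p, n)) (Q : 'M[R]_n) (S : 'M[R]_p)
    (N : nat) (omega : T) : R :=
  N%:R^-1 * \sum_(0 <= t < N.+1)
    (quad Q (state K t omega) + quad S (K *m state K t omega)).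

Definition lqr_loss (K : 'M[R]_(p, n)) (Q : 'M[R]_n) (S : 'M[R]_p) : \bar R :=
  limn (fun N => 'E_P[average_cost K Q S N])%E.

Definition stabilizing : set 'M[R]_(p, n) :=
  [set K | spectral_radius (A + B *m K) < 1].

Definition lqr_minimizer (Q : 'M[R]_n) (S : 'M[R]_p) : set 'M[R]_(p, n) :=
  [set K | stabilizing K /\
     forall K', stabilizing K' -> (lqr_loss K Q S <= lqr_loss K' Q S)%E].

Definition pareto_front m (Q : 'I_m -> 'M[R]_n) (S : 'I_m -> 'M[R]_p) :
    set 'M[R]_(p, n) :=
  [set K | stabilizing K /\
     ~ exists K', [/\ stabilizing K',
         forall i, (lqr_loss K' (Q i) (S i) <= lqr_loss K (Q i) (S i))%E &
         exists j, (lqr_loss K' (Q j) (S j) < lqr_loss K (Q j) (S j))%E]].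

End Cost.
End Noise.

Section Scalarization.
Variables (R : realType) (n p : nat) (A : 'M[R]_n) (B : 'M[R]_(n, p)).

Definition stabilizable : Prop := exists K, stabilizing A B K.

Definition riccati (Q : 'M[R]_n) (S : 'M[R]_p) (X : 'M[R]_n) : Prop :=
  X = A^T *m X *m A
      - A^T *m X *m B *m invmx (S + B^T *m X *m B) *m B^T *m X *m A + Q.

(* The positive semidefinite solution (unique in the setting considered). *)
Definition dare (Q : 'M[R]_n) (S : 'M[R]_p) : 'M[R]_n :=
  xget 0 [set X | possemidefmx X /\ riccati Q S X].

Definition dare_gain (Q : 'M[R]_n) (S : 'M[R]_p) : 'M[R]_(p, n) :=
  - (invmx (S + B^T *m dare Q S *m B) *m B^T *m dare Q S *m A).

End Scalarization.

Definition wsum (R : realType) (m k : nat) (w : 'rV[R]_m) (M : 'I_m -> 'M[R]_k) :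
  'M[R]_k := \sum_i w 0 i *: M i.

Section Constants.
Variables (R : realType) (n p m : nat) (A : 'M[R]_n) (B : 'M[R]_(n, p)).
Variables (Q : 'I_m -> 'M[R]_n) (S : 'I_m -> 'M[R]_p).

Definition P_scal (w : 'rV[R]_m) : 'M[R]_n := dare A B (wsum w Q) (wsum w S).
Definition K_scal (w : 'rV[R]_m) : 'M[R]_(p, n) := dare_gain A B (wsum w Q) (wsum w S).

Definition P_max : R := sup [set opnorm (P_scal w) | w in @simplex R m].
Definition K_max : R := sup [set opnorm (K_scal w) | w in @simplex R m].

Definition Gamma : R :=
  \big[Num.max/0]_(x <- [:: 1 + P_max; 1 + K_max; 1 + opnorm A; 1 + opnorm B;
      \big[Num.max/0]_i opnorm (Q i);
      \big[Num.max/0]_i opnorm (S i);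
      1 + m%:R * \big[Num.max/0]_i opnorm (invmx (S i))]) x.

End Constants.

Section EstimatedFront.
Context d (T : measurableType d) (R : realType) (P : probability T R).
Variables (n p m : nat) (x0 : random_vector P n) (xi : nat -> random_vector P n).
Variables (Q : 'I_m -> 'M[R]_n) (S : 'I_m -> 'M[R]_p).

Definition PF_hat (Ahat : 'M[R]_n) (Bhat : 'M[R]_(n, p)) (N : set 'rV[R]_m) :
    set 'M[R]_(p, n) :=
  [set K | exists2 w, N w &
     lqr_minimizer x0 xi Ahat Bhat (wsum w Q) (wsum w S) K].

Definition loss_dist (A : 'M[R]_n) (B : 'M[R]_(n, p)) (K K' : 'M[R]_(p, n)) : \bar R :=
  \big[maxe/0%E]_i
    `|lqr_loss x0 xi A B K (Q i) (S i) - lqr_loss x0 xi A B K' (Q i) (S i)|%E.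

End EstimatedFront.

(* Main.v *)
(* For a stabilizing gain K with closed loop L = A + BK, the loss is v tr P, where
   v is the second moment of the noise and P = L^T P L + Q + K^T R K. The exact change
   of tr P under a change D of the gain is linear plus quadratic in D, with linear
   part 2 <D, E Sigma>; here E = RK + B^T P L and Sigma is the stationary covariance
   for unit noise. If no convex combination of the matrices E_i Sigma vanished, the
   point of minimal norm of their convex hull would give a direction improving all
   the losses at once; so a Pareto optimal K satisfies E = 0 for some weight w, that
   is, K = K_w. The same argument with a single cost shows that the minimizer of the
   estimated problem, which exists by compactness, solves its Riccati equation.

   Since Q_w >= I, the closed loop is contracting in the norm given by P_w, so P_w
   itself bounds the inverse of the Lyapunov operator, and a slight multiple of P_w
   is a supersolution for every nearby system. Comparing the two optimal cost
   matrices both ways gives ||P' - P|| <= 18 Gamma^4 eps, then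
   ||K' - K|| <= 22 Gamma^6 eps from the equations E = 0, then the loss bound with
   Gamma^13. *)

From mathcomp Require Import all_boot all_order all_algebra finmap.
From mathcomp Require Import all_classical all_reals all_analysis.
From mathcomp Require Import measurable_realfun complex ring lra.
Require Import Defs.

Set Implicit Arguments.
Unset Strict Implicit.
Unset Printing Implicit Defensive.

Import Order.TTheory GRing.Theory Num.Theory.
Import numFieldNormedType.Exports.

Local Open Scope ring_scope.

(** * Quadratic forms and operator norms *)

Section QuadraticForms.
Variable R : realType.

(** Stability appears in three forms: spectral radius below 1 in the statements, a geometric bound
    on the powers ([schur]) in limit arguments, and a positive semidefinite Lyapunov supersolution
    as a certificate. The certificate survives small changes of the system, which is how the
    estimated gain is seen to stabilize the true dynamics. It also helps with compactness: the
    stabilizing gains form an open set, but pairs of a gain and a cost matrix of bounded trace form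
    a compact one.

    No derivative is taken. Costs are compared through exact identities, read as inequalities
    between quadratic forms.

    The entry [1 + P_max] of [Gamma] leaves a margin of 1 between [P_w] and [Gamma]. A comparison
    loses a factor slightly above 1, the margin absorbs it, and the estimated cost matrix lies below
    the same [Gamma]. The comparison can then be run backwards with the same constants. *)

Definition sqn n (x : 'cV[R]_n) : R := \sum_i x i 0 ^+ 2.

(* Only the symmetric parts of [X] and [Y] matter. *)
Definition loewner n (X Y : 'M[R]_n) := forall x, quad X x <= quad Y x.

Definition opb p q (M : 'M[R]_(p, q)) (c : R) :=
  forall x, l2norm (M *m x) <= c * l2norm x.

Lemma trmxD p q (M N : 'M[R]_(p, q)) : (M + N)^T = M^T + N^T.
Proof. by apply/matrixP => i j; rewrite !mxE. Qed.

Lemma trmxN p q (M : 'M[R]_(p, q)) : (- M)^T = - M^T.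
Proof. by apply/matrixP => i j; rewrite !mxE. Qed.

Lemma trmxZ p q a (M : 'M[R]_(p, q)) : (a *: M)^T = a *: M^T.
Proof. by apply/matrixP => i j; rewrite !mxE. Qed.

Lemma scalemx_entry p q a (M : 'M[R]_(p, q)) i j : (a *: M) i j = a * M i j.
Proof. by rewrite mxE. Qed.

Lemma sqn_ge0 n (x : 'cV[R]_n) : 0 <= sqn x.
Proof. by apply: sumr_ge0 => i _; exact: sqr_ge0. Qed.

Lemma sqn_eq0 n (x : 'cV[R]_n) : (sqn x == 0) = (x == 0).
Proof.
apply/idP/eqP => [|->]; last first.
  by rewrite /sqn big1// => i _; rewrite mxE expr0n.
rewrite psumr_eq0 => [|i _]; last exact: sqr_ge0.
move=> /allP h; apply/matrixP => i j; rewrite ord1 mxE.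
by have := h i (mem_index_enum _); rewrite sqrf_eq0 => /eqP.
Qed.

Lemma sqn_gt0 n (x : 'cV[R]_n) : x != 0 -> 0 < sqn x.
Proof. by move=> x0; rewrite lt_def sqn_eq0 x0 sqn_ge0. Qed.

Lemma l2norm_ge0 n (x : 'cV[R]_n) : 0 <= l2norm x.
Proof. exact: sqrtr_ge0. Qed.

Lemma sqr_l2norm n (x : 'cV[R]_n) : l2norm x ^+ 2 = sqn x.
Proof. by rewrite sqr_sqrtr// sqn_ge0. Qed.

Lemma dot_sqn n (x : 'cV[R]_n) : (x^T *m x) 0 0 = sqn x.
Proof. by rewrite mxE; apply: eq_bigr => i _; rewrite mxE expr2. Qed.

Lemma dotC n (x y : 'cV[R]_n) : (x^T *m y) 0 0 = (y^T *m x) 0 0.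
Proof. by rewrite -[in LHS](trmxK y) -trmx_mul mxE. Qed.

Lemma sqnZ n a (x : 'cV[R]_n) : sqn (a *: x) = a ^+ 2 * sqn x.
Proof. by rewrite /sqn mulr_sumr; apply: eq_bigr => i _; rewrite mxE exprMn. Qed.

Lemma sqnD n (x y : 'cV[R]_n) :
  sqn (x + y) = sqn x + 2 * (x^T *m y) 0 0 + sqn y.
Proof.
rewrite -!dot_sqn trmxD mulmxDl !mulmxDr mxE [X in X + _]mxE.
rewrite [X in _ + X]mxE [(y^T *m x) 0 0]dotC; ring.
Qed.

Lemma sqnB n (x y : 'cV[R]_n) :
  sqn (x - y) = sqn x - 2 * (x^T *m y) 0 0 + sqn y.
Proof.
by rewrite -[- y]scaleN1r sqnD sqnZ -scalemxAr scalemx_entry; ring.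
Qed.

Lemma l2normZ n a (x : 'cV[R]_n) : l2norm (a *: x) = `|a| * l2norm x.
Proof.
by rewrite /l2norm -/(sqn _) sqnZ sqrtrM ?sqr_ge0// sqrtr_sqr.
Qed.

Lemma dot_le n (x y : 'cV[R]_n) :
  (x^T *m y) 0 0 <= l2norm x * l2norm y.
Proof.
have [->|y0] := eqVneq y 0.
  by rewrite mulmx0 mxE mulr_ge0// l2norm_ge0.
have ly : 0 < l2norm y by rewrite sqrtr_gt0 sqn_gt0.
have := sqn_ge0 (l2norm y *: x + (- l2norm x) *: y).
rewrite sqnD !sqnZ sqrrN !sqr_l2norm trmxZ -scalemxAl -scalemxAr.
rewrite [X in 2 * X]mxE [X in 2 * (_ * X)]mxE -!sqr_l2norm => h.
have [->|x0] := eqVneq x 0.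
  by rewrite trmx0 mul0mx mxE mulr_ge0// l2norm_ge0.
have lx : 0 < l2norm x by rewrite sqrtr_gt0 sqn_gt0.
rewrite -(@ler_pM2l _ (2 * l2norm x * l2norm y)) ?mulr_gt0//; lra.
Qed.

Lemma l2normD n (x y : 'cV[R]_n) : l2norm (x + y) <= l2norm x + l2norm y.
Proof.
rewrite -(@ler_pXn2r _ 2)// ?nnegrE ?addr_ge0 ?l2norm_ge0//.
rewrite sqr_l2norm sqnD sqrrD !sqr_l2norm.
have := dot_le x y; lra.
Qed.

Lemma l2norm_entry n (x : 'cV[R]_n) i : `|x i 0| <= l2norm x.
Proof.
rewrite -sqrtr_sqr ler_sqrt ?sqn_ge0//.
rewrite (bigD1 i)//= lerDl; apply: sumr_ge0 => j _; exact: sqr_ge0.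
Qed.

Lemma l2norm0 n : l2norm (0 : 'cV[R]_n) = 0.
Proof. by apply/eqP; rewrite -sqrf_eq0 sqr_l2norm sqn_eq0. Qed.

Lemma l2norm_delta n i : l2norm (delta_mx i 0 : 'cV[R]_n) = 1.
Proof.
rewrite /l2norm (bigD1 i)//= mxE !eqxx expr1n big1 ?addr0 ?sqrtr1//.
by move=> j ji; rewrite mxE (negbTE ji) expr0n.
Qed.

Lemma sqn_delta n i : sqn (delta_mx i 0 : 'cV[R]_n) = 1.
Proof. by rewrite -sqr_l2norm l2norm_delta expr1n. Qed.

Lemma quadD n (X Y : 'M[R]_n) x : quad (X + Y) x = quad X x + quad Y x.
Proof. by rewrite /quad mulmxDr mulmxDl mxE. Qed.

Lemma quadN n (X : 'M[R]_n) x : quad (- X) x = - quad X x.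
Proof. by rewrite /quad mulmxN mulNmx mxE. Qed.

Lemma quadB n (X Y : 'M[R]_n) x : quad (X - Y) x = quad X x - quad Y x.
Proof. by rewrite quadD quadN. Qed.

Lemma quadZ n a (X : 'M[R]_n) x : quad (a *: X) x = a * quad X x.
Proof. by rewrite /quad -scalemxAr -scalemxAl mxE. Qed.

Lemma quad0 n x : quad (0 : 'M[R]_n) x = 0.
Proof. by rewrite /quad mulmx0 mul0mx mxE. Qed.

Lemma quad_sum n I (r : seq I) (Pr : pred I) (F : I -> 'M[R]_n) x :
  quad (\sum_(i <- r | Pr i) F i) x = \sum_(i <- r | Pr i) quad (F i) x.
Proof.
apply: (big_ind2 (fun M q => quad M x = q)) => //; first exact: quad0.
by move=> M p N q <- <-; exact: quadD.
Qed.

Lemma quad_scalar n a (x : 'cV[R]_n) : quad (a%:M) x = a * sqn x.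
Proof. by rewrite /quad mul_mx_scalar -scalemxAl mxE dot_sqn. Qed.

Lemma quad1 n (x : 'cV[R]_n) : quad 1%:M x = sqn x.
Proof. by rewrite quad_scalar mul1r. Qed.

Lemma quad_congr n p (L : 'M[R]_(p, n)) X x :
  quad (L^T *m X *m L) x = quad X (L *m x).
Proof. by rewrite /quad trmx_mul !mulmxA. Qed.

Lemma quadZr n a (X : 'M[R]_n) x : quad X (a *: x) = a ^+ 2 * quad X x.
Proof.
by rewrite /quad trmxZ -!scalemxAl -scalemxAr scalerA mxE expr2.
Qed.

Lemma quad_mul n p (L M : 'M[R]_(p, n)) x :
  quad (L^T *m M) x = ((L *m x)^T *m (M *m x)) 0 0.
Proof. by rewrite /quad trmx_mul !mulmxA. Qed.

Lemma quadDr n (X : 'M[R]_n) x y : X^T = X ->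
  quad X (x + y) = quad X x + 2 * (x^T *m X *m y) 0 0 + quad X y.
Proof.
move=> sX; rewrite /quad trmxD !mulmxDl !mulmxDr mxE [X in X + _]mxE [X in _ + X]mxE.
have -> : (y^T *m X *m x) 0 0 = (x^T *m X *m y) 0 0.
  by rewrite -mulmxA dotC trmx_mul sX.
ring.
Qed.

Lemma quadBr n (X : 'M[R]_n) x y : X^T = X ->
  quad X (x - y) = quad X x - 2 * (x^T *m X *m y) 0 0 + quad X y.
Proof.
move=> sX; rewrite -[- y]scaleN1r quadDr// quadZr -scalemxAr.
rewrite scalemx_entry; ring.
Qed.

Lemma loewner_trans n (Y X Z : 'M[R]_n) :
  loewner X Y -> loewner Y Z -> loewner X Z.
Proof. by move=> h k x; exact: le_trans (h x) (k x). Qed.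

Lemma loewner_scalar n a b : a <= b -> loewner (a%:M : 'M[R]_n) b%:M.
Proof. by move=> ab x; rewrite !quad_scalar ler_wpM2r// sqn_ge0. Qed.

Lemma quad_delta n (X : 'M[R]_n) i : quad X (delta_mx i 0) = X i i.
Proof. by rewrite /quad trmx_delta -rowE -colE !mxE. Qed.

Lemma loewner_trace n (X Y : 'M[R]_n) : loewner X Y -> \tr X <= \tr Y.
Proof.
by move=> h; apply: ler_sum => i _; have := h (delta_mx i 0); rewrite !quad_delta.
Qed.

Lemma opb_le p q (M : 'M[R]_(p, q)) a b : a <= b -> opb M a -> opb M b.
Proof. by move=> ab h x; rewrite (le_trans (h x))// ler_wpM2r// l2norm_ge0. Qed.

Lemma opbD p q (M N : 'M[R]_(p, q)) a b :
  opb M a -> opb N b -> opb (M + N) (a + b).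
Proof.
move=> h k x; rewrite mulmxDl mulrDl.
by rewrite (le_trans (l2normD _ _))// lerD.
Qed.

Lemma opbM p q r (M : 'M[R]_(p, q)) (N : 'M[R]_(q, r)) a b : 0 <= a ->
  opb M a -> opb N b -> opb (M *m N) (a * b).
Proof.
move=> a0 h k x; rewrite -mulmxA -mulrA.
by rewrite (le_trans (h _))// ler_wpM2l.
Qed.

Lemma opbN p q (M : 'M[R]_(p, q)) a : opb M a -> opb (- M) a.
Proof. by move=> h x; rewrite mulNmx -scaleN1r l2normZ normrN1 mul1r. Qed.

Lemma opbZ p q (M : 'M[R]_(p, q)) a c : opb M a -> opb (c *: M) (`|c| * a).
Proof.
by move=> h x; rewrite -scalemxAl l2normZ -mulrA ler_wpM2l.
Qed.

Lemma opb_sum p q I (r : seq I) (Pr : pred I) (F : I -> 'M[R]_(p, q)) (c : I -> R) :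
  (forall i, Pr i -> opb (F i) (c i)) ->
  opb (\sum_(i <- r | Pr i) F i) (\sum_(i <- r | Pr i) c i).
Proof.
move=> h; apply: (big_ind2 (fun M a => opb M a)) => //.
  by move=> x; rewrite mul0mx mul0r l2norm0.
by move=> M a N b; exact: opbD.
Qed.

Lemma opb_tr p q (M : 'M[R]_(p, q)) a : 0 <= a -> opb M a -> opb M^T a.
Proof.
move=> a0 h x.
have [->|x0] := eqVneq (M^T *m x) 0.
  by rewrite l2norm0 mulr_ge0// l2norm_ge0.
have lx : 0 < l2norm (M^T *m x) by rewrite sqrtr_gt0 sqn_gt0.
rewrite -(ler_pM2l lx) -expr2 sqr_l2norm -dot_sqn trmx_mul trmxK -mulmxA.
apply: (le_trans (dot_le _ _)).
by rewrite mulrC [leRHS]mulrA [_ * a]mulrC ler_wpM2r ?l2norm_ge0.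
Qed.

Lemma opb_loewner n p (M : 'M[R]_(p, n)) c : 0 <= c ->
  opb M c <-> loewner (M^T *m M) (c ^+ 2)%:M.
Proof.
move=> c0; split=> h x; have := h x; rewrite quad_mul quad_scalar dot_sqn -!sqr_l2norm -exprMn.
  by move=> k; rewrite ler_pXn2r// ?nnegrE ?mulr_ge0 ?l2norm_ge0.
by rewrite ler_pXn2r// ?nnegrE ?mulr_ge0 ?l2norm_ge0.
Qed.

Lemma opb_quad n (M : 'M[R]_n) c : opb M c -> loewner M c%:M.
Proof.
move=> h x; rewrite quad_scalar /quad -mulmxA (le_trans (dot_le _ _))//.
by rewrite -sqr_l2norm mulrC expr2 mulrA ler_wpM2r// l2norm_ge0.
Qed.

(* Polarization, then optimization over the relative scaling of the vectors *)
Lemma sym_opb n (X : 'M[R]_n) c : X^T = X ->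
  loewner X c%:M -> loewner (- X) c%:M -> opb X c.
Proof.
move=> sX h k x.
have [->|x0] := eqVneq (X *m x) 0.
  have := le_trans (h x) (lexx _); have := k x.
  rewrite quadN quad_scalar -sqr_l2norm => h1 h2.
  rewrite l2norm0; have [->|lx] := eqVneq x 0; first by rewrite l2norm0 mulr0.
  have lx0 : 0 < l2norm x by rewrite sqrtr_gt0 sqn_gt0.
  by rewrite -(pmulr_lge0 _ lx0) -mulrA -expr2; lra.
have ly : 0 < l2norm (X *m x) by rewrite sqrtr_gt0 sqn_gt0.
have lx : 0 < l2norm x.
  by rewrite sqrtr_gt0 sqn_gt0//; apply: contraNneq x0 => ->; rewrite mulmx0.
set y := l2norm x *: (X *m x); set z := l2norm (X *m x) *: x.
have h1 := h (z + y); have h2 := k (z - y); move: h1 h2.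
rewrite quadN quadDr// quadBr// !quad_scalar.
rewrite sqnD sqnB => h1 h2.
have e1 : (z^T *m X *m y) 0 0 = l2norm x * l2norm (X *m x) ^+ 3.
  rewrite /z /y trmxZ -!scalemxAl -scalemxAr mxE [X in _ * X]mxE.
  rewrite -[X in x^T *m X]sX -trmx_mul dot_sqn -sqr_l2norm; ring.
have e2 : sqn z = l2norm x ^+ 2 * l2norm (X *m x) ^+ 2.
  by rewrite /z sqnZ -sqr_l2norm mulrC.
have e3 : sqn y = l2norm x ^+ 2 * l2norm (X *m x) ^+ 2.
  by rewrite /y sqnZ -sqr_l2norm.
have e4 : 4 * (l2norm x * l2norm (X *m x) ^+ 3) <= 4 * (c * (l2norm x ^+ 2 * l2norm (X *m x) ^+ 2)).
  rewrite -e1 -{1}e2; move: h1 h2; rewrite e2 e3; lra.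
have pos : 0 < 4 * (l2norm x * l2norm (X *m x) ^+ 2) by rewrite !mulr_gt0// exprn_gt0.
rewrite -(ler_pM2l pos); move: e4; lra.
Qed.

Lemma opb_entry p q (M : 'M[R]_(p, q)) c i j : opb M c -> `|M i j| <= c.
Proof.
move=> /(_ (delta_mx j 0)); rewrite l2norm_delta mulr1 -colE.
by apply: le_trans; rewrite (_ : M i j = col j M i 0) ?l2norm_entry// mxE.
Qed.

(** Cauchy-Schwarz row by row. This crude bound makes the set in [opnorm] bounded, so that its [sup]
    is a true supremum, and later turns entrywise decay of powers into decay in norm. *)
Lemma opb_frobenius p q (M : 'M[R]_(p, q)) :
  opb M (Num.sqrt (\sum_i \sum_j M i j ^+ 2)).
Proof.
move=> x; rewrite /l2norm -sqrtrM; last first.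
  by apply: sumr_ge0 => i _; apply: sumr_ge0 => j _; exact: sqr_ge0.
rewrite ler_sqrt ?mulr_ge0 ?sqn_ge0//; last first.
  by apply: sumr_ge0 => i _; apply: sumr_ge0 => j _; exact: sqr_ge0.
rewrite mulr_suml; apply: ler_sum => i _.
have -> : (M *m x) i 0 = (((row i M)^T)^T *m x) 0 0.
  by rewrite trmxK !mxE; apply: eq_bigr => j _; rewrite mxE.
have -> : \sum_j M i j ^+ 2 = sqn (row i M)^T.
  by apply: eq_bigr => j _; rewrite !mxE.
rewrite -/(sqn x) -!sqr_l2norm -exprMn -[leLHS]real_normK ?num_real//.
rewrite ler_pXn2r ?nnegrE ?mulr_ge0 ?l2norm_ge0//.
rewrite ler_norml dot_le andbT lerNl -mulN1r -scalemx_entry scalemxAr.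
by rewrite (le_trans (dot_le _ _))// l2normZ normrN1 mul1r.
Qed.

Lemma opnorm_has_sup p q (M : 'M[R]_(p, q)) :
  has_sup [set l2norm (M *m x) | x in [set x : 'cV[R]_q | l2norm x <= 1]]%classic.
Proof.
split; first by exists (l2norm (M *m 0)); exists 0; rewrite //= l2norm0.
exists (Num.sqrt (\sum_i \sum_j M i j ^+ 2)) => _ [x /= x1 <-].
apply: (le_trans (opb_frobenius M x)).
by rewrite ler_piMr// sqrtr_ge0.
Qed.

Lemma opb_opnorm p q (M : 'M[R]_(p, q)) : opb M (opnorm M).
Proof.
move=> x; have [->|x0] := eqVneq x 0; first by rewrite mulmx0 !l2norm0 mulr0.
have lx : 0 < l2norm x by rewrite sqrtr_gt0 sqn_gt0.
rewrite -ler_pdivrMr//; apply: ub_le_sup; first exact: (opnorm_has_sup M).2.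
exists ((l2norm x)^-1 *: x) => /=.
  by rewrite l2normZ ger0_norm ?invr_ge0 ?l2norm_ge0// mulVf ?gt_eqF.
by rewrite -scalemxAr l2normZ ger0_norm ?invr_ge0 ?l2norm_ge0// mulrC.
Qed.

Lemma opnorm_ge0 p q (M : 'M[R]_(p, q)) : 0 <= opnorm M.
Proof.
apply: (@le_trans _ _ (l2norm (M *m 0))); first exact: l2norm_ge0.
apply: ub_le_sup.
  exact: (opnorm_has_sup M).2.
by exists 0; rewrite //= l2norm0.
Qed.

Lemma opnorm_le p q (M : 'M[R]_(p, q)) c : 0 <= c -> opb M c -> opnorm M <= c.
Proof.
move=> c0 h; apply: ge_sup; first exact: (opnorm_has_sup M).1.
move=> _ [x /= x1 <-]; apply: (le_trans (h x)).
by rewrite ler_piMr.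
Qed.

End QuadraticForms.

(** * Discrete Lyapunov equations *)

Section Lyapunov.
Variable R : realType.

(** Equivalent to spectral radius below 1, by [spectral_radius_schur] and [schur_spectral_radius].
    The explicit rate passes to transposes and feeds the limit arguments directly. *)
Definition schur n (L : 'M[R]_n) : Prop :=
  exists c r : R, [/\ 0 <= c, 0 <= r < 1 & forall k, opb (L ^+ k) (c * r ^+ k)].

Lemma expmxS n (L : 'M[R]_n) k : L ^+ k.+1 = L ^+ k *m L.
Proof. by rewrite exprSr mulmxE. Qed.

Lemma trmxX n (L : 'M[R]_n) k : (L ^+ k)^T = L^T ^+ k.
Proof.
elim: k => [|k IH]; first by rewrite !expr0 trmx1.
by rewrite exprS expmxS -mulmxE trmx_mul IH.
Qed.

Lemma schur_trmx n (L : 'M[R]_n) : schur L -> schur L^T.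
Proof.
move=> [c [r [c0 /andP[r0 r1] h]]]; exists c, r; split=> //; first exact/andP.
by move=> k; rewrite -trmxX; apply: opb_tr => //; rewrite mulr_ge0// exprn_ge0.
Qed.

Lemma geometric_small (c r e : R) : 0 <= r < 1 -> 0 < e -> exists k, c * r ^+ k < e.
Proof.
move=> /andP[r0 r1] e0.
have : ((fun k => c * r ^+ k) @ \oo --> (0 : R))%classic.
  by apply: cvg_geometric; rewrite ger0_norm.
move=> /cvgrPdist_lt /(_ _ e0) [k _ /(_ k (leqnn _))].
rewrite /= sub0r normrN => h; exists k.
by rewrite (le_lt_trans (ler_norm _)).
Qed.

(** Iterating the hypothesis gives [quad Z x <= quad Z (L ^+ k *m x)], and the right side tends to
    0. All comparisons with solutions of Lyapunov equations rest on this maximum principle. *)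
Lemma schur_comparison n (L Z : 'M[R]_n) : schur L ->
  loewner Z (L^T *m Z *m L) -> loewner Z 0.
Proof.
move=> [c [r [c0 /andP[r0 r1] h]]] ZL x; rewrite quad0.
have hk k : quad Z x <= quad Z (L ^+ k *m x).
  elim: k x {ZL}(ZL) => [|k IH] x ZL; first by rewrite expr0 mul1mx.
  have := ZL x; rewrite quad_congr => /le_trans; apply.
  by rewrite expmxS -mulmxA; exact: IH.
rewrite leNgt; apply/negP => q0.
have r2 : 0 <= r ^+ 2 < 1 by rewrite sqr_ge0 expr_lt1.
have [k kq] := geometric_small (opnorm Z * c ^+ 2 * sqn x) r2 q0.
have := lt_le_trans kq (hk k); apply/negP; rewrite -leNgt.
apply: (le_trans (opb_quad (opb_opnorm Z) _)); rewrite quad_scalar.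
have -> : opnorm Z * c ^+ 2 * sqn x * (r ^+ 2) ^+ k =
    opnorm Z * (c * r ^+ k * l2norm x) ^+ 2.
  by rewrite [_ ^+ k]exprAC !exprMn sqr_l2norm; move: (r ^+ k) => t; ring.
rewrite ler_wpM2l ?opnorm_ge0// -sqr_l2norm.
rewrite ler_pXn2r ?nnegrE ?mulr_ge0 ?l2norm_ge0 ?exprn_ge0//; exact: h.
Qed.

(** Quadratic forms would only see the symmetric part of [Y], so the iterates are bounded entry by
    entry. *)
Lemma schur_fixed0 n (L Y : 'M[R]_n) : schur L -> Y = L^T *m Y *m L -> Y = 0.
Proof.
move=> [c [r [c0 /andP[r0 r1] h]]] YL.
have hk k : Y = (L ^+ k)^T *m Y *m L ^+ k.
  elim: k => [|k IH]; first by rewrite expr0 trmx1 mul1mx mulmx1.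
  by rewrite {1}YL {1}IH expmxS trmx_mul !mulmxA.
apply/matrixP => i j; rewrite mxE; apply/eqP; apply: contraT => y0.
have e0 : 0 < `|Y i j| by rewrite normr_gt0.
have r2 : 0 <= r ^+ 2 < 1 by rewrite sqr_ge0 expr_lt1.
have [k kq] := geometric_small (opnorm Y * c ^+ 2) r2 e0.
have c' : 0 <= c * r ^+ k by rewrite mulr_ge0// exprn_ge0.
have : opb Y ((c * r ^+ k) * opnorm Y * (c * r ^+ k)).
  rewrite [X in opb X](hk k); apply: opbM => //; first by rewrite mulr_ge0// opnorm_ge0.
  by apply: opbM => //; [exact: opb_tr|exact: opb_opnorm].
move=> /(opb_entry i j) Yij; suff : `|Y i j| < `|Y i j| by rewrite ltxx.
apply: (le_lt_trans Yij); apply: le_lt_trans kq.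
by rewrite [(r ^+ 2) ^+ k]exprAC; move: (r ^+ k) => t; lra.
Qed.

(* The Lyapunov operator is an injective endomorphism of a finite-dimensional space. *)
Lemma lyapunov_exists n (L M : 'M[R]_n) : schur L ->
  exists Y, Y = L^T *m Y *m L + M.
Proof.
move=> sL; pose G : 'M[R]_(n * n) := 1%:M - lin_mulmx L^T *m lin_mulmxr L.
have GE (Y : 'M[R]_n) : mxvec Y *m G = mxvec (Y - L^T *m Y *m L).
  rewrite mulmxBr mulmx1 mulmxA /lin_mulmx /lin_mulmxr !mul_vec_lin.
  by rewrite [in RHS]linearB.
have uG : G \in unitmx.
  rewrite -row_free_unit -kermx_eq0; apply/eqP/row_matrixP => i.
  rewrite row0; set u := row i _.
  have : u *m G = 0 by rewrite /u -row_mul mulmx_ker row0.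
  rewrite -[u]vec_mxK GE => /(canRL mxvecK); rewrite linear0 => /eqP.
  rewrite subr_eq0 => /eqP/schur_fixed0 ->//.
  by rewrite linear0.
exists (vec_mx (mxvec M *m invmx G)); set Y := vec_mx _.
have : mxvec Y *m G = mxvec M by rewrite vec_mxK -mulmxA mulVmx// mulmx1.
by rewrite GE => /(can_inj mxvecK) <-; rewrite addrC subrK.
Qed.

(** The sum of [(L ^+ k)^T *m M *m L ^+ k] over [k], characterized by its equation. The default 0 is
    not reached when [schur L] holds. *)
Definition dlyap n (L M : 'M[R]_n) : 'M[R]_n :=
  xget 0 [set Y | Y = L^T *m Y *m L + M]%classic.

Variables (n : nat) (L : 'M[R]_n).
Hypothesis sL : schur L.

Lemma dlyapE M : dlyap L M = L^T *m dlyap L M *m L + M.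
Proof.
rewrite /dlyap; case: xgetP => [Y _ //|h].
by have [Y /h] := lyapunov_exists M sL.
Qed.

Lemma dlyap_unique M Y : Y = L^T *m Y *m L + M -> Y = dlyap L M.
Proof.
move=> h; apply/eqP; rewrite -subr_eq0; apply/eqP/(schur_fixed0 sL).
rewrite mulmxBr mulmxBl [in LHS]h [in LHS]dlyapE opprD addrACA subrr addr0//.
Qed.

Lemma dlyap_sym M : M^T = M -> (dlyap L M)^T = dlyap L M.
Proof.
move=> sM; apply: dlyap_unique.
by rewrite [in LHS]dlyapE trmxD !trmx_mul trmxK sM mulmxA.
Qed.

Lemma dlyapD M N : dlyap L (M + N) = dlyap L M + dlyap L N.
Proof.
apply/esym/dlyap_unique; rewrite mulmxDr mulmxDl addrACA -!dlyapE//.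
Qed.

Lemma dlyapZ a M : dlyap L (a *: M) = a *: dlyap L M.
Proof.
apply/esym/dlyap_unique; rewrite -scalemxAr -scalemxAl -scalerDr -dlyapE//.
Qed.

Lemma dlyap0 : dlyap L 0 = 0.
Proof. by apply/esym/dlyap_unique; rewrite mulmx0 mul0mx addr0. Qed.

Lemma dlyap_sum I (r : seq I) (Pr : pred I) (F : I -> 'M[R]_n) :
  dlyap L (\sum_(i <- r | Pr i) F i) = \sum_(i <- r | Pr i) dlyap L (F i).
Proof.
apply: (big_ind2 (fun M Y => dlyap L M = Y)) => //; first exact: dlyap0.
by move=> M Y N Z <- <-; exact: dlyapD.
Qed.

Lemma dlyap_le M X : loewner (L^T *m X *m L + M) X -> loewner (dlyap L M) X.
Proof.
move=> h x; rewrite -subr_le0 -quadB -(quad0 x).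
move: x; apply: (schur_comparison sL) => x.
rewrite {1}dlyapE mulmxBr mulmxBl !quadB quadD.
have := h x; rewrite quadD; lra.
Qed.

Lemma dlyap_ge M X : loewner X (L^T *m X *m L + M) -> loewner X (dlyap L M).
Proof.
move=> h x; rewrite -subr_le0 -quadB -(quad0 x).
move: x; apply: (schur_comparison sL) => x.
rewrite {1}dlyapE mulmxBr mulmxBl !quadB quadD.
have := h x; rewrite quadD; lra.
Qed.

Lemma dlyap_mono M N : loewner M N -> loewner (dlyap L M) (dlyap L N).
Proof.
move=> h; apply: dlyap_le => x.
by rewrite [in leRHS]dlyapE !quadD lerD2l.
Qed.

Lemma dlyap_ge0 M : loewner 0 M -> loewner 0 (dlyap L M).
Proof. by move=> h; rewrite -{1}dlyap0; exact: dlyap_mono. Qed.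

Lemma dlyap_geM M : loewner 0 M -> loewner M (dlyap L M).
Proof.
move=> h x; rewrite dlyapE quadD lerDr quad_congr -(quad0 (L *m x)).
exact: dlyap_ge0.
Qed.

End Lyapunov.

(** The Lyapunov operators of [L] and [L^T] are adjoint for the trace pairing. Expanding
    [\tr (Y *m S)] by the equation of [S] and by that of [Y] produces a common term, which
    cancels. *)
Lemma tr_dlyap (R : realType) n (L M : 'M[R]_n) : schur L ->
  \tr (dlyap L M) = \tr (M *m dlyap L^T 1%:M).
Proof.
move=> sL; set S := dlyap L^T 1%:M; set Y := dlyap L M.
have SE : S = L *m S *m L^T + 1%:M.
  by rewrite {1}/S (dlyapE (schur_trmx sL)) trmxK.
have : \tr (Y *m S) = \tr (Y *m S) by [].
rewrite {1}SE mulmxDr mulmx1 linearD/= [in RHS](dlyapE sL M : Y = _) mulmxDl linearD/=.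
rewrite !mulmxA [\tr (_ *m L^T)]mxtrace_mulC !mulmxA => h.
by apply: (addrI (\tr (L^T *m Y *m L *m S))).
Qed.

(** * Stability from a Lyapunov supersolution *)

Section LyapunovCriterion.
Variables (R : realType) (n : nat) (L X : 'M[R]_n).
Hypotheses (X0 : loewner 0 X) (LX : loewner (L^T *m X *m L + 1%:M) X).

Lemma lyapunov_ge1 : loewner 1%:M X.
Proof.
move=> x; apply: le_trans (LX x); rewrite quadD lerDr quad_congr.
by have := X0 (L *m x); rewrite quad0.
Qed.

(** With [X <= b I], one step lowers the form of [X] by at least [sqn x >= b^-1 * quad X x], hence
    the rate [1 - b^-1]. The bounds [I <= X <= b I] carry this to the Euclidean norm at the price of
    [Num.sqrt b]. *)
Lemma lyapunov_schur : schur L.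
Proof.
pose b := 1 + opnorm X.
have b1 : 1 <= b by rewrite lerDl opnorm_ge0.
have b0 : 0 < b by rewrite (lt_le_trans ltr01).
have Xb x : quad X x <= b * sqn x.
  apply: (le_trans (opb_quad (opb_opnorm X) x)); rewrite quad_scalar.
  by rewrite ler_wpM2r ?sqn_ge0// /b lerDr.
pose r := 1 - b^-1.
have r0 : 0 <= r by rewrite subr_ge0 invf_le1.
have r1 : r < 1 by rewrite ltrBlDr ltrDl invr_gt0.
have step x : quad X (L *m x) <= r * quad X x.
  have := LX x; rewrite quadD quad_congr quad1.
  have : b^-1 * quad X x <= sqn x by rewrite mulrC ler_pdivrMr// mulrC.
  rewrite /r; lra.
have stepk k x : quad X (L ^+ k *m x) <= r ^+ k * quad X x.
  elim: k x => [|k IH] x; first by rewrite !expr0 mul1mx mul1r.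
  rewrite expmxS -mulmxA (le_trans (IH _))// exprSr -mulrA.
  by rewrite ler_wpM2l// exprn_ge0.
exists (Num.sqrt b), (Num.sqrt r); split; first exact: sqrtr_ge0.
  by rewrite sqrtr_ge0 -[ltRHS]sqrtr1 ltr_sqrt.
move=> k x; rewrite -(@ler_pXn2r _ 2) ?nnegrE ?mulr_ge0 ?l2norm_ge0 ?exprn_ge0 ?sqrtr_ge0//.
rewrite !exprMn !sqr_l2norm [(Num.sqrt r ^+ k) ^+ 2]exprAC !sqr_sqrtr ?(ltW b0)//.
have := lyapunov_ge1 (L ^+ k *m x); rewrite quad1 => /le_trans; apply.
apply: (le_trans (stepk k x)).
by rewrite [leRHS]mulrAC [leRHS]mulrC ler_wpM2l ?exprn_ge0.
Qed.

End LyapunovCriterion.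

(** * Spectral radius and geometric decay *)

Section SpectralRadius.
Variable R : realType.
Local Open Scope complex_scope.

(** The modulus as an element of [R], so that it can be compared with real rates. *)
Definition cnorm (z : R[i]) : R := complex.Re `|z|.

Lemma cnormE z : `|z| = (cnorm z)%:C.
Proof. by rewrite /cnorm normc_def. Qed.

Lemma cnorm_ge0 z : 0 <= cnorm z.
Proof. by rewrite -lecR -cnormE normr_ge0. Qed.

Lemma cnormM z t : cnorm (z * t) = cnorm z * cnorm t.
Proof. by apply: complexI; rewrite -cnormE normrM !cnormE -rmorphM. Qed.

Lemma cnormX z k : cnorm (z ^+ k) = cnorm z ^+ k.
Proof. by apply: complexI; rewrite -cnormE normrX !cnormE -rmorphXn. Qed.

Lemma cnorm_eq0 z : (cnorm z == 0) = (z == 0).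
Proof. by rewrite -(inj_eq (@complexI R)) -cnormE rmorph0 normr_eq0. Qed.

Lemma cnormD z t : cnorm (z + t) <= cnorm z + cnorm t.
Proof. by rewrite -lecR rmorphD/= -!cnormE ler_normD. Qed.

Lemma cnorm_real (x : R) : cnorm x%:C = `|x|.
Proof. by rewrite /cnorm normc_def /= expr0n addr0 sqrtr_sqr. Qed.

Lemma cnorm_sum I (r : seq I) (Pr : pred I) (F : I -> R[i]) :
  cnorm (\sum_(i <- r | Pr i) F i) <= \sum_(i <- r | Pr i) cnorm (F i).
Proof.
by rewrite -lecR rmorph_sum/= -cnormE (le_trans (ler_norm_sum _ _ _)).
Qed.

Definition geometric_decay (u : nat -> R) : Prop :=
  exists c r : R, [/\ 0 <= c, 0 <= r < 1 & forall k, u k <= c * r ^+ k].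

Lemma geometric_decay_step (l : R) (u v : nat -> R) : 0 <= l < 1 ->
  (forall k, u k.+1 <= l * u k + v k) -> geometric_decay v -> geometric_decay u.
Proof.
move=> /andP[l0 l1] uv [c [r [c0 /andP[r0 r1] vc]]].
(* A rate strictly above both [l] and [r] avoids the factor [k] that appears when they are equal.
   The constant [c'] below is such that [l * c' + c <= c' * r']. *)
pose r' := (1 + Num.max l r) / 2.
have m1 : Num.max l r < 1 by rewrite gt_max l1.
have lm : l <= Num.max l r by rewrite le_max lexx.
have lr' : l < r' by rewrite /r'; lra.
have rm : r <= Num.max l r by rewrite le_max lexx orbT.
have rr' : r <= r' by rewrite /r'; lra.
have r'0 : 0 <= r' by exact: le_trans l0 (ltW lr').
have r'1 : r' < 1 by rewrite /r'; lra.
pose c' := `|u 0| + c / (r' - l).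
have d0 : 0 < r' - l by rewrite subr_gt0.
have cc' : c <= c' * (r' - l).
  by rewrite mulrDl divfK ?gt_eqF// lerDr mulr_ge0// ltW.
have c'0 : 0 <= c' by rewrite addr_ge0// divr_ge0// ltW.
exists c', r'; split=> //; first exact/andP.
elim=> [|k IH].
  by rewrite expr0 mulr1 (le_trans (ler_norm _))// lerDl divr_ge0// ltW.
apply: (le_trans (uv k)).
have h1 : l * u k <= l * (c' * r' ^+ k) by rewrite ler_wpM2l.
have h2 : v k <= c * r' ^+ k.
  by apply: (le_trans (vc k)); rewrite ler_wpM2l// lerXn2r// nnegrE.
have h3 : c * r' ^+ k <= c' * (r' - l) * r' ^+ k by rewrite ler_wpM2r// exprn_ge0.
rewrite exprS; move: h1 h2 h3; move: (r' ^+ k) => t h1 h2 h3; lra.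
Qed.

Lemma geometric_decayD u v : geometric_decay u -> geometric_decay v ->
  geometric_decay (fun k => u k + v k).
Proof.
move=> [c [r [c0 /andP[r0 r1] uc]]] [c' [r' [c'0 /andP[r'0 r'1] vc]]].
exists (c + c'), (Num.max r r'); split; first exact: addr_ge0.
  by rewrite le_max r0 gt_max r1.
move=> k; rewrite mulrDl lerD//.
  apply: (le_trans (uc k)); rewrite ler_wpM2l// lerXn2r ?nnegrE ?le_max ?r0 ?lexx//.
apply: (le_trans (vc k)).
by rewrite ler_wpM2l// lerXn2r ?nnegrE ?le_max ?r0 ?lexx ?orbT.
Qed.

Lemma geometric_decay0 : geometric_decay (fun=> 0).
Proof. by exists 0, 0; split; rewrite ?lexx ?ltr01// => k; rewrite mul0r. Qed.

Lemma geometric_decay_sum (I : Type) (s : seq I) (u : I -> nat -> R) :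
  (forall i, geometric_decay (u i)) -> geometric_decay (fun k => \sum_(i <- s) u i k).
Proof.
move=> h; elim: s => [|i s IH].
  by under eq_fun do rewrite big_nil; exact: geometric_decay0.
by under eq_fun do rewrite big_cons; exact: geometric_decayD.
Qed.

(* By Cayley-Hamilton the entries of [L ^+ k] satisfy a linear recurrence, whose
   factors ['X - z%:P] are peeled off one at a time. *)
Lemma geometric_decay_expr n (L : 'M[R[i]]_n.+1) (rs : seq R[i]) i j :
  {in rs, forall z, cnorm z < 1} ->
  geometric_decay (fun k =>
    cnorm ((horner_mx L (\prod_(z <- rs) ('X - z%:P)) * L ^+ k) i j)) ->
  geometric_decay (fun k => cnorm ((L ^+ k) i j)).
Proof.
elim: rs => [|z rs IH] rs1.
  by under eq_fun do rewrite big_nil rmorph1 mul1r.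
move=> h; apply: IH => [t trs|]; first by apply: rs1; rewrite inE trs orbT.
move: h; apply: (@geometric_decay_step (cnorm z)).
  by rewrite cnorm_ge0 rs1// mem_head.
move=> k; set q := \prod_(_ <- rs) _.
rewrite big_cons [(_ - _) * _]mulrC -/q rmorphM rmorphB/= horner_mx_X horner_mx_C.
have -> : horner_mx L q * (L - z%:M) * L ^+ k =
  horner_mx L q * L ^+ k.+1 - z *: (horner_mx L q * L ^+ k).
  rewrite mulrBr mulrBl exprS mulrA; congr (_ - _).
  by rewrite -!mulmxE mul_mx_scalar scalemxAl.
move: (_ * L ^+ k.+1) (_ * L ^+ k) => M N.
 rewrite [X in _ + cnorm X](_ : _ = M i j - z * N i j); last by rewrite !mxE.
by rewrite -cnormM (le_trans _ (cnormD _ _))// addrC subrK.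
Qed.

Lemma map_mx_expr n (L : 'M[R]_n) k :
  map_mx (real_complex R) (L ^+ k) = map_mx (real_complex R) L ^+ k.
Proof.
elim: k => [|k IH]; first by rewrite !expr0 map_mx1.
by rewrite expmxS exprSr -mulmxE -IH map_mxM.
Qed.

Lemma char_poly_roots n (L : 'M[R]_n) : exists rs : seq R[i],
  char_poly (map_mx (real_complex R) L) = \prod_(z <- rs) ('X - z%:P) /\
  forall z, (z \in rs) = eigenvalue (map_mx (real_complex R) L) z.
Proof.
have [rs] := closed_field_poly_normal (char_poly (map_mx (real_complex R) L)).
rewrite (monicP (char_poly_monic _)) scale1r => E; exists rs; split=> // z.
by rewrite eigenvalue_root_char E root_prod_XsubC.
Qed.

Lemma spectral_radius_eigenvalue n (L : 'M[R]_n) z :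
  eigenvalue (map_mx (real_complex R) L) z -> cnorm z <= spectral_radius L.
Proof.
move=> ez; apply: ub_le_sup; last by exists z => //; rewrite cnormE.
have [rs [_ rsE]] := char_poly_roots L.
exists (\sum_(t <- rs) cnorm t) => r [t]; rewrite -rsE => trs /=.
rewrite cnormE => /complexI <-.
rewrite (big_rem t)//= lerDl; apply: sumr_ge0 => ? _; exact: cnorm_ge0.
Qed.

Lemma spectral_radius_schur n (L : 'M[R]_n) : spectral_radius L < 1 -> schur L.
Proof.
case: n L => [|n] L sr.
  (* Dimension 0 is apart because polynomials are evaluated at matrices of size [n.+1]. *)
  exists 0, 0; split=> //; first by rewrite lexx ltr01.
  by move=> k x; rewrite [L ^+ k *m x]flatmx0 l2norm0 !mul0r; exact: lexx.
have [rs [rsE rsP]] := char_poly_roots L.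
have dec i j : geometric_decay (fun k => `|(L ^+ k) i j|).
  have -> : (fun k => `|(L ^+ k) i j|) =
      (fun k => cnorm ((map_mx (real_complex R) L ^+ k) i j)).
    by apply/funext => k; rewrite -map_mx_expr mxE cnorm_real.
  apply: (@geometric_decay_expr _ _ rs).
    by move=> z; rewrite rsP => /spectral_radius_eigenvalue /le_lt_trans; apply.
  (* With all the factors present the sequence is identically 0, and peeling them off starts from
     there. *)
  rewrite -rsE Cayley_Hamilton.
  have -> : (fun k => cnorm ((0 * map_mx (real_complex R) L ^+ k) i j)) = fun=> 0.
    by apply/funext => k; apply/eqP; rewrite mul0r mxE cnorm_eq0.
  exact: geometric_decay0.
have [c [r [c0 r01 h]]] : geometric_decay (fun k => \sum_i \sum_j `|(L ^+ k) i j|).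
  by apply: geometric_decay_sum => i; exact: geometric_decay_sum.
exists c, r; split=> // k; apply: opb_le (h k) _.
apply: opb_le (opb_frobenius _).
have s0 : 0 <= \sum_i \sum_j `|(L ^+ k) i j|.
  by apply: sumr_ge0 => i _; apply: sumr_ge0.
rewrite -(ger0_norm s0) -sqrtr_sqr ler_sqrt ?sqr_ge0// expr2 mulr_suml.
apply: ler_sum => i _; rewrite mulr_suml; apply: ler_sum => j _.
rewrite -real_normK ?num_real// expr2 ler_wpM2l//.
rewrite (bigD1 i)//= (bigD1 j)//= -addrA lerDl addr_ge0//; apply: sumr_ge0 => // a _.
by apply: sumr_ge0.
Qed.

Lemma schur_spectral_radius n (L : 'M[R]_n) : schur L -> spectral_radius L < 1.
Proof.
move=> [c [r [c0 /andP[r0 r1] h]]].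
have [rs [_ rsE]] := char_poly_roots L.
have ev1 z : eigenvalue (map_mx (real_complex R) L) z -> cnorm z < 1.
  case/eigenvalueP => v vL v0; rewrite ltNge; apply/negP => z1.
  have vLk k : v *m map_mx (real_complex R) (L ^+ k) = z ^+ k *: v.
    elim: k => [|k IH]; first by rewrite !expr0 map_mx1 mulmx1 scale1r.
    by rewrite expmxS map_mxM mulmxA IH -scalemxAl vL scalerA -exprSr.
  have [j vj] : exists j, v 0 j != 0.
    apply/existsP; apply: contraNT v0; rewrite negb_exists => /forallP vj.
    apply/eqP/matrixP => i j; rewrite ord1 mxE; apply/eqP.
    by have := vj j; rewrite negbK.
  have vj0 : 0 < cnorm (v 0 j) by rewrite lt_def cnorm_ge0 cnorm_eq0 vj.
  have [k kv] := geometric_small ((\sum_i cnorm (v 0 i)) * c) (introT andP (conj r0 r1)) vj0.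
  move: kv; apply/negP; rewrite -leNgt.
  apply: (@le_trans _ _ (cnorm ((z ^+ k *: v) 0 j))).
    by rewrite mxE cnormM cnormX ler_peMl ?cnorm_ge0// exprn_ege1.
  rewrite -vLk mxE (le_trans (cnorm_sum _ _ _))// -mulrA mulr_suml.
  apply: ler_sum => i _; rewrite cnormM ler_wpM2l ?cnorm_ge0//.
  by rewrite mxE cnorm_real; exact: opb_entry.
rewrite /spectral_radius; set E := (X in sup X).
have [->|/set0P E0] := eqVneq E set0; first by rewrite sup0.
(* A supremum of numbers below 1 could be 1, so it is bounded by a maximum over the finite list of
   eigenvalues. The conditional keeps every entry below 1 by construction. *)
apply: (@le_lt_trans _ _ (\big[Num.max/0]_(z <- rs) (if cnorm z < 1 then cnorm z else 0))).
  apply: ge_sup => // x [z ez /=]; rewrite cnormE => /complexI <-.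
  have z1 := ev1 _ ez; rewrite -rsE in ez.
  elim: rs ez {rsE} => // t s IH; rewrite inE big_cons le_max.
  case/predU1P => [<-|/IH ->]; last by rewrite orbT.
  by rewrite z1 lexx.
by apply: bigmax_lt => // z _; case: ifP.
Qed.

End SpectralRadius.

(** * Gaussian moments and independence *)

(** A Gaussian of doubled deviation absorbs the square. The exponentials differ by the factor
    [expR (- y)] with [y = 3 x^2 / (8 s^2)], and [y <= expR y]. This gives [8 / 3], doubled by the
    lower peak to [16 / 3], which is rounded up to 6. *)
Lemma sqr_normal_pdf_le (R : realType) (s x : R) : s != 0 ->
  x ^+ 2 * normal_pdf 0 s x <= 6 * s ^+ 2 * normal_pdf 0 (2 * s) x.
Proof.
move=> s0; have t0 : 2 * s != 0 by rewrite mulf_neq0.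
have s2 : 0 < s ^+ 2 by rewrite exprn_even_gt0.
rewrite !normal_pdfE// /normal_fun !subr0.
have -> : normal_peak (2 * s) = (normal_peak s / 2).
  rewrite /normal_peak exprMn -!mulrnAr -mulrA [Num.sqrt (2 ^+ 2 * _)]sqrtrM ?sqr_ge0//.
  by rewrite sqrtr_sqr ger0_norm// invfM mulrC.
have p0 := normal_peak_ge0 s.
rewrite (_ : - x ^+ 2 / (s ^+ 2 *+ 2) =
  - x ^+ 2 / ((2 * s) ^+ 2 *+ 2) + - (3 * x ^+ 2 / (8 * s ^+ 2))); last first.
  rewrite exprMn !mulr2n; move: s2; move: (s ^+ 2) (x ^+ 2) => a b a0.
  by field; rewrite !lt0r_neq0 ?addr_gt0 ?mulr_gt0.
rewrite expRD expRN; set y := (3 * x ^+ 2 / _).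
have y1 := expR_ge1Dx y.
have y0 : 0 <= y by rewrite /y divr_ge0// mulr_ge0// sqr_ge0.
have e0 := expR_gt0 y.
have xy : (x ^+ 2 = 8 / 3 * s ^+ 2 * y) by rewrite /y; field.
move: (expR _) (expR_ge0 (- x ^+ 2 / ((2 * s) ^+ 2 *+ 2))) => g g0.
have hy : (y / expR y <= 1) by rewrite ler_pdivrMr// mul1r; lra.
have -> : x ^+ 2 * (normal_peak s * (g / expR y)) =
    8 / 3 * (s ^+ 2 * normal_peak s * g) * (y / expR y) by rewrite xy; ring.
have c0 : (0 <= s ^+ 2 * normal_peak s * g) by rewrite mulr_ge0// mulr_ge0// ltW.
have := ler_wpM2l c0 hy; lra.
Qed.

Section GaussianMoments.
Variable R : realType.
Local Open Scope ereal_scope.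
Notation mu := (@lebesgue_measure R).

(** The Radon-Nikodym derivative of the Gaussian law equals the density almost everywhere, because
    both have the same integral over each measurable set. *)
Lemma ge0_integral_normal_prob (s : R) (f : R -> R) : (forall x, (0 <= f x)%R) ->
  measurable_fun [set: R] f ->
  \int[normal_prob 0 s]_x (f x)%:E = \int[mu]_x (f x * normal_pdf 0 s x)%:E.
Proof.
move=> f0 mf; have dom := @normal_prob_dominates R 0 s.
rewrite -(Radon_Nikodym_SigmaFinite.change_of_variables dom)//=; last first.
  exact/measurable_EFinP.
under [RHS]eq_integral do rewrite EFinM.
have mpdf : measurable_fun [set: R] (fun x : R => (normal_pdf 0 s x)%:E).
  by apply/measurable_EFinP; exact: measurable_normal_pdf.
have iRN := Radon_Nikodym_SigmaFinite.f_integrable dom.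
apply: ae_eq_integral => //.
- apply: emeasurable_funM; first exact/measurable_EFinP.
  exact: measurable_int iRN.
- by apply: emeasurable_funM => //; exact/measurable_EFinP.
- apply: ae_eqe_mul2l; apply: integral_ae_eq => //= E _ mE.
  by rewrite -Radon_Nikodym_SigmaFinite.f_integral.
Qed.

(** Folding the line at 0 shows that the positive and negative parts of a centred Gaussian have the
    same integral. *)
Lemma ge0_integralT_fold (f : R -> R) : (forall x, (0 <= f x)%R) -> continuous f ->
  \int[mu]_x (f x)%:E =
  \int[mu]_(x in `[0%R, +oo[) (f x)%:E + \int[mu]_(x in `[0%R, +oo[) (f (- x)%R)%:E.
Proof.
move=> f0 cf.
have mf : measurable_fun [set: R] f by exact: continuous_measurable_fun.
rewrite -(setUv `[0%R, +oo[%classic) ge0_integral_setU//=; last 4 first.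
- exact: measurableC.
- by apply/measurable_EFinP; rewrite setUv.
- by move=> x _; rewrite lee_fin.
- exact/disj_setPCl.
congr +%E; rewrite setCitvr.
rewrite integral_itv_bndo_bndc; last exact/measurable_EFinP/measurable_funTS.
by rewrite -{1}oppr0 ge0_integration_by_substitutionNy//; exact: continuous_subspaceT.
Qed.

Lemma normal_pdfN (s x : R) : (s != 0)%R -> normal_pdf 0 s (- x) = normal_pdf 0 s x.
Proof. by move=> s0; rewrite !normal_pdfE// /normal_fun !subr0 sqrrN. Qed.

Lemma normal_second_moment_le (s : R) : (s != 0)%R ->
  \int[normal_prob 0 s]_x (x ^+ 2)%:E <= (6 * s ^+ 2)%:E.
Proof.
move=> s0; rewrite ge0_integral_normal_prob; [|by move=> x; exact: sqr_ge0|exact: measurable_funX].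
have mpdf u : measurable_fun [set: R] (fun x : R => normal_pdf 0 u x).
  exact: measurable_normal_pdf.
apply: (@le_trans _ _ (\int[mu]_x ((6 * s ^+ 2)%:E * (normal_pdf 0 (2 * s) x)%:E))); last first.
  rewrite integralZl//; last exact: integrable_normal_pdf.
  by rewrite integral_normal_pdf mule1.
apply: ge0_le_integral => //.
- by move=> x _; rewrite lee_fin mulr_ge0 ?sqr_ge0 ?normal_pdf_ge0.
- by apply/measurable_EFinP/measurable_funM; [exact: measurable_funX|exact: mpdf].
- by apply/measurable_EFinP/measurable_funM; [exact: measurable_cst|exact: mpdf].
by move=> x _; rewrite -EFinM lee_fin sqr_normal_pdf_le.
Qed.

End GaussianMoments.

(** * Square-integrable variables and the pairing [E[XY]] *)

Section SquareIntegrable.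
Context d (T : measurableType d) (R : realType) (P : probability T R).

Definition sqint (X : T -> R) : Prop :=
  measurable_fun [set: T] X /\ P.-integrable [set: T] (fun w => (X w ^+ 2)%:E).

Definition ip (X Y : T -> R) : R := \int[P]_w (X w * Y w).

Lemma sqint_mul X Y : sqint X -> sqint Y ->
  P.-integrable [set: T] (EFin \o (fun w => X w * Y w)).
Proof.
move=> [mX iX] [mY iY].
apply: (@le_integrable _ _ _ _ _ _ _ (fun w => (X w ^+ 2)%:E + (Y w ^+ 2)%:E)%E) => //.
- by apply/measurable_EFinP/measurable_funM.
- move=> w _; rewrite /= lee_fin [leRHS]ger0_norm ?addr_ge0 ?sqr_ge0// normrM.
  have := sqr_ge0 (`|X w| - `|Y w|); rewrite sqrrB !real_normK ?num_real//.
  have : 0 <= `|X w| * `|Y w| by rewrite mulr_ge0.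
  move: (`|X w| * `|Y w|) => t; rewrite -mulr_natr; lra.
- exact: integrableD.
Qed.

Lemma sqint_integrable X : sqint X -> P.-integrable [set: T] (fun w => (X w)%:E).
Proof.
move=> [mX iX].
apply: (@le_integrable _ _ _ _ _ _ _ (fun w => 1%:E + (X w ^+ 2)%:E)%E) => //.
- exact/measurable_EFinP.
- move=> w _ /=; rewrite lee_fin [leRHS]ger0_norm ?addr_ge0 ?sqr_ge0//.
  have := sqr_ge0 (`|X w| - 1); have := sqr_ge0 (X w).
  rewrite sqrrB1 real_normK ?num_real// mulr2n; lra.
- apply: integrableD => //; exact: finite_measure_integrable_cst.
Qed.

Lemma sqintZ a X : sqint X -> sqint (fun w => a * X w).
Proof.
move=> [mX iX]; split; first exact: measurable_funM.
apply: eq_integrable (integrableZl measurableT (a ^+ 2) iX) => // w _.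
by rewrite -EFinM exprMn.
Qed.

Lemma sqintD X Y : sqint X -> sqint Y -> sqint (fun w => X w + Y w).
Proof.
move=> sX sY; have [mX iX] := sX; have [mY iY] := sY.
split; first exact: measurable_funD.
have i1 := integrableD measurableT iX iY.
have i2 := integrableZl measurableT 2 (sqint_mul sX sY).
apply: eq_integrable (integrableD measurableT i1 i2) => // w _.
rewrite /= -!EFinM -!EFinD; congr EFin; ring.
Qed.

Lemma sqint0 : sqint (fun=> 0).
Proof.
split; first exact: measurable_cst.
by under eq_fun do rewrite expr0n; exact: integrable0.
Qed.

Lemma sqint_sum (I : Type) (r : seq I) (F : I -> T -> R) :
  (forall i, sqint (F i)) -> sqint (fun w => \sum_(i <- r) F i w).
Proof.
move=> h; elim: r => [|i r IH].
  by under eq_fun do rewrite big_nil; exact: sqint0.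
by under eq_fun do rewrite big_cons; exact: sqintD.
Qed.

Lemma ipC X Y : ip X Y = ip Y X.
Proof. by rewrite /ip; under eq_Rintegral do rewrite mulrC. Qed.

Lemma ipZl a X Y : sqint X -> sqint Y -> ip (fun w => a * X w) Y = a * ip X Y.
Proof.
move=> sX sY; rewrite /ip -RintegralZl//; last exact: sqint_mul.
by apply: eq_Rintegral => w _; rewrite mulrA.
Qed.

Lemma ipDl X Y Z : sqint X -> sqint Y -> sqint Z ->
  ip (fun w => X w + Y w) Z = ip X Z + ip Y Z.
Proof.
move=> sX sY sZ; rewrite /ip -RintegralD//; try exact: sqint_mul.
by apply: eq_Rintegral => w _; rewrite mulrDl.
Qed.

Lemma ip_suml (I : Type) (r : seq I) (F : I -> T -> R) Z :
  (forall i, sqint (F i)) -> sqint Z ->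
  ip (fun w => \sum_(i <- r) F i w) Z = \sum_(i <- r) ip (F i) Z.
Proof.
move=> h sZ; elim: r => [|i r IH].
  rewrite big_nil /ip; under eq_Rintegral do rewrite big_nil mul0r.
  by rewrite Rintegral_cst// mul0r.
rewrite big_cons -IH -ipDl//; last exact: sqint_sum.
by rewrite /ip; apply: eq_Rintegral => w _; rewrite big_cons.
Qed.

(** By uniqueness of product measures the joint law is the product of the marginals. Fubini then
    leaves inner integrals [x * E[Y] = 0]. *)
Lemma independent_ip0 (X Y : {RV P >-> R}) :
  (forall U V : set R, measurable U -> measurable V ->
    P (X @^-1` U `&` Y @^-1` V)%classic = (P (X @^-1` U)%classic * P (Y @^-1` V)%classic)%E) ->
  sqint X -> sqint Y -> (\int[distribution P Y]_y y%:E = 0)%E -> ip X Y = 0.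
Proof.
move=> indep sX sY EY0.
pose Z w : R * R := (X w, Y w).
have mZ : measurable_fun [set: T] Z by exact: measurable_fun_pair.
pose PZ := pushforward P Z.
have PZE A : measurable A -> (distribution P X \x distribution P Y)%E A = PZ A.
  apply: (@product_measure_unique _ _ _ _ _ _ _
    (pushforward P Z : {measure set (R * R) -> \bar R})) => U V mU mV.
  rewrite /= /pushforward -indep//; congr (P _).
pose f (z : R * R) := (z.1 * z.2)%:E.
have mf : measurable_fun [set: R * R] f.
  apply/measurable_EFinP/measurable_funM; [exact: measurable_fst|exact: measurable_snd].
have ifZ : P.-integrable (Z @^-1` [set: R * R])%classic (f \o Z) by exact: sqint_mul.
have iPZ := integrable_pushforward mZ mf ifZ measurableT.
have EZ : (\int[PZ]_z f z = \int[P]_w (X w * Y w)%:E)%E.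
  by rewrite integral_pushforward.
rewrite /ip /Rintegral -EZ.
have -> : (\int[PZ]_z f z = \int[(distribution P X \x distribution P Y)%E]_z f z)%E.
  by apply: eq_measure_integral => A mA _; exact/esym/PZE.
rewrite -integral12_prod_meas1/=; last first.
  move/integrableP: iPZ => [_ h]; apply/integrableP; split=> //.
  rewrite (eq_measure_integral PZ)// => A mA _; exact: PZE.
rewrite /fubini_F /f /=.
have iYP : P.-integrable [set: T] (fun w => (Y w)%:E) by exact: sqint_integrable.
have iY : (distribution P Y).-integrable [set: R] (EFin \o id).
  apply: (@integrable_pushforward _ _ _ _ R Y (@measurable_funPT _ _ _ _ Y)) => //.
  exact/measurable_EFinP.
rewrite (eq_integral (cst 0%E)) ?integral0// => x _.
under eq_integral do rewrite EFinM.
by rewrite integralZl// EY0 mule0.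
Qed.

End SquareIntegrable.

(** * Moments of a Gaussian random variable *)

Section GaussianVariable.
Context d (T : measurableType d) (R : realType) (P : probability T R).

(* The value [s ^+ 2] is not needed, only [0 < gauss_m2 s <= 6 * s ^+ 2]. *)
Definition gauss_m2 (s : R) : R := fine (\int[normal_prob 0 s]_x (x ^+ 2)%:E)%E.

Lemma gauss_m2_fin (s : R) : s != 0 ->
  (\int[normal_prob 0 s]_x (x ^+ 2)%:E = (gauss_m2 s)%:E)%E.
Proof.
move=> s0; rewrite /gauss_m2 fineK// ge0_fin_numE.
  exact: le_lt_trans (normal_second_moment_le s0) (ltry _).
by apply: integral_ge0 => x _; rewrite lee_fin sqr_ge0.
Qed.

Lemma gauss_m2_le (s : R) : s != 0 -> gauss_m2 s <= 6 * s ^+ 2.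
Proof.
by move=> s0; rewrite -lee_fin -gauss_m2_fin// normal_second_moment_le.
Qed.

(** A zero second moment would concentrate the law on [{0}], a Lebesgue-null set. Strict positivity
    lets strict inequalities pass between traces and losses. *)
Lemma gauss_m2_gt0 (s : R) : s != 0 -> 0 < gauss_m2 s.
Proof.
move=> s0; rewrite lt_def; apply/andP; split; last first.
  by rewrite -lee_fin -gauss_m2_fin//; apply: integral_ge0 => x _; rewrite lee_fin sqr_ge0.
apply/eqP => m0.
have : (\int[normal_prob 0 s]_x `|(x ^+ 2)%:E| = 0)%E.
  under eq_integral do rewrite gee0_abs ?lee_fin ?sqr_ge0//.
  by rewrite gauss_m2_fin// m0.
have mf : measurable_fun [set: R] (fun x : R => (x ^+ 2)%:E).
  by apply/measurable_EFinP; exact: measurable_funX.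
move=> /(ae_eq_integral_abs (normal_prob 0 s) measurableT mf) [N [mN N0 sN]].
have N1 : (normal_prob 0 s) [set: R] = 1%E by exact: probability_setT.
have Z0 : (normal_prob 0 s) [set 0 : R] = 0%E.
  have /null_content_dominatesP := @normal_prob_dominates R 0 s.
  by apply=> //; exact: lebesgue_measure_set1.
have : (normal_prob 0%R s [set: R] <= normal_prob 0%R s (N `|` [set 0%R : R])%classic)%E.
  apply: le_measure; rewrite ?inE//; first exact: measurableU.
  move=> x _ /=; have [->|x0] := eqVneq x 0; [by right|left].
  apply: sN => /= /(_ I) [] /eqP; rewrite sqrf_eq0; exact/negP.
have : (normal_prob 0%R s (N `|` [set 0%R : R])%classic <=
  normal_prob 0%R s N + normal_prob 0%R s [set 0%R : R])%E.
  exact: measureU2.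
rewrite N0 Z0 add0e N1 => h1 h2; have := le_trans h2 h1.
by rewrite lee_fin ler10.
Qed.

Lemma normal_mean0 (s : R) : s != 0 ->
  (\int[normal_prob 0 s]_x (x%:E) = 0)%E.
Proof.
move=> s0; pose g (x : R) := Num.max x 0.
have g0 x : 0 <= g x by rewrite le_max lexx orbT.
have cg : continuous g.
  by move=> x; apply: continuous_max; [exact: cvg_id|exact: cvg_cst].
have cgN : continuous (fun x => g (- x)).
  move=> x; apply: (@continuous_comp _ _ _ (@GRing.opp R) g); last exact: cg.
  exact: opp_continuous.
have posE : ((fun x : R => x%:E)^\+ = (fun x => (g x)%:E))%E.
  by apply/funext => x; rewrite funeposE /g EFin_max.
have negE : ((fun x : R => x%:E)^\- = (fun x => (g (- x))%:E))%E.
  by apply/funext => x; rewrite funenegE /g EFin_max.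
rewrite integralE posE negE.
have pc := @continuous_normal_pdf R 0 s s0.
have -> : (\int[normal_prob 0 s]_x (g (- x))%:E = \int[normal_prob 0 s]_x (g x)%:E)%E.
  rewrite !ge0_integral_normal_prob//; try exact: continuous_measurable_fun.
  have c1 : continuous (fun x => g x * normal_pdf 0 s x).
    by move=> x; apply: cvgM; [exact: cg|exact: pc].
  have c2 : continuous (fun x => g (- x) * normal_pdf 0 s x).
    by move=> x; apply: cvgM; [exact: cgN|exact: pc].
  have p1 x : 0 <= g x * normal_pdf 0 s x by rewrite mulr_ge0 ?normal_pdf_ge0.
  have p2 x : 0 <= g (- x) * normal_pdf 0 s x by rewrite mulr_ge0 ?normal_pdf_ge0.
  rewrite (ge0_integralT_fold p1 c1) (ge0_integralT_fold p2 c2).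
  under [X in (_ + X)%E = _]eq_integral do rewrite opprK normal_pdfN//.
  under [X in _ = (_ + X)%E]eq_integral do rewrite normal_pdfN//.
  by rewrite addeC.
(* Equal parts cancel only if they are finite, which follows from [Num.max x 0 <= 1 + x ^+ 2]. *)
apply: subee; rewrite ge0_fin_numE; last by apply: integral_ge0 => x _; rewrite lee_fin.
apply: (@le_lt_trans _ _ (\int[normal_prob 0 s]_x (1%:E + (x ^+ 2)%:E))%E).
  apply: ge0_le_integral => //.
  - by move=> x _; rewrite lee_fin.
  - by apply/measurable_EFinP; exact: continuous_measurable_fun.
  - apply: emeasurable_funD => //.
    by apply/measurable_EFinP; exact: measurable_funX.
  - move=> x _; rewrite -EFinD lee_fin ge_max; apply/andP; split.
      by have := sqr_ge0 (x - 1); have := sqr_ge0 x; rewrite sqrrB1 mulr2n; lra.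
    by rewrite addr_ge0 ?sqr_ge0.
rewrite ge0_integralD//.
- by rewrite integral_cst//= mul1e probability_setT gauss_m2_fin// -EFinD ltry.
- by move=> x _; rewrite lee_fin sqr_ge0.
- by apply/measurable_EFinP; exact: measurable_funX.
Qed.

(* [distribution] and [normal_prob] live on two copies of the Borel structure,
   hence the detour through the push-forward by the identity. *)
Lemma ge0_eq_integral_normal_prob (X : {RV P >-> R}) (s : R) (f : R -> \bar R) :
  (forall V : set R, measurable V -> distribution P X V = normal_prob 0 s V) ->
  measurable_fun [set: R] f -> (forall x, (0 <= f x)%E) ->
  (\int[distribution P X]_y f y = \int[normal_prob 0 s]_y f y)%E.
Proof.
move=> XN mf f0; pose phi : measurableTypeR R -> R := idfun.
have mphi : measurable_fun [set: measurableTypeR R] phi by exact: measurable_id.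
have := @ge0_integral_pushforward _ _ _ _ R phi mphi (normal_prob 0 s) setT f
  measurableT mf (fun y _ => f0 y).
rewrite preimage_setT => <-.
by apply: eq_measure_integral => A mA _; exact: XN.
Qed.

Lemma eq_integral_normal_prob (X : {RV P >-> R}) (s : R) (f : R -> \bar R) :
  (forall V : set R, measurable V -> distribution P X V = normal_prob 0 s V) ->
  measurable_fun [set: R] f ->
  (\int[distribution P X]_y f y = \int[normal_prob 0 s]_y f y)%E.
Proof.
move=> XN mf; rewrite integralE [RHS]integralE.
have mfp : measurable_fun [set: R] (f^\+)%E by exact: measurable_funepos.
have mfn : measurable_fun [set: R] (f^\-)%E by exact: measurable_funeneg.
rewrite (ge0_eq_integral_normal_prob XN mfp) ?(ge0_eq_integral_normal_prob XN mfn)//.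
Qed.

Variables (X : {RV P >-> R}) (s : R).
Hypotheses (s0 : s != 0)
  (XN : forall V : set R, measurable V -> distribution P X V = normal_prob 0 s V).

Lemma gaussian_second_moment : (\int[P]_w (X w ^+ 2)%:E = (gauss_m2 s)%:E)%E.
Proof.
have mf : measurable_fun [set: R] (fun y : R => (y ^+ 2)%:E).
  by apply/measurable_EFinP; exact: measurable_funX.
rewrite -gauss_m2_fin// -(eq_integral_normal_prob XN mf).
by rewrite ge0_integral_distribution// => y; rewrite lee_fin sqr_ge0.
Qed.

Lemma gaussian_sqint : sqint P X.
Proof.
split; first exact: measurable_funPT.
apply/integrableP; split.
  by apply/measurable_EFinP; apply: measurable_funX; exact: measurable_funPT.
under eq_integral do rewrite gee0_abs ?lee_fin ?sqr_ge0//.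
by rewrite gaussian_second_moment ltry.
Qed.

Lemma gaussian_ip : ip P X X = gauss_m2 s.
Proof.
rewrite /ip /Rintegral; under eq_integral do rewrite -expr2.
by rewrite gaussian_second_moment.
Qed.

Lemma gaussian_mean0 : (\int[distribution P X]_y (y%:E) = 0)%E.
Proof.
rewrite -(normal_mean0 s0); exact: eq_integral_normal_prob.
Qed.

End GaussianVariable.

(** * The average cost *)

Section AverageTrace.
Variables (R : realType) (n : nat) (L M : 'M[R]_n) (v0 v : R) (Sg : nat -> 'M[R]_n).
Hypotheses (sL : schur L) (v00 : 0 <= v0) (vge0 : 0 <= v).
Hypotheses (Sg0 : Sg 0 = v0%:M)
  (SgS : forall t, Sg t.+1 = L *m Sg t *m L^T + v%:M).

(** The stationary covariance [D] for unit noise, multiplied by [v0 + v], dominates the initial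
    covariance and is a supersolution of the recursion. *)
Lemma covariance_bounded : exists c, 0 <= c /\ forall t, opb (Sg t) c.
Proof.
have sLT := schur_trmx sL; pose D := dlyap L^T 1%:M; pose a := v0 + v.
have a0 : 0 <= a by exact: addr_ge0.
have DE : D = L *m D *m L^T + 1%:M by rewrite {1}/D (dlyapE sLT) trmxK.
have I0 : loewner 0 (1%:M : 'M[R]_n) by move=> x; rewrite quad0 quad1 sqn_ge0.
have D1 : loewner 1%:M D by exact: dlyap_geM.
exists (opnorm (a *: D)); split=> [|t]; first exact: opnorm_ge0.
have symS : (Sg t)^T = Sg t.
  elim: t => [|t IH]; first by rewrite Sg0 tr_scalar_mx.
  by rewrite SgS trmxD tr_scalar_mx !trmx_mul trmxK IH mulmxA.
have Sge0 : loewner 0 (Sg t).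
  elim: t {symS} => [|t IH] x.
    by rewrite Sg0 quad0 quad_scalar mulr_ge0// sqn_ge0.
  rewrite SgS quad0 quadD quad_scalar addr_ge0 ?mulr_ge0 ?sqn_ge0//.
  by rewrite -{1}[L]trmxK quad_congr -(quad0 (L^T *m x)).
have Sle : loewner (Sg t) (a *: D).
  elim: t {symS Sge0} => [|t IH] x.
    rewrite Sg0 quad_scalar quadZ; have := D1 x; rewrite quad1 => h.
    by rewrite (le_trans (ler_wpM2l v00 h))// ler_wpM2r ?lerDl// (le_trans _ h)// sqn_ge0.
  rewrite SgS DE scalerDr !quadD lerD//.
    rewrite scalemxAl scalemxAr -{1 3}[L]trmxK !quad_congr; exact: IH.
  by rewrite quadZ quad_scalar quad1 ler_wpM2r ?sqn_ge0// lerDr.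
apply: sym_opb => //; first exact: loewner_trans Sle (opb_quad (opb_opnorm _)).
move=> x; rewrite quadN quad_scalar (@le_trans _ _ 0)//.
  by rewrite oppr_le0; have := Sge0 x; rewrite quad0.
by rewrite mulr_ge0 ?opnorm_ge0 ?sqn_ge0.
Qed.

(** Pairing the recursion of [Sg] with the equation of [Y] makes the sum telescope up to a constant
    [v * \tr Y] per step, so no convergence of [Sg t] itself is involved. *)
Lemma average_trace_cvg :
  ((fun N => N%:R^-1 * \sum_(0 <= t < N.+1) \tr (M *m Sg t)) @ \oo -->
    v * \tr (dlyap L M))%classic.
Proof.
set Y := dlyap L M; have YE : Y = L^T *m Y *m L + M by exact: dlyapE.
have step t : \tr (M *m Sg t) = \tr (Y *m Sg t) - \tr (Y *m Sg t.+1) + v * \tr Y.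
  rewrite SgS mulmxDr linearD/= mul_mx_scalar linearZ/= {1}YE mulmxDl linearD/=.
  rewrite !mulmxA [\tr (_ *m L^T)]mxtrace_mulC !mulmxA; ring.
have sumE N : \sum_(0 <= t < N.+1) \tr (M *m Sg t) =
    \tr (Y *m Sg 0) - \tr (Y *m Sg N.+1) + N.+1%:R * (v * \tr Y).
  elim: N => [|N IH]; first by rewrite big_nat1 step mul1r.
  by rewrite big_nat_recr//= IH step [N.+2%:R]mulrS; ring.
have [c [c0 hc]] := covariance_bounded.
pose k := n%:R * (opnorm Y * c).
have trk t : `|\tr (Y *m Sg t)| <= k.
  rewrite /mxtrace (le_trans (ler_norm_sum _ _ _))//.
  have -> : k = \sum_(i < n) opnorm Y * c by rewrite /k sumr_const card_ord mulr_natl.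
  apply: ler_sum => i _; apply: opb_entry.
  by apply: opbM (opb_opnorm _) (hc t); exact: opnorm_ge0.
have -> : (fun N => N%:R^-1 * \sum_(0 <= t < N.+1) \tr (M *m Sg t)) =
    (fun N => N%:R^-1 * (\tr (Y *m Sg 0) - \tr (Y *m Sg N.+1) + N.+1%:R * (v * \tr Y))).
  by apply/funext => N; rewrite sumE.
apply/cvgrPdist_le => e e0.
(* Two end terms of the telescoping sum, plus one extra [v * \tr Y]: there are [N + 1] summands but
   the division is by [N]. *)
pose b := 2 * k + `|v * \tr Y|.
near=> N.
have N0 : (0 < N%:R :> R) by rewrite ltr0n; near: N; exact: nbhs_infty_gt.
have bN : b <= e * N%:R.
  rewrite -ler_pdivrMl// mulrC; near: N; exact: nbhs_infty_ger.
rewrite distrC [X in `|X|](_ : _ =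
  N%:R^-1 * (\tr (Y *m Sg 0) - \tr (Y *m Sg N.+1) + v * \tr Y)); last first.
  by rewrite -natr1; field; rewrite gt_eqF.
rewrite normrM ger0_norm ?invr_ge0 ?(ltW N0)// [leLHS]mulrC ler_pdivrMr//.
apply: le_trans bN; rewrite (le_trans (ler_normD _ _))// lerD2r.
rewrite (le_trans (ler_normB _ _))//.
by have := trk 0; have := trk N.+1; lra.
Unshelve. all: by end_near.
Qed.

End AverageTrace.

(** * Second moments of the state and the value of the loss *)

Section Noise.
Context d (T : measurableType d) (R : realType) (P : probability T R).

Lemma mutually_independent2 (I : choiceType) (F : I -> set (set T)) i j (E E' : set T) :
  mutually_independent P F -> i != j -> F i E -> F j E' ->
  P (E `&` E')%classic = (P E * P E')%E.
Proof.
move=> ind ij FE FE'.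
have := ind [fset i; j]%fset (fun k => if k == i then E else E').
have -> : (\bigcap_(k in [set` [fset i; j]%fset]) (if k == i then E else E'))%classic
    = (E `&` E')%classic.
  apply/seteqP; split=> [w h|w [Ew E'w] k _]; last by case: ifP.
  split; first by have := h i; rewrite eqxx; apply; rewrite /= !inE eqxx.
  by have := h j; rewrite eq_sym (negbTE ij); apply; rewrite /= !inE eqxx orbT.
rewrite big_fsetU1 ?inE//= big_seq_fset1 eqxx eq_sym (negbTE ij); apply=> k.
by rewrite !inE => /orP[]/eqP ->; rewrite ?eqxx// eq_sym (negbTE ij).
Qed.

Variables (n : nat) (sigma : R) (x0 : random_vector P n) (xi : nat -> random_vector P n).
Hypotheses (sigma0 : 0 < sigma) (noise : lqr_noise sigma x0 xi).

Let v0 : R := gauss_m2 1.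
Let v : R := gauss_m2 sigma.

Lemma sigma_of_rv_preimage (X : {RV P >-> R}) (U : set R) :
  measurable U -> sigma_of_rv X (X @^-1` U)%classic.
Proof. by move=> mU; exists U => //; rewrite setTI. Qed.

Lemma sigma_of_rvec_preimage (X : random_vector P n) i (U : set R) :
  measurable U -> sigma_of_rvec X (X i @^-1` U)%classic.
Proof.
by move=> mU; apply: sub_gen_smallest; exists i => //; exact: sigma_of_rv_preimage.
Qed.

Lemma isotropic_sqint (s : R) (X : random_vector P n) i :
  s != 0 -> isotropic_gaussian s X -> sqint P (X i).
Proof. by move=> s0 [_ XN]; exact: gaussian_sqint s0 (XN i). Qed.

Lemma isotropic_ip (s : R) (X : random_vector P n) i j :
  s != 0 -> isotropic_gaussian s X -> ip P (X i) (X j) = gauss_m2 s *+ (i == j).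
Proof.
move=> s0 XG; have [ind XN] := XG.
have [->|ij] := eqVneq i j; first by rewrite mulr1n (gaussian_ip s0 (XN j)).
rewrite mulr0n; apply: independent_ip0; [|exact: isotropic_sqint XG..|].
  move=> U V mU mV; apply: (mutually_independent2 ind ij).
    exact: sigma_of_rv_preimage.
  exact: sigma_of_rv_preimage.
exact: gaussian_mean0 s0 (XN j).
Qed.

Let s0 : sigma != 0. Proof. by rewrite gt_eqF. Qed.

Lemma x0_sqint i : sqint P (x0 i).
Proof. by case: noise => h _ _; apply: isotropic_sqint h; exact: oner_neq0. Qed.

Lemma xi_sqint t i : sqint P (xi t i).
Proof. by case: noise => _ h _; exact: isotropic_sqint (h t). Qed.

Lemma x0_xi_ip t i j : ip P (x0 i) (xi t j) = 0.
Proof.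
have [_ xiG ind] := noise.
apply: independent_ip0; [|exact: x0_sqint|exact: xi_sqint|].
  move=> U V mU mV; apply: (@mutually_independent2 _ _ 0%N t.+1 _ _ ind) => //.
    exact: sigma_of_rvec_preimage.
  exact: sigma_of_rvec_preimage.
by have [_ XN] := xiG t; exact: gaussian_mean0 s0 (XN j).
Qed.

Lemma xi_xi_ip s t i j : s != t -> ip P (xi s i) (xi t j) = 0.
Proof.
move=> st; have [_ xiG ind] := noise.
apply: independent_ip0; [|exact: xi_sqint|exact: xi_sqint|].
  move=> U V mU mV; apply: (@mutually_independent2 _ _ s.+1 t.+1 _ _ ind) => //.
    exact: sigma_of_rvec_preimage.
  exact: sigma_of_rvec_preimage.
by have [_ XN] := xiG t; exact: gaussian_mean0 s0 (XN j).
Qed.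

Variables (p : nat) (A : 'M[R]_n) (B : 'M[R]_(n, p)) (K : 'M[R]_(p, n)).
Let L := A + B *m K.
Let st t i (w : T) : R := state x0 xi A B K t w i 0.
Let Sg t : 'M[R]_n := \matrix_(i, j) ip P (st t i) (st t j).

Lemma state_coordS t i : st t.+1 i = (fun w => \sum_j L i j * st t j w + xi t i w).
Proof.
apply/funext => w; rewrite /st /= mulmxA -mulmxDl -/L !mxE.
by congr (_ + _); apply: eq_bigr.
Qed.

Lemma state_coord0 i : st 0 i = x0 i.
Proof. by apply/funext => w; rewrite /st /= mxE. Qed.

Lemma state_coord_sqint t i : sqint P (st t i).
Proof.
elim: t i => [|t IH] i; first by rewrite state_coord0; exact: x0_sqint.
rewrite state_coordS; apply: sqintD (xi_sqint t i).
by apply: sqint_sum => j; exact: sqintZ.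
Qed.

Lemma drift_sqint t i : sqint P (fun w => \sum_j L i j * st t j w).
Proof. by apply: sqint_sum => j; apply: sqintZ; exact: state_coord_sqint. Qed.

Lemma drift_ip t i Z : sqint P Z ->
  ip P (fun w => \sum_j L i j * st t j w) Z = \sum_j L i j * ip P (st t j) Z.
Proof.
move=> sZ; rewrite ip_suml//; last by move=> j; apply: sqintZ; exact: state_coord_sqint.
by apply: eq_bigr => j _; rewrite ipZl//; exact: state_coord_sqint.
Qed.

(** The noise [xi s] first enters the state at time [s.+1], so the case [t = s] is included; it is
    the one that the covariance recursion uses. *)
Lemma state_noise_ip0 t s i j : (t <= s)%N -> ip P (st t i) (xi s j) = 0.
Proof.
elim: t i => [|t IH] i ts; first by rewrite state_coord0 x0_xi_ip.
rewrite state_coordS ipDl; [|exact: drift_sqint|exact: xi_sqint..].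
rewrite xi_xi_ip ?addr0; last by rewrite ltn_eqF.
rewrite drift_ip; last exact: xi_sqint.
by rewrite big1// => k _; rewrite IH ?mulr0// ltnW.
Qed.

Lemma second_moment0 : Sg 0 = v0%:M.
Proof.
apply/matrixP => i j; rewrite !mxE !state_coord0; case: noise => h _ _.
by rewrite (isotropic_ip _ _ _ h)// oner_neq0.
Qed.

Lemma second_momentS t : Sg t.+1 = L *m Sg t *m L^T + v%:M.
Proof.
have [_ /(_ t) xiG _] := noise.
have SX i j : ip P (fun w => \sum_k L i k * st t k w) (xi t j) = 0.
  rewrite drift_ip; last exact: xi_sqint.
  by rewrite big1// => k _; rewrite state_noise_ip0 ?mulr0.
have SS i j : ip P (fun w => \sum_k L i k * st t k w) (fun w => \sum_k L j k * st t k w)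
    = (L *m Sg t *m L^T) i j.
  rewrite ipC drift_ip; last exact: drift_sqint.
  rewrite mxE; apply: eq_bigr => k _; rewrite ipC drift_ip; last exact: state_coord_sqint.
  rewrite mulrC !mxE; congr (_ * _); apply: eq_bigr => l _; congr (_ * _).
  by rewrite mxE.
have sxi := xi_sqint t; have sst := drift_sqint t.
apply/matrixP => i j; rewrite mxE [RHS]mxE -SS !state_coordS.
rewrite (ipDl (sst i) (sxi i) (sqintD (sst j) (sxi j))).
rewrite [ip P (fun w => \sum_k _) (fun w => _ + _)]ipC [ip P (xi t i) _]ipC.
rewrite (ipDl (sst j) (sxi j) (sst i)) (ipDl (sst j) (sxi j) (sxi i)).
rewrite SX [ip P (xi t j) (fun w => _)]ipC SX (isotropic_ip _ _ s0 xiG) [in RHS]mxE.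
by rewrite addr0 add0r ipC eq_sym.
Qed.

Lemma quad_entries M (x : 'cV[R]_n) : quad M x = \sum_i \sum_j M i j * (x i 0 * x j 0).
Proof.
rewrite /quad -mulmxA mxE; apply: eq_bigr => i _.
rewrite mxE mxE mulr_sumr; apply: eq_bigr => j _; ring.
Qed.

Lemma expectation_quad M t :
  P.-integrable [set: T] (fun w => (quad M (state x0 xi A B K t w))%:E) /\
  (\int[P]_w (quad M (state x0 xi A B K t w))%:E = (\tr (M *m Sg t))%:E)%E.
Proof.
have i1 i j : P.-integrable [set: T] (fun w => (st t i w * st t j w)%:E).
  by apply: sqint_mul; exact: state_coord_sqint.
have E1 i j : (\int[P]_w (st t i w * st t j w)%:E = (Sg t i j)%:E)%E.
  by rewrite mxE /ip /Rintegral fineK// integrable_fin_num.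
have i2 i j : P.-integrable [set: T] (fun w => (M i j * (st t i w * st t j w))%:E).
  by under eq_fun do rewrite EFinM; exact: integrableZl.
have i3 i : P.-integrable [set: T]
    (fun w => (\sum_j M i j * (st t i w * st t j w))%:E).
  by under eq_fun do rewrite -sumEFin; apply: integrable_sum.
under eq_fun do rewrite quad_entries.
split; first by under eq_fun do rewrite -sumEFin; apply: integrable_sum.
under eq_integral do rewrite -sumEFin.
rewrite integral_sum//= /mxtrace -sumEFin; apply: eq_bigr => i _.
under eq_integral do rewrite -sumEFin.
rewrite integral_sum//= mxE -sumEFin; apply: eq_bigr => j _.
under eq_integral do rewrite EFinM.
rewrite integralZl//; last exact: i1.
have -> : Sg t j i = Sg t i j by rewrite !mxE ipC.
by rewrite EFinM -E1.
Qed.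

Lemma expectation_average_cost (Q : 'M[R]_n) (S : 'M[R]_p) N :
  ('E_P[average_cost x0 xi A B K Q S N] =
   (N%:R^-1 * \sum_(0 <= t < N.+1) \tr ((Q + K^T *m S *m K) *m Sg t))%:E)%E.
Proof.
rewrite unlock /average_cost; set M := Q + _.
have h t w : quad Q (state x0 xi A B K t w) + quad S (K *m state x0 xi A B K t w) =
    quad M (state x0 xi A B K t w) by rewrite quadD quad_congr.
under eq_integral do under eq_bigr do rewrite h.
under eq_integral do rewrite EFinM -sumEFin.
have iq t := (expectation_quad M t).1.
rewrite integralZl//=; last exact: integrable_sum.
rewrite integral_sum//= [in RHS]EFinM -sumEFin; congr (_ * _)%E.
by apply: eq_bigr => t _; exact: (expectation_quad M t).2.
Qed.

Lemma lqr_lossE (Q : 'M[R]_n) (S : 'M[R]_p) : stabilizing A B K ->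
  lqr_loss x0 xi A B K Q S =
  (gauss_m2 sigma * \tr (dlyap (A + B *m K) (Q + K^T *m S *m K)))%:E.
Proof.
move=> /spectral_radius_schur sL; rewrite /lqr_loss.
under eq_fun do rewrite expectation_average_cost.
apply: cvg_lim => //; apply: cvg_EFin; first exact: nearW.
apply: (@average_trace_cvg _ _ _ (Q + K^T *m S *m K) v0 v Sg sL _ _
  second_moment0 second_momentS).
  by rewrite ltW// gauss_m2_gt0// oner_neq0.
by rewrite ltW// gauss_m2_gt0.
Qed.

End Noise.

(** * Compactness *)

Section Compactness.
Variables (R : realType) (q : nat).
Implicit Types f g : 'rV[R]_q -> R.

(** The parameter is a row vector because compactness of bounded closed sets is applied there;
    unknown matrices are flattened into one. *)
Definition mcontinuous a b (F : 'rV[R]_q -> 'M[R]_(a, b)) :=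
  forall i j, continuous (fun v => F v i j).

Lemma continuous_sumr (I : Type) (r : seq I) (f : I -> 'rV[R]_q -> R) :
  (forall i, continuous (f i)) -> continuous (fun v => \sum_(i <- r) f i v).
Proof.
move=> cf; elim: r => [|i r IH].
  under eq_fun do rewrite big_nil; exact: cst_continuous.
by under eq_fun do rewrite big_cons; move=> v; exact: (cvgD (cf i v) (IH v)).
Qed.

Lemma mcontinuous_cst a b (M : 'M[R]_(a, b)) : mcontinuous (fun=> M).
Proof. by move=> i j; exact: (@cst_continuous _ _ (M i j)). Qed.

Lemma mcontinuousD a b (F G : 'rV[R]_q -> 'M[R]_(a, b)) :
  mcontinuous F -> mcontinuous G -> mcontinuous (fun v => F v + G v).
Proof.
move=> cF cG i j; under eq_fun do rewrite mxE.
by move=> v; exact: (cvgD (cF i j v) (cG i j v)).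
Qed.

Lemma mcontinuousM a b c (F : 'rV[R]_q -> 'M[R]_(a, b)) (G : 'rV[R]_q -> 'M[R]_(b, c)) :
  mcontinuous F -> mcontinuous G -> mcontinuous (fun v => F v *m G v).
Proof.
move=> cF cG i j; under eq_fun do rewrite mxE.
by apply: continuous_sumr => k u; exact: (cvgM (cF i k u) (cG k j u)).
Qed.

Lemma mcontinuous_tr a b (F : 'rV[R]_q -> 'M[R]_(a, b)) :
  mcontinuous F -> mcontinuous (fun v => (F v)^T).
Proof.
by move=> cF i j; under eq_fun do rewrite mxE; exact: cF.
Qed.

Lemma mcontinuous_trace a (F : 'rV[R]_q -> 'M[R]_a) :
  mcontinuous F -> continuous (fun v => \tr (F v)).
Proof. by move=> cF; apply: continuous_sumr => i; exact: cF. Qed.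

Lemma mcontinuous_id : mcontinuous id.
Proof. by move=> i j; exact: coord_continuous. Qed.

Lemma closed_nonneg f : continuous f -> closed [set v | 0 <= f v]%classic.
Proof.
move=> cf; apply: (@preimage_closed _ _ f [set x | 0 <= x]%classic); last exact: closed_ge.
by move=> v _; exact: cf.
Qed.

Lemma closed_mx_eq a b (F G : 'rV[R]_q -> 'M[R]_(a, b)) :
  mcontinuous F -> mcontinuous G -> closed [set v | F v = G v]%classic.
Proof.
move=> cF cG.
have -> : [set v | F v = G v]%classic =
    (\bigcap_(ij in [set: 'I_a * 'I_b]) [set v | F v ij.1 ij.2 - G v ij.1 ij.2 = 0])%classic.
  apply/seteqP; split=> [v /= e ij _ /=|v h]; first by rewrite e subrr.
  by apply/matrixP => i j; apply/eqP; rewrite -subr_eq0; apply/eqP/(h (i, j)).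
apply: closed_bigI => -[i j] _ /=.
apply: (@preimage_closed _ _ (fun v => F v i j - G v i j) [set x | x = 0]%classic).
  by move=> v _; exact: (cvgB (cF i j v) (cG i j v)).
exact: closed_eq.
Qed.

Lemma closed_psd a (F : 'rV[R]_q -> 'M[R]_a) :
  mcontinuous F -> closed [set v | forall x, 0 <= quad (F v) x]%classic.
Proof.
move=> cF.
have -> : [set v | forall x, 0 <= quad (F v) x]%classic =
    (\bigcap_(x in [set: 'cV[R]_a]) [set v | 0 <= quad (F v) x])%classic.
  by apply/seteqP; split=> [v h x _|v h x]; exact: h.
apply: closed_bigI => x _; apply: closed_nonneg.
by apply: (mcontinuousM (mcontinuousM (@mcontinuous_cst _ _ x^T) cF) (@mcontinuous_cst _ _ x)).
Qed.

Lemma bounded_closed_min (A : set 'rV[R]_q) f b : (A !=set0)%classic -> closed A ->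
  (forall v, A v -> forall j, `|v 0 j| <= b) -> continuous f ->
  exists2 v, A v & forall u, A u -> f v <= f u.
Proof.
move=> A0 clA bA cf.
have cA : compact A.
  apply: bounded_closed_compact => //; exists `|b|; split; first exact: num_real.
  move=> M bM v Av; rewrite /Num.norm/= mx_normrE; apply: bigmax_le.
    exact: le_trans (normr_ge0 b) (ltW bM).
  move=> [i j] _ /=; rewrite ord1 (le_trans (bA v Av j))// (le_trans (ler_norm b))// ltW//.
have [v Av fv] := compact_EVT_min A0 cA (continuous_subspaceT cf).
exists v; first exact: set_mem.
by move=> u Au; apply: fv; rewrite inE.
Qed.

End Compactness.

Section LowerBound.
Variable R : realType.

(* The minimum of the Rayleigh quotient is an eigenvalue. *)
Lemma sigma_min_loewner n (M : 'M[R]_n) : posdefmx M -> 1 <= sigma_min M ->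
  loewner 1%:M M.
Proof.
case: n M => [|n] M [sM pM] s1.
  move=> x; rewrite [x]flatmx0 quad1 /quad mulmx0 mxE.
  by have /eqP -> : sqn (0 : 'cV[R]_0) == 0 by rewrite sqn_eq0.
pose A : set 'rV[R]_n.+1 := [set v | v *m v^T = 1%:M]%classic.
have sqnE (v : 'rV[R]_n.+1) : v *m v^T = (sqn v^T)%:M.
  by apply/matrixP => i j; rewrite !ord1 -dot_sqn trmxK [RHS]mxE eqxx mulr1n.
have [v Av vmin] : exists2 v, A v & forall u, A u -> quad M v^T <= quad M u^T.
  apply: (@bounded_closed_min _ _ A (fun v => quad M v^T) 1).
  - by exists (delta_mx 0 0); rewrite /A/= sqnE trmx_delta sqn_delta.
  - apply: closed_mx_eq; last exact: mcontinuous_cst.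
    apply: mcontinuousM; first exact: mcontinuous_id.
    exact/mcontinuous_tr/mcontinuous_id.
  - move=> v; rewrite /A/= sqnE => /(congr1 (fun M : 'M[R]_1 => M 0 0)).
    rewrite !mxE eqxx !mulr1n => v1 j.
    have := l2norm_entry v^T j; rewrite mxE => /le_trans; apply.
    by rewrite -(@ler_pXn2r _ 2) ?nnegrE ?l2norm_ge0// sqr_l2norm v1 expr1n.
  - rewrite /quad; under eq_fun do rewrite trmxK.
    have idc := @mcontinuous_id R n.+1.
    exact: (mcontinuousM (mcontinuousM idc (@mcontinuous_cst _ _ _ _ M)) (mcontinuous_tr idc)).
have v1 : sqn v^T = 1.
  move: Av; rewrite /A/= sqnE => /(congr1 (fun M : 'M[R]_1 => M 0 0)).
  by rewrite !mxE eqxx !mulr1n.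
pose x := v^T; pose l := quad M x.
have lmin y : l * sqn y <= quad M y.
  have [->|y0] := eqVneq y 0; first by rewrite -[0](scale0r 0) sqnZ quadZr expr0n !mul0r mulr0.
  have ly : 0 < l2norm y by rewrite sqrtr_gt0 sqn_gt0.
  have := vmin ((l2norm y)^-1 *: y)^T; rewrite /A/= sqnE !trmxK sqnZ exprVn sqr_l2norm.
  rewrite mulVf ?gt_eqF ?sqn_gt0// => /(_ erefl).
  by rewrite quadZr exprVn sqr_l2norm mulrC ler_pdivlMr ?sqn_gt0.
have x0 : x != 0 by rewrite -sqn_eq0 v1 oner_neq0.
have Mx : M *m x = l *: x.
  apply/eqP; rewrite -subr_eq0 -sqn_eq0; apply/eqP.
  set z := M *m x - l *: x.
  pose N := M - l%:M.
  have sN : N^T = N by rewrite /N trmxD trmxN sM tr_scalar_mx.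
  have Nx : N *m x = z by rewrite /N mulmxBl mul_scalar_mx.
  have N0 y : 0 <= quad N y by rewrite quadB quad_scalar subr_ge0.
  have Nx0 : quad N x = 0 by rewrite quadB quad_scalar v1 mulr1 subrr.
  have xz : (x^T *m N *m z) 0 0 = sqn z.
    by rewrite -{1}sN -trmx_mul Nx dot_sqn.
  have h t : 0 <= - 2 * t * sqn z + t ^+ 2 * quad N z.
    have := N0 (x - t *: z); rewrite quadBr// Nx0 quadZr -scalemxAr scalemx_entry xz.
    lra.
  apply/eqP; rewrite eq_le sqn_ge0 andbT leNgt; apply/negP => z0.
  (* The form of [N] is nonnegative and vanishes at [x], so [h] forbids a first-order decrease along
     [z]. The step [sqn z / k] would give a negative value; the [+ 1] keeps [k] positive. *)
  pose k := quad N z + 1; have k0 : 0 < k by rewrite ltr_wpDl.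
  have := h (sqn z / k).
  have -> : - 2 * (sqn z / k) * sqn z + (sqn z / k) ^+ 2 * quad N z =
    (sqn z / k) ^+ 2 * (quad N z - 2 * k) by field; rewrite gt_eqF.
  rewrite leNgt => /negP; apply; rewrite pmulr_rlt0 ?exprn_gt0 ?divr_gt0//.
  by rewrite /k; have := N0 z; lra.
have l0 : 0 < l by exact: pM.
have l1 : 1 <= l.
  apply: (le_trans s1); apply: ge_inf.
    by exists 0 => s [].
  split; first exact: ltW.
  apply/eigenvalueP; exists v; last by apply: contra_neq x0 => v0; rewrite /x v0 trmx0.
  have vM : v *m M = l *: v by apply: trmx_inj; rewrite trmx_mul sM Mx trmxZ.
  by rewrite sM mulmxA vM -scalemxAl vM scalerA expr2.
by move=> y; rewrite quad1 (le_trans _ (lmin y))// ler_peMl// sqn_ge0.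
Qed.

End LowerBound.

Lemma simplex_nonempty (R : realType) m : (0 < m)%N -> (@simplex R m !=set0)%classic.
Proof.
case: m => // m _; exists (delta_mx 0 0 : 'rV[R]_m.+1); split=> [i|].
  by rewrite mxE ler0n.
rewrite /l1norm (bigD1 0)//= mxE !eqxx normr1 big1 ?addr0// => i i0.
by rewrite mxE (negbTE i0) andbF normr0.
Qed.

(** * The point of minimal norm of a convex hull *)

Section MinimalNormPoint.
Variables (R : realType) (a b : nat).

Definition inner (X Y : 'M[R]_(a, b)) : R := \tr (X^T *m Y).

Lemma innerC X Y : inner X Y = inner Y X.
Proof. by rewrite /inner -mxtrace_tr trmx_mul trmxK. Qed.

Lemma innerDr X Y Z : inner X (Y + Z) = inner X Y + inner X Z.
Proof. by rewrite /inner mulmxDr linearD. Qed.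

Lemma innerZr c X Y : inner X (c *: Y) = c * inner X Y.
Proof. by rewrite /inner -scalemxAr linearZ. Qed.

Lemma innerD Y Z : inner (Y + Z) (Y + Z) = inner Y Y + 2 * inner Y Z + inner Z Z.
Proof. by rewrite innerDr !(innerC (Y + Z)) !innerDr (innerC Z Y); ring. Qed.

Lemma inner_ge0 X : 0 <= inner X X.
Proof.
by apply: sumr_ge0 => i _; rewrite mxE; apply: sumr_ge0 => j _; rewrite mxE -expr2 sqr_ge0.
Qed.

Lemma inner_eq0 X : inner X X = 0 -> X = 0.
Proof.
move=> X0; apply/matrixP => i j; rewrite mxE; apply/eqP; rewrite -sqrf_eq0.
rewrite eq_le sqr_ge0 andbT -X0 /inner /mxtrace (bigD1 j)//= mxE (bigD1 i)//= mxE -expr2.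
rewrite -addrA lerDl addr_ge0//; apply: sumr_ge0 => k _.
  by rewrite mxE -expr2 sqr_ge0.
by rewrite mxE; apply: sumr_ge0 => l _; rewrite mxE -expr2 sqr_ge0.
Qed.

(** Minimizing over the weights rather than over the hull delivers the weights with the point. The
    inequality is the first-order condition for moving from the minimizer towards the vertex
    [G i]. *)
Lemma min_norm_simplex m (G : 'I_m -> 'M[R]_(a, b)) : (0 < m)%N ->
  exists2 w : 'rV[R]_m, simplex w &
    forall i, inner (\sum_k w 0 k *: G k) (\sum_k w 0 k *: G k) <=
              inner (\sum_k w 0 k *: G k) (G i).
Proof.
move=> m0; pose g (w : 'rV[R]_m) := \sum_k w 0 k *: G k.
have simplexE (w : 'rV[R]_m) : simplex w <-> (forall i, 0 <= w 0 i) /\ \sum_i w 0 i = 1.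
  split=> -[w0 w1]; split=> //; move: w1; rewrite /l1norm.
    by under eq_bigr do rewrite ger0_norm//.
  by under [in X in _ -> X]eq_bigr do rewrite ger0_norm//.
have cg : mcontinuous g.
  move=> i j; rewrite /g; under eq_fun do rewrite summxE.
  apply: continuous_sumr => k; under eq_fun do rewrite mxE.
  by move=> u; exact: (cvgM (@coord_continuous _ _ _ 0 k u) (cvg_cst _)).
have [w sw wmin] : exists2 w, simplex w & forall u, simplex u ->
    inner (g w) (g w) <= inner (g u) (g u).
  apply: (@bounded_closed_min _ _ (@simplex R m) _ 1).
  - exact: simplex_nonempty.
  - have -> : @simplex R m = ((\bigcap_(i in [set: 'I_m]) [set w : 'rV[R]_m | 0 <= w 0 i]) `&`
       [set w : 'rV[R]_m | (\sum_i w 0 i)%:M = 1%:M :> 'M[R]_1])%classic.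
      apply/seteqP; split=> w.
        by case/simplexE => w0 w1; split=> //=; [move=> i _; exact: w0|rewrite w1].
      case=> /= w0 /(congr1 (fun M : 'M[R]_1 => M 0 0)); rewrite !mxE eqxx !mulr1n => w1.
      by apply/simplexE; split=> // i; exact: w0.
    apply: closedI.
      by apply: closed_bigI => i _; apply: closed_nonneg; exact: coord_continuous.
    apply: closed_mx_eq; last exact: mcontinuous_cst.
    move=> i j; rewrite (ord1 i) (ord1 j); under eq_fun do rewrite mxE eqxx mulr1n.
    by apply: continuous_sumr => k; exact: coord_continuous.
  - move=> v /simplexE[v0 v1] j; rewrite ger0_norm// -v1 (bigD1 j)//= lerDl.
    exact: sumr_ge0.
  - by apply: mcontinuous_trace; apply: mcontinuousM => //; exact: mcontinuous_tr.
exists w => // i; rewrite -/(g w).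
have [w0 w1] := (simplexE w).1 sw.
pose X := G i - g w.
have h s : 0 <= s <= 1 -> 0 <= 2 * s * inner (g w) X + s ^+ 2 * inner X X.
  move=> /andP[s0 s1].
  pose u : 'rV[R]_m := \row_k ((1 - s) * w 0 k + s * (k == i)%:R).
  have su : simplex u.
    apply/simplexE; split=> [k|].
      by rewrite mxE addr_ge0// mulr_ge0 ?ler0n ?subr_ge0 ?w0.
    under eq_bigr do rewrite mxE; rewrite big_split/= -!mulr_sumr w1.
    rewrite (bigD1 i)//= eqxx big1 => [|k /negbTE ->//]; by rewrite addr0 !mulr1 subrK.
  have gu : g u = g w + s *: X.
    rewrite /g; under eq_bigr do rewrite mxE scalerDl -!scalerA.
    rewrite big_split/= -!scaler_sumr -/(g w) (bigD1 i)//= eqxx scale1r.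
    rewrite big1 => [|k /negbTE ->]; last by rewrite scale0r.
    by rewrite addr0 /X scalerBr scalerBl scale1r addrA addrAC.
  have := wmin u su; rewrite gu innerD !innerZr (innerC (s *: X) X) innerZr; lra.
rewrite -subr_ge0 -[- inner _ _]mulN1r -innerZr -innerDr scaleN1r -/X.
rewrite leNgt; apply/negP => neg.
(* If [inner (g w) X < 0], the step [- inner (g w) X / k] lies in the unit interval and is short
   enough for the linear term to win over the quadratic one. *)
pose k := inner X X - inner (g w) X.
have X0 := inner_ge0 X.
have k0 : 0 < k by rewrite /k; lra.
have s01 : 0 <= - inner (g w) X / k <= 1.
  by rewrite divr_ge0 ?oppr_ge0 ?(ltW neg) ?(ltW k0)//= ler_pdivrMr// mul1r /k; lra.
have := h _ s01.
have -> : 2 * (- inner (g w) X / k) * inner (g w) X + (- inner (g w) X / k) ^+ 2 * inner X X =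
   (inner (g w) X / k) ^+ 2 * (inner X X - 2 * k) by field; rewrite gt_eqF.
rewrite leNgt => /negP; apply; rewrite pmulr_rlt0; first by rewrite /k; lra.
by rewrite exprn_even_gt0//= mulf_neq0 ?invr_eq0 ?(gt_eqF k0) ?(lt_eqF neg).
Qed.

End MinimalNormPoint.

(** * Perturbation of Lyapunov equations and first-order optimality *)

Section Perturbation.
Variable R : realType.

Lemma loewner_opb n (X : 'M[R]_n) q : X^T = X -> 0 <= q ->
  loewner 0 X -> loewner X q%:M -> opb X q.
Proof.
move=> sX q0 X0 Xq; apply: sym_opb => // x; rewrite quadN quad_scalar.
by have := X0 x; rewrite quad0 => h; rewrite (@le_trans _ _ 0) ?oppr_le0// mulr_ge0// sqn_ge0.
Qed.

Lemma tr_opb n (X : 'M[R]_n) c : opb X c -> `|\tr X| <= n%:R * c.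
Proof.
move=> h; rewrite /mxtrace (le_trans (ler_norm_sum _ _ _))//.
have -> : n%:R * c = \sum_(i < n) c by rewrite sumr_const card_ord mulr_natl.
by apply: ler_sum => i _; exact: opb_entry.
Qed.

Lemma trace_quad n (X Y : 'M[R]_n) : (forall x, quad X x = quad Y x) -> \tr X = \tr Y.
Proof.
by move=> h; apply: le_anti; rewrite !loewner_trace// => x; rewrite h.
Qed.

Lemma congr_diff_opb m n (L L' : 'M[R]_(m, n)) (X : 'M[R]_m) q l h : 0 <= q -> 0 <= l -> 0 <= h ->
  opb X q -> opb L l -> opb (L' - L) h ->
  opb (L'^T *m X *m L' - L^T *m X *m L) (q * (2 * l * h + h ^+ 2)).
Proof.
move=> q0 l0 h0 Xq Ll Eh; set E := L' - L in Eh.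
have -> : L'^T *m X *m L' - L^T *m X *m L =
    L^T *m X *m E + E^T *m X *m L + E^T *m X *m E.
  have -> : L' = L + E by rewrite addrC subrK.
  rewrite trmxD !mulmxDl !mulmxDr.
  move: (L^T *m X *m L) (L^T *m X *m E) (E^T *m X *m L) (E^T *m X *m E) => a b c e.
  by apply/matrixP => i j; rewrite !mxE; ring.
have lq : 0 <= l * q by rewrite mulr_ge0.
have hq : 0 <= h * q by rewrite mulr_ge0.
have tL := opb_tr l0 Ll; have tE := opb_tr h0 Eh.
have e1 := opbM lq (opbM l0 tL Xq) Eh.
have e2 := opbM hq (opbM h0 tE Xq) Ll.
have e3 := opbM hq (opbM h0 tE Xq) Eh.
apply: opb_le (opbD (opbD e1 e2) e3); lra.
Qed.

Lemma congr_diff_sym m n (L L' : 'M[R]_(m, n)) (X : 'M[R]_m) : X^T = X ->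
  (L'^T *m X *m L' - L^T *m X *m L)^T = L'^T *m X *m L' - L^T *m X *m L.
Proof. by move=> sX; rewrite trmxD trmxN !trmx_mul !trmxK sX !mulmxA. Qed.

(** By monotonicity, the inverse Lyapunov operator on symmetric matrices has its norm controlled by
    its value at the identity. *)
Lemma dlyap_opb n (L N : 'M[R]_n) c q : schur L -> N^T = N -> 0 <= c ->
  opb N c -> opb (dlyap L 1%:M) q -> opb (dlyap L N) (c * q).
Proof.
move=> sL sN c0 Nc Dq.
have key (M : 'M[R]_n) : opb M c -> loewner (dlyap L M) (c * q)%:M.
  move=> Mc; apply: loewner_trans (dlyap_mono sL (opb_quad Mc)) _.
  have -> : (c%:M : 'M[R]_n) = c *: 1%:M by rewrite scale_scalar_mx mulr1.
  rewrite dlyapZ// => x.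
  rewrite quadZ quad_scalar -mulrA ler_wpM2l//.
  by have := opb_quad Dq x; rewrite quad_scalar.
apply: sym_opb; [exact: dlyap_sym|exact: key|].
by rewrite -scaleN1r -dlyapZ// scaleN1r; apply: key; exact: opbN.
Qed.

(** An exact resolvent identity: the old solution is inserted into the new equation, and its defect
    is propagated by the new operator. *)
Lemma dlyap_diff n (L L' M M' : 'M[R]_n) : schur L -> schur L' ->
  dlyap L' M' - dlyap L M =
  dlyap L' ((L'^T *m dlyap L M *m L' - L^T *m dlyap L M *m L) + (M' - M)).
Proof.
move=> sL sL'; apply: dlyap_unique => //.
rewrite mulmxBr mulmxBl {1}(dlyapE sL' M') {1}(dlyapE sL M).
move: (L'^T *m dlyap L' M' *m L') (L'^T *m dlyap L M *m L') (L^T *m dlyap L M *m L).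
by move=> a b c; apply/matrixP => i j; rewrite !mxE; ring.
Qed.

(** Scaling [P] by [1 + a] creates the slack [a *: M >= a I]. It pays for the change of the closed
    loop, itself scaled by [1 + a], and for [mu]. *)
Lemma perturb_super n (L L' P M M' : 'M[R]_n) q l h mu a : 0 <= q -> 0 <= l -> 0 <= h ->
  loewner (L^T *m P *m L + M) P -> loewner 1%:M M -> loewner M' (M + mu%:M) ->
  opb P q -> opb L l -> opb (L' - L) h -> 0 <= a ->
  (1 + a) * (q * (2 * l * h + h ^+ 2)) + mu <= a ->
  loewner (L'^T *m ((1 + a) *: P) *m L' + M') ((1 + a) *: P).
Proof.
move=> q0 l0 h0 PL M1 MM' Pq Ll Eh a0 ha x.
have := opb_quad (congr_diff_opb q0 l0 h0 Pq Ll Eh) x.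
rewrite quad_scalar quadB -scalemxAr -scalemxAl quadD !quadZ.
move: (PL x) (M1 x) (MM' x); rewrite !quadD quad1 quad_scalar.
set d := q * _ in ha *; move=> PLx M1x MM'x h1.
have s0 := sqn_ge0 x.
have h2 : (1 + a) * quad (L'^T *m P *m L') x <=
    (1 + a) * (quad (L^T *m P *m L) x + d * sqn x).
  by rewrite ler_wpM2l ?addr_ge0//; lra.
have h3 : (1 + a) * (quad (L^T *m P *m L) x + quad M x) <= (1 + a) * quad P x.
  by rewrite ler_wpM2l ?addr_ge0.
have h4 : a * sqn x <= a * quad M x by rewrite ler_wpM2l.
have h5 : ((1 + a) * d + mu) * sqn x <= a * sqn x by rewrite ler_wpM2r.
lra.
Qed.

Lemma dlyap_near n (L F : 'M[R]_n) : schur L -> exists t0 c : R,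
  [/\ 0 < t0, 0 <= c & forall t, 0 < t <= t0 ->
  [/\ schur (L + t *: F), opb (dlyap (L + t *: F) 1%:M) c &
      opb (dlyap (L + t *: F) 1%:M - dlyap L 1%:M) (c * t)]].
Proof.
move=> sL; set P := dlyap L 1%:M.
have I0 : loewner 0 (1%:M : 'M[R]_n) by move=> x; rewrite quad0 quad1 sqn_ge0.
have sI : (1%:M : 'M[R]_n)^T = 1%:M by exact: trmx1.
have P0 : loewner 0 P by exact: dlyap_ge0.
have PE : P = L^T *m P *m L + 1%:M by exact: dlyapE.
pose q := opnorm P; pose l := opnorm L; pose f := opnorm F.
have [q0 l0 f0] : [/\ 0 <= q, 0 <= l & 0 <= f] by split; exact: opnorm_ge0.
pose k := q * (2 * l * f + f ^+ 2).
have k0 : 0 <= k by rewrite !(mulr_ge0, addr_ge0) ?sqr_ge0.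
have k1 : 0 < 2 * (k + 1) by rewrite mulr_gt0// ltr_wpDl.
exists (Num.min 1 (2 * (k + 1))^-1), (2 * q * (1 + k)); split.
- by rewrite lt_min ltr01 invr_gt0.
- by rewrite !mulr_ge0// addr_ge0.
move=> t /andP[t0]; rewrite le_min => /andP[t1 tk].
have tk1 : t * (2 * (k + 1)) <= 1 by rewrite -ler_pdivlMr// mul1r.
have Eh : opb (L + t *: F - L) (t * f).
  rewrite addrAC subrr add0r -{2}(ger0_norm (ltW t0)).
  by apply: opbZ; exact: opb_opnorm.
have tf0 : 0 <= t * f by rewrite mulr_ge0// ltW.
have dk : q * (2 * l * (t * f) + (t * f) ^+ 2) <= t * k.
  rewrite /k [leRHS]mulrCA ler_wpM2l// exprMn mulrDr lerD//; first by lra.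
  by rewrite ler_wpM2r ?sqr_ge0// expr2 ler_piMr// ltW.
have sup : loewner ((L + t *: F)^T *m ((1 + 1) *: P) *m (L + t *: F) + 1%:M) ((1 + 1) *: P).
  apply: (@perturb_super _ L _ P 1%:M _ q l (t * f) 0) => //.
  - by rewrite -PE.
  - by move=> x; rewrite quadD quad_scalar mul0r addr0.
  - exact: opb_opnorm.
  - exact: opb_opnorm.
  - rewrite addr0; lra.
have P20 : loewner 0 ((1 + 1) *: P).
  by move=> x; rewrite quad0 quadZ mulr_ge0//; have := P0 x; rewrite quad0.
have sL' := lyapunov_schur P20 sup.
have opb' : opb (dlyap (L + t *: F) 1%:M) (2 * q).
  apply: loewner_opb; [exact: dlyap_sym|by rewrite mulr_ge0|exact: dlyap_ge0|].
  apply: loewner_trans (dlyap_le sL' sup) _ => x.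
  rewrite quadZ quad_scalar -mulrA ler_wpM2l//.
  by have := opb_quad (opb_opnorm P) x; rewrite quad_scalar.
split=> //; first by apply: opb_le opb'; rewrite ler_peMr ?mulr_ge0// lerDl.
rewrite dlyap_diff// subrr addr0.
have tk0 : 0 <= t * k by rewrite mulr_ge0// ltW.
apply: (@opb_le _ _ _ _ (t * k * (2 * q))); first by have := mulr_ge0 q0 (ltW t0); lra.
apply: dlyap_opb => //.
  exact/congr_diff_sym/dlyap_sym.
apply: opb_le dk _; apply: congr_diff_opb => //; exact: opb_opnorm.
Qed.

Lemma loewner1_unit n (H : 'M[R]_n) : loewner 1%:M H -> H \in unitmx.
Proof.
move=> H1; rewrite -row_free_unit -kermx_eq0; apply/eqP/row_matrixP => i.
rewrite row0; set u := row i _.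
have uH : u *m H = 0 by rewrite /u -row_mul mulmx_ker row0.
have := H1 u^T; rewrite quad1 /quad trmxK uH mul0mx mxE => h.
by apply: trmx_inj; rewrite trmx0; apply/eqP; rewrite -sqn_eq0 eq_le h sqn_ge0.
Qed.

End Perturbation.

(** * Cost matrices under a change of gain *)

Section CostMatrix.
Variables (R : realType) (n p : nat) (A : 'M[R]_n) (B : 'M[R]_(n, p)).

Definition cost_mx (K : 'M[R]_(p, n)) (Q : 'M[R]_n) (S : 'M[R]_p) : 'M[R]_n :=
  dlyap (A + B *m K) (Q + K^T *m S *m K).

(** [P] is a free argument because [gain_perturbation] pairs one gain with the cost matrix of
    another. *)
Definition grad_mx (K : 'M[R]_(p, n)) (S : 'M[R]_p) (P : 'M[R]_n) : 'M[R]_(p, n) :=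
  S *m K + B^T *m P *m (A + B *m K).

Lemma stage_sym K (Q : 'M[R]_n) (S : 'M[R]_p) : Q^T = Q -> S^T = S ->
  (Q + K^T *m S *m K)^T = Q + K^T *m S *m K.
Proof. by move=> sQ sS; rewrite trmxD !trmx_mul trmxK sQ sS mulmxA. Qed.

Lemma complete_square K D S P x : P^T = P -> S^T = S ->
  quad P ((A + B *m (K + D)) *m x) + quad S ((K + D) *m x) =
  quad P ((A + B *m K) *m x) + quad S (K *m x)
  + 2 * ((D *m x)^T *m (grad_mx K S P *m x)) 0 0
  + quad (S + B^T *m P *m B) (D *m x).
Proof.
move=> sP sS; rewrite mulmxDr addrA (mulmxDl (A + B *m K)) (mulmxDl K) !quadDr//.
rewrite quadD quad_congr -!mulmxA.
have e1 : (((A + B *m K) *m x)^T *m (P *m (B *m (D *m x)))) 0 0 =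
    ((D *m x)^T *m (B^T *m (P *m ((A + B *m K) *m x)))) 0 0.
  by rewrite dotC !trmx_mul sP -!mulmxA.
have e2 : ((K *m x)^T *m (S *m (D *m x))) 0 0 = ((D *m x)^T *m (S *m (K *m x))) 0 0.
  by rewrite dotC !trmx_mul sS -!mulmxA.
rewrite e1 e2 /grad_mx mulmxDl mulmxDr [X in _ + _ + 2 * X]mxE -!mulmxA; ring.
Qed.

(** [P' - P] solves, as a quadratic form, the Lyapunov equation of the new loop with right side [N].
    As [N] need not be symmetric, only the forms agree, which is enough for the trace; [tr_dlyap]
    then brings in the covariance of the new loop. *)
Lemma cost_difference K D Q S : Q^T = Q -> S^T = S ->
  schur (A + B *m K) -> schur (A + B *m (K + D)) ->
  let P := cost_mx K Q S in let Sg := dlyap (A + B *m (K + D))^T 1%:M in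
  \tr (cost_mx (K + D) Q S) - \tr P =
  2 * inner D (grad_mx K S P *m Sg) + \tr (D^T *m (S + B^T *m P *m B) *m D *m Sg).
Proof.
move=> sQ sS sL sL' P Sg; set P' := cost_mx _ Q S; set L' := A + B *m (K + D).
set E := grad_mx K S P; set H := S + _.
have sP : P^T = P by apply: dlyap_sym => //; exact: stage_sym.
pose N := 2 *: (D^T *m E) + D^T *m H *m D.
have key : \tr (P' - P) = \tr (dlyap L' N).
  apply: trace_quad => x.
  have h y : quad (P' - P) y = quad (P' - P) (L' *m y) + quad N y.
    have PE : quad P y = quad P ((A + B *m K) *m y) + quad Q y + quad S (K *m y).
      by rewrite {1}/P /cost_mx (dlyapE sL) !quadD !quad_congr addrA.
    have P'E : quad P' y = quad P' (L' *m y) + quad Q y + quad S ((K + D) *m y).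
      by rewrite {1}/P' /cost_mx (dlyapE sL') !quadD !quad_congr addrA.
    have NE : quad N y = 2 * ((D *m y)^T *m (E *m y)) 0 0 + quad H (D *m y).
      by rewrite /N quadD quadZ quad_mul quad_congr.
    rewrite !quadB NE; have := complete_square K D y sP sS; rewrite -/L' -/E -/H; lra.
  apply: le_anti; apply/andP; split.
    by apply: dlyap_ge => // y; rewrite [leRHS]quadD quad_congr -h.
  by apply: dlyap_le => // y; rewrite [leLHS]quadD quad_congr -h.
rewrite -linearB/= -/P' key tr_dlyap// -/Sg mulmxDl linearD/=; congr (_ + _).
by rewrite -scalemxAl linearZ/= /inner mulmxA.
Qed.

(** The Bellman inequality: with a zero gradient, completing the square leaves only the nonnegative
    Hessian term. *)
Lemma cost_mx_le K Q S K' : Q^T = Q -> S^T = S ->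
  schur (A + B *m K) -> let P := cost_mx K Q S in
  grad_mx K S P = 0 -> loewner 0 (S + B^T *m P *m B) ->
  loewner P ((A + B *m K')^T *m P *m (A + B *m K') + (Q + K'^T *m S *m K')).
Proof.
move=> sQ sS sL P E0 H0 x.
have sP : P^T = P by apply: dlyap_sym => //; exact: stage_sym.
have PE : quad P x = quad P ((A + B *m K) *m x) + quad Q x + quad S (K *m x).
  by rewrite {1}/P /cost_mx (dlyapE sL) !quadD !quad_congr addrA.
have := complete_square K (K' - K) x sP sS; rewrite E0 mul0mx mulmx0 mxE mulr0 addr0.
rewrite [K + _]addrC subrK !quadD !quad_congr => e.
by have := H0 ((K' - K) *m x); rewrite quad0 quadD quad_congr; lra.
Qed.

(** The linear gain is [2 t e]; half of it covers all the terms of order [t ^+ 2]. *)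
Lemma first_order_neg (t e a b c1 c2 : R) :
  t * a <= t * (- e + c1 * t) -> t ^+ 2 * b <= t ^+ 2 * c2 ->
  t * (t * (2 * c1 + c2)) <= t * e -> 0 < t * e -> 2 * (t * a) + t ^+ 2 * b < 0.
Proof. move=> h1 h2 h3 h4; lra. Qed.

(** The covariance [Sg] depends on the closed loop alone, so it is common to all costs. Being at
    least the identity, it is invertible and can be cancelled from the vanishing combination. *)
Lemma stationary_weights m (Q : 'I_m -> 'M[R]_n) (S : 'I_m -> 'M[R]_p) K :
  (0 < m)%N -> (forall i, (Q i)^T = Q i) -> (forall i, (S i)^T = S i) ->
  schur (A + B *m K) ->
  (forall K', schur (A + B *m K') ->
    ~ forall i, \tr (cost_mx K' (Q i) (S i)) < \tr (cost_mx K (Q i) (S i))) ->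
  exists2 w : 'rV[R]_m, simplex w &
    \sum_i w 0 i *: grad_mx K (S i) (cost_mx K (Q i) (S i)) = 0.
Proof.
move=> m0 sQ sS sL nobetter; set E := fun i => grad_mx K (S i) (cost_mx K (Q i) (S i)).
have sLT := schur_trmx sL; pose Sg := dlyap (A + B *m K)^T 1%:M.
have I0 : loewner 0 (1%:M : 'M[R]_n) by move=> x; rewrite quad0 quad1 sqn_ge0.
have Sg1 : loewner 1%:M Sg by exact: dlyap_geM.
have [w sw wmin] := min_norm_simplex (fun i => E i *m Sg) m0; exists w => //.
set g := \sum_k w 0 k *: (E k *m Sg) in wmin.
have gE : g = (\sum_i w 0 i *: E i) *m Sg.
  by rewrite mulmx_suml; apply: eq_bigr => i _; rewrite scalemxAl.
have uS := loewner1_unit Sg1.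
suff g0 : g = 0 by rewrite -[LHS](mulmxK uS) -gE g0 mul0mx.
apply: inner_eq0; apply/eqP; apply: contraT => gn0.
have e0 : 0 < inner g g by rewrite lt_def gn0 inner_ge0.
set e := inner g g in e0 wmin.
(* The cost difference involves the covariance of the new loop; [dlyap_near], applied to the
   transposes, replaces it by [Sg] up to order [t]. *)
pose D := - g; have [t0 [c [t00 c0 near]]] := dlyap_near (B *m D)^T sLT.
pose H i := D^T *m (S i + B^T *m cost_mx K (Q i) (S i) *m B) *m D.
pose C1 i := n%:R * (opnorm (D^T *m E i) * c).
pose C2 i := n%:R * (opnorm (H i) * c).
(* One step size has to serve every cost at once, hence the sum. *)
pose C := \sum_i (2 * C1 i + C2 i).
have C10 i : 0 <= C1 i by rewrite !mulr_ge0 ?opnorm_ge0.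
have C20 i : 0 <= C2 i by rewrite !mulr_ge0 ?opnorm_ge0.
have CiC i : 2 * C1 i + C2 i <= C.
  rewrite /C (bigD1 i)//= lerDl; apply: sumr_ge0 => j _.
  by rewrite addr_ge0// mulr_ge0.
have C0 : 0 <= C by apply: sumr_ge0 => j _; rewrite addr_ge0// mulr_ge0.
have C1' : 0 < C + 1 by rewrite ltr_wpDl.
pose t := Num.min t0 (e / (C + 1)).
have tpos : 0 < t by rewrite lt_min t00 divr_gt0.
have tt0 : t <= t0 by rewrite ge_min lexx.
have tC : t * (C + 1) <= e by rewrite -ler_pdivlMr// ge_min lexx orbT.
have [sLt St SSt] := near t (introT andP (conj tpos tt0)).
have LtE : (A + B *m K)^T + t *: (B *m D)^T = (A + B *m (K + t *: D))^T.
  by rewrite -trmxZ -trmxD scalemxAr mulmxDr addrA.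
rewrite LtE in sLt St SSt.
have sLt' : schur (A + B *m (K + t *: D)) by rewrite -[_ + _]trmxK; exact: schur_trmx.
exfalso; apply: (nobetter _ sLt') => i.
rewrite -subr_lt0 cost_difference// -/(E i); set St' := dlyap _ _ in St SSt *.
have -> : inner (t *: D) (E i *m St') =
    t * (- inner g (E i *m Sg) + \tr (D^T *m E i *m (St' - Sg))).
  have -> : E i *m St' = E i *m Sg + E i *m (St' - Sg).
    by rewrite -mulmxDr addrC subrK.
  have i1 : inner D (E i *m Sg) = - inner g (E i *m Sg).
    by rewrite /inner /D trmxN mulNmx linearN.
  have i2 : inner D (E i *m (St' - Sg)) = \tr (D^T *m E i *m (St' - Sg)).
    by rewrite /inner mulmxA.
  by rewrite innerC innerZr innerC innerDr i1 i2.
have -> : \tr ((t *: D)^T *m (S i + B^T *m cost_mx K (Q i) (S i) *m B) *m (t *: D) *m St')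
    = t ^+ 2 * \tr (H i *m St').
  by rewrite trmxZ -!scalemxAr -!scalemxAl !linearZ/= mulrA expr2.
have b1 : \tr (D^T *m E i *m (St' - Sg)) <= C1 i * t.
  rewrite (le_trans (ler_norm _))// /C1 -!mulrA; apply: tr_opb.
  by apply: opbM (opb_opnorm _) SSt; exact: opnorm_ge0.
have b2 : \tr (H i *m St') <= C2 i.
  rewrite (le_trans (ler_norm _))//; apply: tr_opb.
  by apply: opbM (opb_opnorm _) St; exact: opnorm_ge0.
have b3 := wmin i.
have f1 : t * (- inner g (E i *m Sg) + \tr (D^T *m E i *m (St' - Sg))) <=
    t * (- e + C1 i * t) by rewrite ler_pM2l//; lra.
have f2 : t ^+ 2 * \tr (H i *m St') <= t ^+ 2 * C2 i by rewrite ler_wpM2l ?sqr_ge0.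
have f3 : t * (t * (2 * C1 i + C2 i)) <= t * e.
  by rewrite ler_pM2l// (le_trans _ tC)// ler_pM2l// (le_trans (CiC i))// lerDl ler01.
have f4 : 0 < t * e by rewrite mulr_gt0.
exact: first_order_neg f1 f2 f3 f4.
Qed.

End CostMatrix.

(** * Optimal gains and the Riccati equation *)

Section CostProperties.
Variables (R : realType) (n p : nat) (A : 'M[R]_n) (B : 'M[R]_(n, p)).
Variables (Q : 'M[R]_n) (S : 'M[R]_p).
Hypotheses (sQ : Q^T = Q) (sS : S^T = S) (Q1 : loewner 1%:M Q) (S1 : loewner 1%:M S).

Lemma loewner1_ge0 k (X : 'M[R]_k) x : loewner 1%:M X -> 0 <= quad X x.
Proof. by move=> X1; apply: le_trans (X1 x); rewrite quad1 sqn_ge0. Qed.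

Lemma stage_ge1 (K : 'M[R]_(p, n)) : loewner 1%:M (Q + K^T *m S *m K).
Proof.
by move=> x; rewrite quadD quad_congr (le_trans (Q1 x))// lerDl loewner1_ge0.
Qed.

(** Since the stage cost is at least the identity, a positive semidefinite fixed point is already a
    stability certificate. *)
Lemma closed_loop_schur (K : 'M[R]_(p, n)) P : (forall x, 0 <= quad P x) ->
  P = (A + B *m K)^T *m P *m (A + B *m K) + (Q + K^T *m S *m K) ->
  schur (A + B *m K).
Proof.
move=> P0 PE; apply: (@lyapunov_schur _ _ _ P) => x; first by rewrite quad0.
by rewrite {2}PE !quadD lerD2l -quadD; exact: stage_ge1.
Qed.

Section Stabilizing.
Variable K : 'M[R]_(p, n).
Hypothesis sL : schur (A + B *m K).
Let P := cost_mx A B K Q S.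

Lemma cost_mx_sym : P^T = P.
Proof. by apply: dlyap_sym => //; exact: stage_sym. Qed.

Lemma cost_mx_ge1 : loewner 1%:M P.
Proof.
apply: (loewner_trans (stage_ge1 K)); apply: dlyap_geM => // x.
by rewrite quad0 loewner1_ge0//; exact: stage_ge1.
Qed.

Lemma cost_mx_ge0 x : 0 <= quad P x.
Proof. exact/loewner1_ge0/cost_mx_ge1. Qed.

Lemma cost_mxE : P = (A + B *m K)^T *m P *m (A + B *m K) + (Q + K^T *m S *m K).
Proof. exact: dlyapE. Qed.

Lemma dlyap1_cost_mx : loewner (dlyap (A + B *m K) 1%:M) P.
Proof. by apply: dlyap_mono => //; exact: stage_ge1. Qed.

Lemma cost_mx_hess_ge1 : loewner 1%:M (S + B^T *m P *m B).
Proof.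
by move=> x; rewrite quadD quad_congr (le_trans (S1 x))// lerDl cost_mx_ge0.
Qed.

(** From [K^T S K <= P] comes [sqn (K *m x) <= G * sqn x]; weakening [G] to [G ^+ 2] avoids square
    roots. The closed loop is treated alike in [closed_loop_opb]. *)
Lemma gain_opb G : 1 <= G -> loewner P G%:M -> opb K G.
Proof.
move=> G1 PG; have G0 : 0 <= G by exact: le_trans ler01 G1.
apply/opb_loewner => // x; rewrite quad_mul quad_scalar dot_sqn.
have := PG x; rewrite cost_mxE !quadD !quad_congr quad_scalar => h.
have h1 := S1 (K *m x); have h2 := loewner1_ge0 x Q1.
have h3 := cost_mx_ge0 ((A + B *m K) *m x).
rewrite quad1 in h1; apply: (@le_trans _ _ (G * sqn x)); first by lra.
by rewrite ler_wpM2r ?sqn_ge0// expr2 ler_peMl.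
Qed.

Lemma closed_loop_opb G : 1 <= G -> loewner P G%:M -> opb (A + B *m K) G.
Proof.
move=> G1 PG; have G0 : 0 <= G by exact: le_trans ler01 G1.
apply/opb_loewner => // x; rewrite quad_mul quad_scalar dot_sqn.
have := PG x; rewrite cost_mxE quadD quad_congr quad_scalar => h.
have h1 := cost_mx_ge1 ((A + B *m K) *m x); have h2 := loewner1_ge0 x (stage_ge1 K).
rewrite quad1 in h1; apply: (@le_trans _ _ (G * sqn x)); first by lra.
by rewrite ler_wpM2r ?sqn_ge0// expr2 ler_peMl.
Qed.

End Stabilizing.

Lemma optimal_cost_mx_le K K' : schur (A + B *m K) -> schur (A + B *m K') ->
  grad_mx A B K S (cost_mx A B K Q S) = 0 ->
  loewner (cost_mx A B K Q S) (cost_mx A B K' Q S).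
Proof.
move=> sL sL' E0; apply: dlyap_ge => //; apply: cost_mx_le => // x.
by rewrite quad0; exact/loewner1_ge0/cost_mx_hess_ge1.
Qed.

Lemma psd_entry k (X : 'M[R]_k) i j : X^T = X -> (forall x, 0 <= quad X x) ->
  `|X i j| <= \tr X.
Proof.
move=> sX X0.
have dii l : 0 <= X l l by rewrite -quad_delta.
have trl l : X l l <= \tr X.
  by rewrite /mxtrace (bigD1 l)//= lerDl; apply: sumr_ge0.
have e : (delta_mx i 0)^T *m X *m (delta_mx j 0 : 'cV[R]_k) = (X i j)%:M.
  by rewrite trmx_delta -rowE -colE; apply/matrixP => a b; rewrite !ord1 !mxE eqxx mulr1n.
have h1 := X0 (delta_mx i 0 + delta_mx j 0); have h2 := X0 (delta_mx i 0 - delta_mx j 0).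
move: h1 h2; rewrite quadDr// quadBr// e !quad_delta mxE eqxx mulr1n => h1 h2.
have := trl i; have := trl j; rewrite ler_norml => t1 t2; apply/andP; split; lra.
Qed.

(** The minimization runs over pairs [(K, P)] with [P] positive semidefinite, solving the Lyapunov
    equation, of trace at most that of [K0]. These conditions are closed and bounded, and
    [closed_loop_schur] returns the stability of the limit gain. *)
Lemma exists_cost_minimizer K0 : schur (A + B *m K0) -> exists2 K, schur (A + B *m K) &
  forall K', schur (A + B *m K') -> \tr (cost_mx A B K Q S) <= \tr (cost_mx A B K' Q S).
Proof.
move=> sL0.
pose Kf (v : 'rV[R]_((p + n) * n)) : 'M[R]_(p, n) := usubmx (vec_mx v).
pose Pf (v : 'rV[R]_((p + n) * n)) : 'M[R]_n := dsubmx (vec_mx v).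
have cK : mcontinuous Kf.
  by move=> i j; rewrite /Kf; under eq_fun do rewrite !mxE; exact: coord_continuous.
have cP : mcontinuous Pf.
  by move=> i j; rewrite /Pf; under eq_fun do rewrite !mxE; exact: coord_continuous.
pose Lf v := A + B *m Kf v.
have cL : mcontinuous Lf.
  by apply: mcontinuousD; [|apply: mcontinuousM => //]; exact: mcontinuous_cst.
pose c0 := \tr (cost_mx A B K0 Q S).
pose F : set 'rV[R]_((p + n) * n) := (
  [set v | Pf v = (Lf v)^T *m Pf v *m Lf v + (Q + (Kf v)^T *m S *m Kf v)] `&`
  [set v | (Pf v)^T = Pf v] `&` [set v | forall x, 0 <= quad (Pf v) x] `&`
  [set v | 0 <= c0 - \tr (Pf v)])%classic.
have memF K : schur (A + B *m K) -> \tr (cost_mx A B K Q S) <= c0 ->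
    F (mxvec (col_mx K (cost_mx A B K Q S))).
  move=> sL trK; rewrite /F /Lf /Kf /Pf /= mxvecK col_mxKu col_mxKd.
  split; last by rewrite subr_ge0.
  split; last exact: cost_mx_ge0.
  by split; [exact: cost_mxE|exact: cost_mx_sym].
have clF : closed F.
  apply: closedI; last first.
    apply: closed_nonneg => v.
    exact: (cvgB (@cst_continuous _ _ (c0 : R) v) (@mcontinuous_trace _ _ _ _ cP v)).
  apply: closedI; last exact: closed_psd.
  apply: closedI; apply: closed_mx_eq => //; last exact: mcontinuous_tr.
  apply: mcontinuousD.
    by apply: mcontinuousM => //; apply: mcontinuousM => //; exact: mcontinuous_tr.
  apply: mcontinuousD; first exact: mcontinuous_cst.
  apply: mcontinuousM => //; apply: mcontinuousM; last exact: mcontinuous_cst.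
  exact: mcontinuous_tr.
(* Entries of [P] are bounded by its trace. Those of the gain satisfy [K k j ^+ 2 <= P j j <= c0],
   and [1 + c0] exceeds the square root of [c0]. *)
have bF v : F v -> forall j, `|v 0 j| <= 1 + c0.
  case=> -[[PE sP] P0] /=; rewrite subr_ge0 => trP j.
  have c00 : 0 <= c0.
    apply: le_trans trP; apply: sumr_ge0 => i _; rewrite -quad_delta; exact: P0.
  rewrite -(vec_mxK v); case/mxvec_indexP: j => i j; rewrite mxvecE.
  rewrite -[vec_mx v]vsubmxK -/(Kf v) -/(Pf v) mxE; case: splitP => k _; last first.
    by rewrite (le_trans (psd_entry _ _ sP P0))// (le_trans trP)// lerDr ler01.
  have : (Kf v k j) ^+ 2 <= c0.
    have hjj : Pf v j j <= c0.
      exact: le_trans (ler_norm _) (le_trans (psd_entry j j sP P0) trP).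
    apply: le_trans hjj; rewrite -[leRHS]quad_delta PE !quadD !quad_congr.
    have h1 := P0 (Lf v *m delta_mx j 0); have h2 := loewner1_ge0 (delta_mx j 0) Q1.
    have h3 := S1 (Kf v *m delta_mx j 0); rewrite quad1 in h3.
    have : (Kf v k j) ^+ 2 <= sqn (Kf v *m delta_mx j 0).
      have -> : Kf v k j = (Kf v *m (delta_mx j 0 : 'cV[R]_n)) k 0 by rewrite -colE [RHS]mxE.
      by rewrite /sqn (bigD1 k)//= lerDl; apply: sumr_ge0 => l _; exact: sqr_ge0.
    lra.
  rewrite -real_normK ?num_real// => h.
  rewrite leNgt; apply/negP => lt1; move: h; apply/negP; rewrite -ltNge.
  have : 0 <= (`|Kf v k j| - 1 - c0) by lra.
  move: (`|_|) lt1 => y y1 y2; rewrite expr2.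
  have y3 : 1 * y < y * y by rewrite ltr_pM2r; lra.
  lra.
have [v Fv vmin] : exists2 v, F v & forall u, F u -> \tr (Pf v) <= \tr (Pf u).
  apply: (bounded_closed_min _ clF bF); last exact: mcontinuous_trace.
  by exists (mxvec (col_mx K0 (cost_mx A B K0 Q S))); exact: memF.
have [[[PE sP] P0] /=] := Fv; rewrite subr_ge0 => trP.
have sL := closed_loop_schur P0 PE.
have PvE : Pf v = cost_mx A B (Kf v) Q S by exact: dlyap_unique.
exists (Kf v) => // K' sL'; rewrite -PvE.
have [le0|gt0] := leP (\tr (cost_mx A B K' Q S)) c0; last exact: le_trans trP (ltW gt0).
have := vmin _ (memF K' sL' le0); rewrite [X in _ <= \tr X](_ : _ = cost_mx A B K' Q S)//.
by rewrite /Pf mxvecK col_mxKd.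
Qed.

Lemma exists_optimal_gain K0 : schur (A + B *m K0) -> exists2 K, schur (A + B *m K) &
  grad_mx A B K S (cost_mx A B K Q S) = 0.
Proof.
move=> /exists_cost_minimizer[K sL Kmin]; exists K => //.
have [] := @stationary_weights _ _ _ A B 1 (fun=> Q) (fun=> S) K isT (fun=> sQ) (fun=> sS) sL.
  by move=> K' sL' /(_ 0); rewrite ltNge Kmin.
move=> w [w0 w1]; rewrite -scaler_suml.
by move: w1; rewrite /l1norm !big_ord1 ger0_norm// => ->; rewrite scale1r.
Qed.

Lemma grad_mxE K X : grad_mx A B K S X = (S + B^T *m X *m B) *m K + B^T *m X *m A.
Proof. by rewrite /grad_mx mulmxDr mulmxDl !mulmxA addrA addrAC. Qed.

(** For [L = A + B *m K] the factor of [K^T] is the gradient. Once it vanishes, the Lyapunov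
    equation turns into the Riccati equation. *)
Lemma congr_grad K X (L : 'M[R]_n) : (A + B *m K)^T *m X *m L + K^T *m S *m K =
  A^T *m X *m L + K^T *m (S *m K + B^T *m X *m L).
Proof.
rewrite trmxD trmx_mul !mulmxDl mulmxDr !mulmxA -addrA; congr (_ + _).
exact: addrC.
Qed.

(** Stability of the Riccati gain is a conclusion here: rewritten as a Lyapunov equation, the
    Riccati equation makes [X] a certificate. This gives access to whichever solution [dare]
    selects. *)
Lemma riccati_gain X : possemidefmx X -> riccati A B Q S X ->
  exists K, [/\ schur (A + B *m K), X = cost_mx A B K Q S & grad_mx A B K S X = 0].
Proof.
move=> [sX X0] ric.
pose H := S + B^T *m X *m B.
have uH : H \in unitmx.
  by apply: loewner1_unit => x; rewrite quadD quad_congr (le_trans (S1 x))// lerDl.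
pose K := - (invmx H *m B^T *m X *m A).
have HK : H *m K = - (B^T *m X *m A) by rewrite /K mulmxN !mulmxA mulmxV// mul1mx.
have E0 : grad_mx A B K S X = 0.
  by rewrite grad_mxE -/H HK addNr.
have XE : X = (A + B *m K)^T *m X *m (A + B *m K) + (Q + K^T *m S *m K).
  rewrite addrCA addrC congr_grad -/(grad_mx A B K S X) E0 mulmx0 addr0.
  rewrite {1}ric; congr (_ + _); rewrite mulmxDr; congr (_ + _).
  by rewrite /K mulmxN mulmxN !mulmxA.
have sL := closed_loop_schur X0 XE.
by exists K; split=> //; exact: dlyap_unique.
Qed.

Lemma optimal_gain_riccati K : schur (A + B *m K) ->
  grad_mx A B K S (cost_mx A B K Q S) = 0 ->
  possemidefmx (cost_mx A B K Q S) /\ riccati A B Q S (cost_mx A B K Q S).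
Proof.
move=> sL E0; set P := cost_mx A B K Q S; split.
  by split; [exact: cost_mx_sym|exact: cost_mx_ge0].
pose H := S + B^T *m P *m B.
have uH : H \in unitmx by exact: loewner1_unit (cost_mx_hess_ge1 sL).
have HK : H *m K = - (B^T *m P *m A).
  by apply/eqP; rewrite -addr_eq0 -grad_mxE E0.
have KE : K = - (invmx H *m (B^T *m P *m A)) by rewrite -mulmxN -HK mulKmx.
rewrite /riccati {1}/P (cost_mxE sL) -/P addrCA addrC congr_grad -/(grad_mx A B K S P) E0.
rewrite mulmx0 addr0; congr (_ + _); rewrite mulmxDr; congr (_ + _).
by rewrite {1}KE mulmxN mulmxN !mulmxA.
Qed.

End CostProperties.

(** * Certainty equivalence *)

Section Transfer.
Variable R : realType.

Lemma loewner_opb_sub n (X Y : 'M[R]_n) c : opb (Y - X) c -> loewner Y (X + c%:M).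
Proof.
by move=> /opb_quad h x; have := h x; rewrite quadB quadD !quad_scalar; lra.
Qed.

Lemma closed_loop_diff n p (A A' : 'M[R]_n) (B B' : 'M[R]_(n, p)) K e G :
  0 <= e -> 1 <= G -> opb (A' - A) e -> opb (B' - B) e -> opb K G ->
  opb (A' + B' *m K - (A + B *m K)) (2 * G * e).
Proof.
move=> e0 G1 Ae Be KG.
have -> : A' + B' *m K - (A + B *m K) = (A' - A) + (B' - B) *m K.
  by rewrite mulmxBl opprD addrACA.
apply: opb_le (opbD Ae (opbM e0 Be KG)).
by have := ler_wpM2l e0 G1; lra.
Qed.

Lemma stage_diff n p (Q Q' : 'M[R]_n) (S S' : 'M[R]_p) (K : 'M[R]_(p, n)) e G :
  0 <= e -> 1 <= G -> opb (Q' - Q) (G * e) -> opb (S' - S) (G * e) -> opb K G ->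
  opb ((Q' + K^T *m S' *m K) - (Q + K^T *m S *m K)) (2 * G ^+ 3 * e).
Proof.
move=> e0 G1 Qe Se KG; have G0 : 0 <= G by exact: le_trans ler01 G1.
have -> : (Q' + K^T *m S' *m K) - (Q + K^T *m S *m K) = (Q' - Q) + K^T *m (S' - S) *m K.
  by rewrite mulmxBr mulmxBl opprD addrACA.
have Ge0 : 0 <= G * e by rewrite mulr_ge0.
have GGe0 : 0 <= G * (G * e) by rewrite mulr_ge0.
apply: opb_le (opbD Qe (opbM GGe0 (opbM G0 (opb_tr G0 KG) Se) KG)).
have h1 : G * e <= G ^+ 2 * (G * e) by rewrite ler_peMl// exprn_ege1.
lra.
Qed.

Lemma cost_mx_transfer n p (A A' : 'M[R]_n) (B B' : 'M[R]_(n, p))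
    (Q Q' : 'M[R]_n) (S S' : 'M[R]_p) K e G :
  Q^T = Q -> S^T = S -> loewner 1%:M Q -> loewner 1%:M S ->
  loewner 1%:M Q' -> loewner 1%:M S' ->
  schur (A + B *m K) -> loewner (cost_mx A B K Q S) G%:M ->
  1 <= G -> 0 <= e <= 1 -> 18 * G ^+ 3 * e <= 1 ->
  opb (A' - A) e -> opb (B' - B) e -> opb (Q' - Q) (G * e) -> opb (S' - S) (G * e) ->
  schur (A' + B' *m K) /\
  loewner (cost_mx A' B' K Q' S') ((1 + 18 * G ^+ 3 * e) *: cost_mx A B K Q S).
Proof.
move=> sQ sS Q1 S1 Q'1 S'1 sL PG G1 /andP[e0 e1] small Ae Be Qe Se.
set P := cost_mx A B K Q S; set a := 18 * G ^+ 3 * e.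
have G0 : 0 <= G by exact: le_trans ler01 G1.
have a0 : 0 <= a by rewrite !mulr_ge0// exprn_ge0.
have sP : P^T = P by exact: cost_mx_sym.
have P0 x : 0 <= quad P x by exact: cost_mx_ge0.
have PGo : opb P G by apply: loewner_opb => // x; rewrite quad0.
have KG := gain_opb Q1 S1 sL G1 PG.
have LG := closed_loop_opb Q1 S1 sL G1 PG.
have Ge0 : 0 <= 2 * G * e by rewrite !mulr_ge0.
have sup := @perturb_super _ _ (A + B *m K) (A' + B' *m K) P (Q + K^T *m S *m K)
  (Q' + K^T *m S' *m K) G G (2 * G * e) (2 * G ^+ 3 * e) a G0 G0 Ge0.
have {}sup : loewner ((A' + B' *m K)^T *m ((1 + a) *: P) *m (A' + B' *m K)
    + (Q' + K^T *m S' *m K)) ((1 + a) *: P).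
  apply: sup => //.
  - by rewrite -cost_mxE.
  - exact: stage_ge1.
  - exact/loewner_opb_sub/stage_diff.
  - exact: closed_loop_diff.
  (* Origin of 18: the closed loop moves by [2 * G * e], which costs at most [8 * G ^+ 3 * e] as
     [e <= 1]. This doubles because [1 + a <= 2], and the stage cost adds [2 * G ^+ 3 * e]. *)
  have h2 : G * (2 * G * (2 * G * e) + (2 * G * e) ^+ 2) <= 8 * G ^+ 3 * e.
    have : e * (4 * G ^+ 3 * e) <= 1 * (4 * G ^+ 3 * e).
      by rewrite ler_wpM2r// !mulr_ge0// exprn_ge0.
    rewrite !exprMn; lra.
  have h3 : 0 <= G * (2 * G * (2 * G * e) + (2 * G * e) ^+ 2).
    by rewrite mulr_ge0// addr_ge0 ?sqr_ge0// !mulr_ge0.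
  have h4 : (1 + a) * (G * (2 * G * (2 * G * e) + (2 * G * e) ^+ 2)) <=
      2 * (8 * G ^+ 3 * e).
    by apply: ler_pM => //; [exact: addr_ge0|rewrite -[2]/(1 + 1) lerD2l].
  have aE : a = 18 * G ^+ 3 * e by [].
  lra.
have P20 x : 0 <= quad ((1 + a) *: P) x by rewrite quadZ mulr_ge0// addr_ge0.
have sL' : schur (A' + B' *m K).
  apply: (@lyapunov_schur _ _ _ ((1 + a) *: P)) => x; first by rewrite quad0.
  apply: le_trans (sup x); rewrite quadD [leRHS]quadD lerD2l.
  exact: stage_ge1.
by split=> //; exact: dlyap_le.
Qed.

(** By Cauchy-Schwarz, [H >= I] does not shrink vectors; this divides by the Hessian without forming
    its inverse. *)
Lemma loewner1_opb p n (H : 'M[R]_p) (X : 'M[R]_(p, n)) c :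
  loewner 1%:M H -> opb (H *m X) c -> opb X c.
Proof.
move=> H1 h x; apply: le_trans (h x).
have [X0|X0] := eqVneq (X *m x) 0; first by rewrite X0 l2norm0 l2norm_ge0.
have lx : 0 < l2norm (X *m x) by rewrite sqrtr_gt0 sqn_gt0.
rewrite -(ler_pM2l lx) -expr2 sqr_l2norm -quad1 (le_trans (H1 _))//.
by rewrite /quad -mulmxA (le_trans (dot_le _ _))// mulmxA.
Qed.

(** * Comparison of two nearby optimal control problems *)

Section CertaintyEquivalence.
Variables (n p : nat) (A A' : 'M[R]_n) (B B' : 'M[R]_(n, p)).
Variables (Q Q' : 'M[R]_n) (S S' : 'M[R]_p) (K K' : 'M[R]_(p, n)) (e G : R).
Hypotheses (sQ : Q^T = Q) (sS : S^T = S) (Q1 : loewner 1%:M Q) (S1 : loewner 1%:M S).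
Hypotheses (sQ' : Q'^T = Q') (sS' : S'^T = S')
  (Q'1 : loewner 1%:M Q') (S'1 : loewner 1%:M S').
Hypotheses (sL : schur (A + B *m K)) (sL' : schur (A' + B' *m K')).
Let P := cost_mx A B K Q S.
Let P' := cost_mx A' B' K' Q' S'.
Hypotheses (E0 : grad_mx A B K S P = 0) (E'0 : grad_mx A' B' K' S' P' = 0).
Hypotheses (G1 : 1 <= G) (PG : loewner P (G - 1)%:M) (BG : opb B G).
Hypotheses (e0 : 0 <= e) (small : 22 * G ^+ 6 * e <= 1).
Hypotheses (Ae : opb (A' - A) e) (Be : opb (B' - B) e)
  (Qe : opb (Q' - Q) (G * e)) (Se : opb (S' - S) (G * e)).

Let G0 : 0 <= G. Proof. exact: le_trans ler01 G1. Qed.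

Let GXe k : (k <= 6)%N -> G ^+ k * e <= G ^+ 6 * e.
Proof. by move=> k6; rewrite ler_wpM2r// ler_weXn2l. Qed.

Let GXe0 k : 0 <= G ^+ k * e. Proof. by rewrite mulr_ge0// exprn_ge0. Qed.

Let a := 18 * G ^+ 3 * e.

Let a0 : 0 <= a. Proof. by rewrite /a -mulrA mulr_ge0. Qed.
Let a1 : a <= 1.
Proof.
have := GXe (isT : (3 <= 6)%N); have := GXe0 6; move: small; rewrite /a; lra.
Qed.
Let e1 : 0 <= e <= 1.
Proof.
rewrite e0; have := GXe (isT : (0 <= 6)%N); have := GXe0 6.
by move: small; rewrite expr0; lra.
Qed.

Let PG' : loewner P G%:M.
Proof. by apply: loewner_trans PG _; apply: loewner_scalar; lra. Qed.

(** [K] is a competitor of [K'] in the second system. Then [(1 + a) * (G - 1) <= G], because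
    [18 * G ^+ 4 * e <= 1]: the margin in [PG] keeps the bound [G] for the second system. *)
Lemma certainty_cost_le : loewner P' ((1 + a) *: P) /\ loewner P' G%:M.
Proof.
have [s1 h] := cost_mx_transfer sQ sS Q1 S1 Q'1 S'1 sL PG' G1 e1 a1 Ae Be Qe Se.
have h1 : loewner P' ((1 + a) *: P).
  exact: loewner_trans (optimal_cost_mx_le sQ' sS' Q'1 S'1 sL' s1 E'0) h.
split=> // x; apply: (le_trans (h1 x)); rewrite quadZ quad_scalar.
have := PG x; rewrite quad_scalar => h2.
have b1 : (1 + a) * quad P x <= (1 + a) * ((G - 1) * sqn x).
  by rewrite ler_wpM2l// addr_ge0.
apply: (le_trans b1); rewrite mulrA ler_wpM2r ?sqn_ge0//.
have := GXe (isT : (4 <= 6)%N); have := GXe0 6; move: small; rewrite /a.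
have -> : (1 + 18 * G ^+ 3 * e) * (G - 1) = G - 1 + 18 * (G ^+ 4 * e) - 18 * (G ^+ 3 * e) by ring.
by have := GXe0 3; lra.
Qed.

(** The same comparison with the systems exchanged, now starting from [P' <= G I]. It yields the
    stability of the true loop under the estimated gain. *)
Lemma certainty_transfer : schur (A + B *m K') /\
  loewner (cost_mx A B K' Q S) ((1 + a) *: P').
Proof.
have [_ P'G] := certainty_cost_le.
have flip k l (X Y : 'M[R]_(k, l)) c : opb (Y - X) c -> opb (X - Y) c.
  by move=> h; rewrite -opprB; exact: opbN.
exact: cost_mx_transfer sQ' sS' Q'1 S'1 Q1 S1 sL' P'G G1 e1 a1 (flip _ _ _ _ _ Ae)
  (flip _ _ _ _ _ Be) (flip _ _ _ _ _ Qe) (flip _ _ _ _ _ Se).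
Qed.

Lemma riccati_perturbation : opb (P' - P) (18 * G ^+ 4 * e).
Proof.
have [P'P P'G] := certainty_cost_le; have [sK' h] := certainty_transfer.
have h' := loewner_trans (optimal_cost_mx_le sQ sS Q1 S1 sL sK' E0) h.
have aG : a * G = 18 * G ^+ 4 * e by rewrite /a; ring.
apply: sym_opb.
- by rewrite trmxD trmxN !cost_mx_sym.
- move=> x; rewrite quadB quad_scalar -aG -mulrA.
  have := P'P x; rewrite quadZ => h1.
  have := PG' x; rewrite quad_scalar => h2; have := ler_wpM2l a0 h2; lra.
- move=> x; rewrite quadN quadB quad_scalar -aG -mulrA.
  have := h' x; rewrite quadZ => h1.
  have := P'G x; rewrite quad_scalar => h2; have := ler_wpM2l a0 h2; rewrite -/P; lra.
Qed.

Lemma gain_perturbation : opb (K' - K) (22 * G ^+ 6 * e).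
Proof.
have [_ P'G] := certainty_cost_le; have PP := riccati_perturbation.
have [sK' _] := certainty_transfer.
apply: (loewner1_opb (cost_mx_hess_ge1 Q1 S1 sL)); rewrite -/P.
have sP : P^T = P by exact: cost_mx_sym.
have sP' : P'^T = P' by exact: cost_mx_sym.
have PGo : opb P G.
  by apply: loewner_opb => // x; rewrite quad0; exact: cost_mx_ge0.
have P'Go : opb P' G.
  by apply: loewner_opb => // x; rewrite quad0; exact: cost_mx_ge0.
have K'G := gain_opb Q'1 S'1 sL' G1 P'G.
have L'G := closed_loop_opb Q'1 S'1 sL' G1 P'G.
have Ld := closed_loop_diff e0 G1 Ae Be K'G.
(* By [E0] the left side is the gradient at [K'] with the true data and [P]. Subtracting the zero
   gradient [E'0] leaves one term per change: in [S], in the closed loop, in the cost matrix and in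
   [B]. They contribute [1 + 2 + 18 + 1 = 22]. *)
have -> : (S + B^T *m P *m B) *m (K' - K) =
    - ((S' - S) *m K' + B^T *m P *m (A' + B' *m K' - (A + B *m K'))
       + B^T *m (P' - P) *m (A' + B' *m K') + (B' - B)^T *m P' *m (A' + B' *m K')).
  have h1 : (S + B^T *m P *m B) *m (K' - K) = grad_mx A B K' S P.
    have HK : (S + B^T *m P *m B) *m K = - (B^T *m P *m A).
      by apply/eqP; rewrite -addr_eq0 -grad_mxE E0.
    by rewrite mulmxBr HK opprK grad_mxE.
  rewrite h1 -[LHS]subr0 -E'0 /grad_mx trmxD trmxN.
  move: (A' + B' *m K') (A + B *m K') => L' L.
  rewrite !mulmxBr !mulmxBl.
  move: (S *m K') (S' *m K') (B^T *m P *m L) (B^T *m P *m L') (B'^T *m P' *m L') (B^T *m P' *m L').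
  by move=> x1 x2 x3 x4 x5 x6; apply/matrixP => i j; rewrite !mxE; ring.
apply: opbN.
have BT := opb_tr G0 BG; have BeT := opb_tr e0 Be.
have Ge0 : 0 <= G * e by rewrite mulr_ge0.
have GG0 : 0 <= G * G by rewrite mulr_ge0.
have PP0 : 0 <= G * (18 * G ^+ 4 * e) by rewrite -!mulrA !mulr_ge0// exprn_ge0.
have eG0 : 0 <= e * G by rewrite mulr_ge0.
have t1 := opbM Ge0 Se K'G.
have t2 := opbM GG0 (opbM G0 BT PGo) Ld.
have t3 := opbM PP0 (opbM G0 BT PP) L'G.
have t4 := opbM eG0 (opbM e0 BeT P'Go) L'G.
apply: opb_le (opbD (opbD (opbD t1 t2) t3) t4).
by have := GXe (isT : (2 <= 6)%N); have := GXe (isT : (3 <= 6)%N); lra.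
Qed.

(** [K] is optimal for the weighted cost, not for each single one, so the estimate is of first order
    in [K' - K]. *)
Lemma cost_perturbation (Qi : 'M[R]_n) (Si : 'M[R]_p) : Qi^T = Qi -> Si^T = Si ->
  opb Qi G -> opb Si G ->
  `|\tr (cost_mx A B K' Qi Si) - \tr (cost_mx A B K Qi Si)| <= 396 * n%:R * G ^+ 13 * e.
Proof.
move=> sQi sSi QiG SiG.
have [P'P P'G] := certainty_cost_le; have [sK' hK'] := certainty_transfer.
have dK := gain_perturbation; set k := 22 * G ^+ 6 * e in dK.
have k1 : k <= 1 := small.
have k0 : 0 <= k by rewrite /k -mulrA mulr_ge0.
have KG := gain_opb Q1 S1 sL G1 PG'; have LG := closed_loop_opb Q1 S1 sL G1 PG'.
have dL : opb (A + B *m K' - (A + B *m K)) (G * k).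
  have -> : A + B *m K' - (A + B *m K) = B *m (K' - K).
    by rewrite mulmxBr opprD addrACA subrr add0r.
  exact: opbM.
have I1 : (1%:M : 'M[R]_n)^T = 1%:M by exact: trmx1.
have I0 : loewner 0 (1%:M : 'M[R]_n) by move=> x; rewrite quad0 quad1 sqn_ge0.
have D1 : opb (dlyap (A + B *m K) 1%:M) G.
  apply: loewner_opb; [exact: dlyap_sym|exact: G0|exact: dlyap_ge0|].
  exact: loewner_trans (dlyap1_cost_mx Q1 S1 sL) PG'.
(* The true cost of [K'] is at most [(1 + a) *: P'], hence at most [2 * G]. *)
have D2 : opb (dlyap (A + B *m K') 1%:M) (2 * G).
  apply: loewner_opb; [exact: dlyap_sym|by rewrite mulr_ge0|exact: dlyap_ge0|].
  apply: loewner_trans (dlyap1_cost_mx Q1 S1 sK') _.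
  apply: loewner_trans hK' _ => x; rewrite quadZ quad_scalar -mulrA.
  apply: ler_pM; [exact: addr_ge0|exact: cost_mx_ge0|by have := a1; lra|].
  by have := P'G x; rewrite quad_scalar.
have Gpow i j : (i <= j)%N -> G ^+ i <= G ^+ j by move=> ij; rewrite ler_weXn2l.
have Mo : opb (Qi + K^T *m Si *m K) (2 * G ^+ 3).
  have GG0 : 0 <= G * G by rewrite mulr_ge0.
  apply: opb_le (opbD QiG (opbM GG0 (opbM G0 (opb_tr G0 KG) SiG) KG)).
  by have := Gpow 1%N 3%N isT; rewrite expr1; lra.
have G30 : 0 <= 2 * G ^+ 3 by rewrite mulr_ge0// exprn_ge0.
have sM := stage_sym K sQi sSi.
have Po := dlyap_opb sL sM G30 Mo D1; rewrite -/(cost_mx A B K Qi Si) in Po.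
rewrite -linearB/= /cost_mx dlyap_diff//.
have Gk0 : 0 <= G * k by rewrite mulr_ge0.
have q0 : 0 <= 2 * G ^+ 3 * G by rewrite mulr_ge0.
have n1 := congr_diff_opb q0 G0 Gk0 Po LG dL.
have n2 := congr_diff_opb G0 G0 k0 SiG KG dK.
have -> : Qi + K'^T *m Si *m K' - (Qi + K^T *m Si *m K) = K'^T *m Si *m K' - K^T *m Si *m K.
  by rewrite opprD addrACA subrr add0r.
have nN := opbD n1 n2.
(* The terms count [4 + 2 + 2 + 1 = 9]. With the factor [2 * G] of [D2] and [k = 22 * G ^+ 6 * e]
   this becomes [396 * G ^+ 13 * e] per unit of dimension. *)
have b : 2 * G ^+ 3 * G * (2 * G * (G * k) + (G * k) ^+ 2) + G * (2 * G * k + k ^+ 2) <=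
    9 * G ^+ 6 * k.
  have k2 : k ^+ 2 <= k by rewrite expr2 ler_piMr.
  have g1 : G ^+ 6 * k ^+ 2 <= G ^+ 6 * k by rewrite ler_wpM2l// exprn_ge0.
  have g2 : G ^+ 2 * k <= G ^+ 6 * k by rewrite ler_wpM2r// Gpow.
  have g3 : G * k ^+ 2 <= G ^+ 6 * k.
    by apply: ler_pM => //; [exact: sqr_ge0|have := Gpow 1%N 6%N isT; rewrite expr1].
  rewrite exprMn; lra.
have b0 : 0 <= 9 * G ^+ 6 * k by rewrite !mulr_ge0// exprn_ge0.
have sN : ((A + B *m K')^T *m dlyap (A + B *m K) (Qi + K^T *m Si *m K) *m (A + B *m K')
    - (A + B *m K)^T *m dlyap (A + B *m K) (Qi + K^T *m Si *m K) *m (A + B *m K)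
    + (K'^T *m Si *m K' - K^T *m Si *m K))^T =
    (A + B *m K')^T *m dlyap (A + B *m K) (Qi + K^T *m Si *m K) *m (A + B *m K')
    - (A + B *m K)^T *m dlyap (A + B *m K) (Qi + K^T *m Si *m K) *m (A + B *m K)
    + (K'^T *m Si *m K' - K^T *m Si *m K).
  by rewrite [LHS]trmxD !congr_diff_sym//; exact: dlyap_sym.
have := tr_opb (dlyap_opb sK' sN b0 (opb_le b nN) D2).
move=> /le_trans; apply; rewrite /k -!mulrA; move: (n%:R : R) => N.
by rewrite le_eqVlt; apply/orP; left; apply/eqP; ring.
Qed.

End CertaintyEquivalence.

End Transfer.

(** * Weights of Pareto optimal gains *)

Section WeightedSums.
Variables (R : realType) (m : nat).
Implicit Types w v : 'rV[R]_m.

Lemma simplex_sum w : simplex w -> \sum_i w 0 i = 1.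
Proof. by case=> w0 <-; apply: eq_bigr => i _; rewrite ger0_norm. Qed.

Lemma simplex_le1 w i : simplex w -> w 0 i <= 1.
Proof.
move=> sw; rewrite -(simplex_sum sw) (bigD1 i)//= lerDl.
by apply: sumr_ge0 => j _; case: sw.
Qed.

Lemma wsum_sym k w (M : 'I_m -> 'M[R]_k) : (forall i, (M i)^T = M i) ->
  (wsum w M)^T = wsum w M.
Proof.
move=> sM; rewrite /wsum; apply: (big_ind (fun X : 'M[R]_k => X^T = X)).
- exact: trmx0.
- by move=> X Y sX sY; rewrite trmxD sX sY.
- by move=> i _; rewrite trmxZ sM.
Qed.

Lemma wsum_ge1 k w (M : 'I_m -> 'M[R]_k) : simplex w ->
  (forall i, loewner 1%:M (M i)) -> loewner 1%:M (wsum w M).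
Proof.
move=> sw M1 x; rewrite /wsum quad_sum quad1 -[leLHS]mul1r -(simplex_sum sw) mulr_suml.
apply: ler_sum => i _; rewrite quadZ ler_wpM2l//; first by case: sw.
by have := M1 i x; rewrite quad1.
Qed.

Lemma wsum_diff_opb k w v (M : 'I_m -> 'M[R]_k) G e : 0 <= G ->
  (forall i, opb (M i) G) -> l1norm (w - v) <= e ->
  opb (wsum v M - wsum w M) (G * e).
Proof.
move=> G0 MG we.
have -> : wsum v M - wsum w M = \sum_i (v 0 i - w 0 i) *: M i.
  by rewrite /wsum -sumrB; apply: eq_bigr => i _; rewrite scalerBl.
have h : opb (\sum_i (v 0 i - w 0 i) *: M i) (\sum_i `|v 0 i - w 0 i| * G).
  by apply: opb_sum => i _; exact: opbZ.
apply: opb_le h; rewrite -mulr_suml mulrC ler_wpM2l//; apply: le_trans we.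
by rewrite /l1norm; apply: ler_sum => i _; rewrite !mxE distrC.
Qed.

Variables (n p : nat) (A : 'M[R]_n) (B : 'M[R]_(n, p)).
Variables (Q : 'I_m -> 'M[R]_n) (S : 'I_m -> 'M[R]_p).

Lemma cost_mx_wsum w K : schur (A + B *m K) ->
  cost_mx A B K (wsum w Q) (wsum w S) = \sum_i w 0 i *: cost_mx A B K (Q i) (S i).
Proof.
move=> sL; rewrite /cost_mx /wsum mulmx_sumr mulmx_suml -big_split/= dlyap_sum//.
apply: eq_bigr => i _.
by rewrite -scalemxAr -scalemxAl -scalerDr dlyapZ.
Qed.

Lemma grad_mx_wsum w K : schur (A + B *m K) ->
  grad_mx A B K (wsum w S) (cost_mx A B K (wsum w Q) (wsum w S)) =
  \sum_i w 0 i *: grad_mx A B K (S i) (cost_mx A B K (Q i) (S i)).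
Proof.
move=> sL; rewrite cost_mx_wsum// /grad_mx /wsum mulmx_suml mulmx_sumr mulmx_suml -big_split/=.
apply: eq_bigr => i _.
by rewrite scalerDr -scalemxAl -scalemxAr -scalemxAl.
Qed.

Hypotheses (sQ : forall i, (Q i)^T = Q i) (sS : forall i, (S i)^T = S i).
Hypotheses (Q1 : forall i, loewner 1%:M (Q i)) (S1 : forall i, loewner 1%:M (S i)).

(** Without an upper bound the real [sup] in [P_max] would be 0. A fixed stabilizing gain bounds all
    the optimal costs, and the default 0 of [dare] is harmless. *)
Lemma P_scal_bounded K0 : schur (A + B *m K0) ->
  has_ubound [set opnorm (P_scal A B Q S w) | w in @simplex R m]%classic.
Proof.
move=> sL0; pose b := \sum_i opnorm (cost_mx A B K0 (Q i) (S i)).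
have b0 : 0 <= b by apply: sumr_ge0 => i _; exact: opnorm_ge0.
exists b => _ [w sw <-]; apply: opnorm_le => //.
have sQw := wsum_sym w sQ; have sSw := wsum_sym w sS.
have Qw1 := wsum_ge1 sw Q1; have Sw1 := wsum_ge1 sw S1.
rewrite /P_scal /dare; case: xgetP => [X _ [[sX X0] ric]|_]; last first.
  by move=> x; rewrite mul0mx l2norm0 mulr_ge0// l2norm_ge0.
have [K [sL XE E0]] := riccati_gain Qw1 Sw1 (conj sX X0) ric.
apply: loewner_opb => //; first by move=> x; rewrite quad0.
rewrite XE in E0 *; apply: loewner_trans (optimal_cost_mx_le sQw sSw Qw1 Sw1 sL sL0 E0) _.
rewrite cost_mx_wsum//; apply: opb_quad.
apply: (@opb_le _ _ _ _ (\sum_i `|w 0 i| * opnorm (cost_mx A B K0 (Q i) (S i)))).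
  apply: ler_sum => i _; rewrite ler_piMl ?opnorm_ge0//.
  by rewrite ger0_norm ?simplex_le1//; case: sw.
by apply: opb_sum => i _; apply: opbZ; exact: opb_opnorm.
Qed.

(** [dare] only selects some positive semidefinite solution. That solution is the cost matrix of a
    stabilizing gain, so optimality of [K] gives the one inequality that matters. *)
Lemma optimal_cost_P_max K w : simplex w -> schur (A + B *m K) ->
  grad_mx A B K (wsum w S) (cost_mx A B K (wsum w Q) (wsum w S)) = 0 ->
  0 <= P_max A B Q S /\
  loewner (cost_mx A B K (wsum w Q) (wsum w S)) (P_max A B Q S)%:M.
Proof.
move=> sw sL E0.
have sQw := wsum_sym w sQ; have sSw := wsum_sym w sS.
have Qw1 := wsum_ge1 sw Q1; have Sw1 := wsum_ge1 sw S1.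
have Pm : opnorm (P_scal A B Q S w) <= P_max A B Q S.
  by rewrite /P_max; apply: ub_le_sup; [exact: P_scal_bounded sL|exists w].
split; first exact: le_trans (opnorm_ge0 _) Pm.
have [psd ric] := optimal_gain_riccati sQw sSw Qw1 Sw1 sL E0.
have [psdX ricX] : possemidefmx (P_scal A B Q S w) /\
    riccati A B (wsum w Q) (wsum w S) (P_scal A B Q S w).
  apply: (@xgetPex _ 0 [set X | possemidefmx X /\ riccati A B (wsum w Q) (wsum w S) X]%classic).
  by exists (cost_mx A B K (wsum w Q) (wsum w S)).
have [KX [sLX XE _]] := riccati_gain Qw1 Sw1 psdX ricX.
apply: loewner_trans (optimal_cost_mx_le sQw sSw Qw1 Sw1 sL sLX E0) _.
by rewrite -XE; apply: opb_quad; apply: opb_le Pm (opb_opnorm _).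
Qed.

Lemma Gamma_ge : [/\ 1 + P_max A B Q S <= Gamma A B Q S, 1 + opnorm B <= Gamma A B Q S,
  forall i, opnorm (Q i) <= Gamma A B Q S & forall i, opnorm (S i) <= Gamma A B Q S].
Proof.
rewrite /Gamma !big_cons !le_max !lexx ?orbT; split=> // i.
  by rewrite !le_max le_bigmax !orbT.
by rewrite !le_max le_bigmax !orbT.
Qed.

End WeightedSums.

Lemma pareto_weights d (T : measurableType d) (R : realType) (P : probability T R)
    (n p m : nat) (sigma : R) (x0 : random_vector P n) (xi : nat -> random_vector P n)
    (A : 'M[R]_n) (B : 'M[R]_(n, p)) (Q : 'I_m -> 'M[R]_n) (S : 'I_m -> 'M[R]_p) K :
  (0 < m)%N -> 0 < sigma -> lqr_noise sigma x0 xi ->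
  (forall i, (Q i)^T = Q i) -> (forall i, (S i)^T = S i) ->
  pareto_front x0 xi A B Q S K ->
  exists2 w, simplex w &
    grad_mx A B K (wsum w S) (cost_mx A B K (wsum w Q) (wsum w S)) = 0.
Proof.
move=> m0 sg0 noise sQ sS [stK nodom]; have sL := spectral_radius_schur stK.
have [|w sw E0] := stationary_weights m0 sQ sS sL; last first.
  by exists w => //; rewrite grad_mx_wsum.
move=> K' /schur_spectral_radius stK' better; apply: nodom; exists K'.
have lt i : (lqr_loss x0 xi A B K' (Q i) (S i) < lqr_loss x0 xi A B K (Q i) (S i))%E.
  rewrite !(lqr_lossE sg0 noise)// lte_fin ltr_pM2l; first exact: better.
  by rewrite gauss_m2_gt0// gt_eqF.
split=> //; first by move=> i; exact: ltW.
by exists (Ordinal m0).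
Qed.

Lemma optimal_gain_minimizer d (T : measurableType d) (R : realType) (P : probability T R)
    (n p : nat) (sigma : R) (x0 : random_vector P n) (xi : nat -> random_vector P n)
    (A : 'M[R]_n) (B : 'M[R]_(n, p)) (Q : 'M[R]_n) (S : 'M[R]_p) K :
  0 < sigma -> lqr_noise sigma x0 xi ->
  Q^T = Q -> S^T = S -> loewner 1%:M Q -> loewner 1%:M S ->
  schur (A + B *m K) -> grad_mx A B K S (cost_mx A B K Q S) = 0 ->
  lqr_minimizer x0 xi A B Q S K.
Proof.
move=> sg0 noise sQ sS Q1 S1 sL E0; have stK := schur_spectral_radius sL.
split; first exact: stK.
move=> K' stK'; rewrite (lqr_lossE sg0 noise Q S stK) (lqr_lossE sg0 noise Q S stK').
rewrite lee_fin ler_wpM2l//; first by rewrite ltW// gauss_m2_gt0// gt_eqF.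
apply: loewner_trace; apply: (optimal_cost_mx_le sQ sS Q1 S1 sL _ E0).
exact: spectral_radius_schur.
Qed.

Lemma opnorm_scalar1 (R : realType) n : (0 < n)%N -> 1 <= opnorm (1%:M : 'M[R]_n).
Proof.
case: n => // n _; have := opb_opnorm (1%:M : 'M[R]_n.+1) (delta_mx 0 0).
by rewrite mul1mx l2norm_delta mulr1.
Qed.

Theorem theorem3 (R : realType) :
  exists c C : R, 0 < c /\ 0 < C /\
  forall (n p m : nat) (A : 'M[R]_n) (B : 'M[R]_(n, p))
    (Q : 'I_m -> 'M[R]_n) (S : 'I_m -> 'M[R]_p) (sigma : R)
    (d : measure_display) (T : measurableType d) (P : probability T R)
    (x0 : random_vector P n) (xi : nat -> random_vector P n)
    (gam taubar eps : R) (Ahat : 'M[R]_n) (Bhat : 'M[R]_(n, p))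
    (N : set 'rV[R]_m),
  (0 < p <= n)%N -> (0 < m)%N ->
  0 < sigma ->
  lqr_noise sigma x0 xi ->
  stabilizable A B ->
  (forall i, posdefmx (Q i)) -> (forall i, posdefmx (S i)) ->
  (forall i, 1 <= sigma_min (Q i)) -> (forall i, 1 <= sigma_min (S i)) ->
  0 < gam < 1 ->
  (forall w, simplex w ->
     spectral_radius (A + B *m K_scal A B Q S w) <= gam /\
     (tau (A + B *m K_scal A B Q S w) gam <= taubar%:E)%E) ->
  0 < eps ->
  eps <= c * ((1 - gam ^+ 2) ^+ 4 / taubar ^+ 4) * Gamma A B Q S ^- 17 ->
  opnorm (Ahat - A) <= eps -> opnorm (Bhat - B) <= eps ->
  stabilizable Ahat Bhat ->
  l1_net eps N ->
  forall K, pareto_front x0 xi A B Q S K ->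
  exists Khat, [/\ PF_hat x0 xi Q S Ahat Bhat N Khat,
    spectral_radius (A + B *m Khat) < 1 &
    (loss_dist x0 xi Q S A B K Khat <=
       (C * sigma ^+ 2 * n%:R * Gamma A B Q S ^+ 29
        * (taubar ^+ 8 / (1 - gam ^+ 2) ^+ 4) * eps)%:E)%E].
Proof.
(* [22^-1] yields the smallness condition of the comparison; [2376 = 6 * 396], where 6 bounds the
   Gaussian second moment in units of [sigma ^+ 2]. *)
exists 22^-1, 2376; split; first by rewrite invr_gt0.
split; first by rewrite ltr0n.
move=> n p m A B Q S sigma d T P x0 xi gam taubar eps Ahat Bhat N.
move=> /andP[p0 pn] m0 sg0 noise _ posQ posS sminQ sminS /andP[gam0 gam1] taub eps0 epsc.
move=> Ae Be [Khat0 /spectral_radius_schur stab0] [Nsub Nnet] K pf.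
have sL := spectral_radius_schur pf.1.
have sQ i : (Q i)^T = Q i by case: (posQ i).
have sS i : (S i)^T = S i by case: (posS i).
have Q1 i : loewner 1%:M (Q i) by exact: sigma_min_loewner.
have S1 i : loewner 1%:M (S i) by exact: sigma_min_loewner.
have [w sw E0] := pareto_weights m0 sg0 noise sQ sS pf.
have [Pm0 PPm] := optimal_cost_P_max sQ sS Q1 S1 sw sL E0.
have [GP GB GQ GS] := Gamma_ge A B Q S.
set G := Gamma A B Q S in epsc GP GB GQ GS *.
have G1 : 1 <= G by rewrite (le_trans _ GP)// lerDl.
have G0 : 0 < G by exact: lt_le_trans ltr01 G1.
have PG : loewner (cost_mx A B K (wsum w Q) (wsum w S)) (G - 1)%:M.
  by apply: loewner_trans PPm _; apply: loewner_scalar; lra.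
have BG : opb B G by apply: opb_le (opb_opnorm B); lra.
have QG i : opb (Q i) G by apply: opb_le (GQ i) (opb_opnorm _).
have SG i : opb (S i) G by apply: opb_le (GS i) (opb_opnorm _).
(* The term [k = 0] of the supremum is the norm of the identity, at least 1 in positive
   dimension. *)
have tau1 : 1 <= taubar.
  rewrite -lee_fin; apply: le_trans (taub w sw).2; rewrite /tau.
  apply: (@le_trans _ _ (opnorm (1%:M : 'M[R]_n))%:E).
    by rewrite lee_fin opnorm_scalar1// (leq_trans p0).
  by apply: ereal_sup_ubound; exists 0%N => //=; rewrite !expr0 invr1 mulr1.
have g2 : 0 < 1 - gam ^+ 2 <= 1.
  by rewrite subr_gt0 expr_lt1 ?(ltW gam0)// gam1 gerBl sqr_ge0.
have [g20 g21] := andP g2.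
have g4 : 0 < (1 - gam ^+ 2) ^+ 4 <= 1 by rewrite exprn_gt0//= exprn_ile1// ltW.
have [g40 g41] := andP g4.
have small : 22 * G ^+ 6 * eps <= 1.
  have r1 : (1 - gam ^+ 2) ^+ 4 / taubar ^+ 4 <= 1.
    rewrite ler_pdivrMr ?exprn_gt0 ?(lt_le_trans ltr01)// mul1r.
    by rewrite (le_trans g41)// exprn_ege1.
  have G17 : 0 < G ^- 17 by rewrite invr_gt0 exprn_gt0.
  have e2 : eps <= 22^-1 * G ^- 17.
    by apply: (le_trans epsc); rewrite ler_wpM2r ?(ltW G17)// ler_piMr// invr_ge0.
  have e3 : 22 * G ^+ 6 * eps <= 22 * G ^+ 6 * (22^-1 * G ^- 17).
    by rewrite ler_wpM2l// mulr_ge0// exprn_ge0// ltW.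
  apply: (le_trans e3); rewrite mulrACA divff// mul1r ler_pdivrMr ?exprn_gt0// mul1r.
  by rewrite ler_weXn2l.
have [v Nv wv] := Nnet w sw; have sv := Nsub v Nv.
have sQw := wsum_sym w sQ; have sSw := wsum_sym w sS.
have sQv := wsum_sym v sQ; have sSv := wsum_sym v sS.
have Qw1 := wsum_ge1 sw Q1; have Sw1 := wsum_ge1 sw S1.
have Qv1 := wsum_ge1 sv Q1; have Sv1 := wsum_ge1 sv S1.
(* The gain is produced with a vanishing gradient, which the comparison consumes; that it minimizes
   the estimated loss follows from it. *)
have [Khat sLhat Ehat0] := exists_optimal_gain sQv sSv Qv1 Sv1 stab0.
have Ao : opb (Ahat - A) eps by apply: opb_le Ae (opb_opnorm _).
have Bo : opb (Bhat - B) eps by apply: opb_le Be (opb_opnorm _).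
have Qo := wsum_diff_opb (ltW G0) QG wv; have So := wsum_diff_opb (ltW G0) SG wv.
have [sK' _] := certainty_transfer sQw sSw Qw1 Sw1 sQv sSv Qv1 Sv1 sL sLhat Ehat0
  G1 PG (ltW eps0) small Ao Bo Qo So.
have pert i := cost_perturbation sQw sSw Qw1 Sw1 sQv sSv Qv1 Sv1 sL sLhat E0 Ehat0
  G1 PG BG (ltW eps0) small Ao Bo Qo So (sQ i) (sS i) (QG i) (SG i).
have stK' := schur_spectral_radius sK'.
exists Khat; split=> //.
  exists v; first exact: Nv.
  exact: (optimal_gain_minimizer sg0 noise sQv sSv Qv1 Sv1 sLhat Ehat0).
have sg1 : sigma != 0 by rewrite gt_eqF.
set bound := (X in (_ <= X%:E)%E).
have mul0 : 0 <= sigma ^+ 2 * n%:R * G ^+ 13 * eps.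
  have s2 := sqr_ge0 sigma; have G13 : 0 <= G ^+ 13 by rewrite exprn_ge0// ltW.
  exact: mulr_ge0 (mulr_ge0 (mulr_ge0 s2 (ler0n _ _)) G13) (ltW eps0).
have X0 : 0 <= 2376 * (sigma ^+ 2 * n%:R * G ^+ 13 * eps).
  exact: mulr_ge0 (ler0n _ _) mul0.
have boundP : 2376 * (sigma ^+ 2 * n%:R * G ^+ 13 * eps) <= bound.
  (* The last factor is at least 1, as [G] and [taubar] are at least 1 and [1 - gam ^+ 2] lies
     between 0 and 1. *)
  have -> : bound = 2376 * (sigma ^+ 2 * n%:R * G ^+ 13 * eps) *
      (G ^+ 16 * (taubar ^+ 8 / (1 - gam ^+ 2) ^+ 4)).
    by rewrite /bound (exprD G 13 16 : G ^+ 29 = _); ring.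
  apply: (ler_peMr X0); rewrite mulr_ege1 ?exprn_ege1//.
  by rewrite ler_pdivlMr// mul1r (le_trans g41)// exprn_ege1.
have bound0 : 0 <= bound by exact: le_trans X0 boundP.
apply: bigmax_le; first by rewrite lee_fin.
move=> i _; rewrite (lqr_lossE sg0 noise (Q i) (S i) pf.1).
rewrite (lqr_lossE sg0 noise (Q i) (S i) stK').
rewrite -EFinB abse_EFin lee_fin -mulrBr normrM.
apply: le_trans boundP.
rewrite distrC (ger0_norm (ltW (gauss_m2_gt0 sg1))).
have -> : 2376 * (sigma ^+ 2 * n%:R * G ^+ 13 * eps) =
  (6 * sigma ^+ 2) * (396 * n%:R * G ^+ 13 * eps) by ring.
by apply: (ler_pM _ _ (gauss_m2_le sg1) (pert i)); [exact/ltW/gauss_m2_gt0|exact: normr_ge0].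
Qed.
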